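(* Let $\Omega\subset\mathbb{R}^2$ be a bounded open connected set with Lipschitz connected boundary $\Gamma=\partial\Omega$. For every integer $k\ge 1$ and every $\alpha\in(0,1]$, there exists $\rho_k^{\bigtriangledown}\in\mathcal{A}_\alpha$ with $$\lambda_k(\rho_k^{\bigtriangledown})=\inf_{\rho\in\mathcal{A}_\alpha}\lambda_k(\rho),$$ and there exists $\rho_k^{\triangle}\in\mathcal{A}_\alpha$ with $$\lambda_k(\rho_k^{\triangle})=\sup_{\rho\in\mathcal{A}_\alpha}\lambda_k(\rho).$$
   Context: Here $|\cdot|$ denotes arc-length measure on $\Gamma$ and $ds$ integration with respect to it. For $\rho\in L^\infty(\Gamma)$ with $\rho\ge 0$ a.e. and $\rho$ not a.e. zero, the weighted Steklov eigenproblem is: $\Delta u=0$ in $\Omega$, $\partial_n u=\lambda\rho u$ on $\Gamma$ (understood weakly: $\int_\Omega\nabla u\cdot\nabla v\,dx=\lambda\int_\Gamma\rho uv\,ds$ for all $v\in H^1(\Omega)$). Its eigenvalues, enumerated with multiplicity, are $0=\lambda_0(\rho)<\lambda_1(\rho)\le\lambda_2(\rho)\le\cdots\nearrow\infty$, and satisfy $$\lambda_k(\rho)=\min_{E_k\subset H^1(\Omega)}\ \max_{u\in E_k\setminus\{0\}}\frac{\int_\Omega|\nabla u|^2dx}{\int_\Gamma\rho u^2\,ds},$$ where $E_k$ ranges over $(k+1)$-dimensional subspaces of $H^1(\Omega)$ (and the quotient is $+\infty$ when the denominator vanishes). For $\alpha\in(0,1]$ the admissible set is $$\mathcal{A}_\alpha=\Big\{\rho\in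 L^\infty(\Gamma):\ 0\le\rho(s)\le1\text{ for a.e. }s\in\Gamma,\ \int_\Gamma\rho\,ds=\alpha|\Gamma|\Big\}.$$ *)

(* Defs.v *)
From HB Require Import structures.
From mathcomp Require Import all_boot all_order all_algebra.
From mathcomp Require Import all_classical all_reals all_analysis.
From mathcomp Require Import measurable_realfun.

Set Implicit Arguments.
Unset Strict Implicit.
Unset Printing Implicit Defensive.
Import Order.TTheory GRing.Theory Num.Theory numFieldNormedType.Exports.

Local Open Scope classical_set_scope.
Local Open Scope ring_scope.

(* lebesgue_measure lives on measurableTypeR R, that is R with its Borel
   sigma-algebra; R * R is viewed as the corresponding product. *)
Notation plane R := (measurableTypeR R * measurableTypeR R)%type.

Section ArcLength.
Context {R : realType}.
Local Open Scope ereal_scope.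
Implicit Types (A B C X : set (R * R)) (d : R).

(* The library norm on R * R is the max norm; lengths need the Euclidean one *)
Definition eucl_dist (x y : R * R) : R :=
  Num.sqrt ((x.1 - y.1) ^+ 2 + (x.2 - y.2) ^+ 2)%R.

(* The added 0 only matters for C = set0, whose supremum would be -oo *)
Definition diam C : \bar R :=
  ereal_sup (0 |` [set (eucl_dist z.1 z.2)%:E | z in C `*` C]).

Definition delta_cover d A : set ((set (R * R))^nat) :=
  [set F | A `<=` \bigcup_i F i /\ forall i, diam (F i) <= d%:E].

Definition hausdorff1_pre d A : \bar R :=
  ereal_inf [set \sum_(i <oo) diam (F i) | F in delta_cover d A].

(* One-dimensional Hausdorff measure: on a rectifiable curve it is arc length *)
Definition arclength : set (plane R) -> \bar R := fun A =>
  ereal_sup [set hausdorff1_pre d A | d in [set d : R | (0 < d)%R]].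

Lemma diam_ge0 C : 0 <= diam C.
Proof. by apply: ereal_sup_ubound; left. Qed.

Lemma diam0 : diam set0 = 0.
Proof.
apply/eqP; rewrite eq_le diam_ge0 andbT; apply: ge_ereal_sup => x [->//|].
by move=> [z [[]]].
Qed.

Lemma eucl_dist_le_diam C x y : C x -> C y -> (eucl_dist x y)%:E <= diam C.
Proof. by move=> Cx Cy; apply: ereal_sup_ubound; right; exists (x, y). Qed.

Lemma hausdorff1_pre_ge0 d A : 0 <= hausdorff1_pre d A.
Proof.
apply: le_ereal_inf_tmp => _ [F _ <-].
by apply: nneseries_ge0 => *; exact: diam_ge0.
Qed.

Lemma le_hausdorff1_pre d A B : A `<=` B ->
  hausdorff1_pre d A <= hausdorff1_pre d B.
Proof.
move=> AB; apply/ereal_inf_le_tmp => _ [F [BF dF] <-].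
by exists F => //; split => //; exact: subset_trans BF.
Qed.

Lemma hausdorff1_pre_anti d d' A : (d <= d')%R ->
  hausdorff1_pre d' A <= hausdorff1_pre d A.
Proof.
move=> dd'; apply/ereal_inf_le_tmp => _ [F [AF dF] <-].
by exists F => //; split => // i; rewrite (le_trans (dF i))// lee_fin.
Qed.

Lemma hausdorff1_pre_le d A : (0 < d)%R -> hausdorff1_pre d A <= arclength A.
Proof. by move=> d0; apply: ereal_sup_ubound; exists d. Qed.

Lemma arclength_ge0 A : 0 <= arclength A.
Proof.
exact: le_trans (hausdorff1_pre_ge0 1 A) (hausdorff1_pre_le A (@ltr01 R)).
Qed.

Lemma le_arclength : {homo arclength : A B / A `<=` B >-> A <= B}.
Proof.
move=> A B AB; apply: ge_ereal_sup => _ [d d0 <-].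
by rewrite (le_trans (le_hausdorff1_pre d AB))// hausdorff1_pre_le.
Qed.

Lemma arclength0 : arclength set0 = 0.
Proof.
apply/eqP; rewrite eq_le arclength_ge0 andbT; apply: ge_ereal_sup => _ [d d0 <-].
apply: ereal_inf_lbound; exists (fun=> set0).
  by split => // i; rewrite diam0 lee_fin ltW.
by rewrite eseries0// => *; exact: diam0.
Qed.

Lemma hausdorff1_pre_sigma_subadditive d : (0 < d)%R ->
  sigma_subadditive (hausdorff1_pre d).
Proof.
move=> d0 A; have [[i ioo]|] := pselect (exists i, hausdorff1_pre d (A i) = +oo).
  rewrite (eseries_pinfty _ _ ioo) ?leey// => n _.
  by rewrite -ltNye (lt_le_trans _ (hausdorff1_pre_ge0 _ _)).
rewrite -forallNE => Aoo.
suff add2e (e : {posnum R}) : hausdorff1_pre d (\bigcup_n A n) <=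
    \sum_(i <oo) hausdorff1_pre d (A i) + e%:num%:E.
  by apply/lee_addgt0Pr => _/posnumP[].
rewrite (le_trans _ (epsilon_trick _ _ _))//; last first.
  by move=> n; exact: hausdorff1_pre_ge0.
pose P n (B : (set (R * R))^nat) := delta_cover d (A n) B /\
  \sum_(k <oo) diam (B k) <= hausdorff1_pre d (A n) + (e%:num / (2 ^ n.+1)%:R)%:E.
have [G PG] : {G : ((set (R * R))^nat)^nat & forall n, P n (G n)}.
  apply: (@choice _ _ P) => n; rewrite /P /hausdorff1_pre.
  set S := (X in ereal_inf X); move infS : (ereal_inf S) => iS.
  case: iS infS => [r Sr|Soo|Soo].
  - have en1 : (0 < e%:num / (2 ^ n.+1)%:R)%R by [].
    have /(lb_ereal_inf_adherent en1) : ereal_inf S \is a fin_num by rewrite Sr.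
    move=> [x [B AnB muBx] xS].
    by exists B; split => //; rewrite muBx -Sr; exact/ltW.
  - by have := Aoo n; rewrite /hausdorff1_pre Soo.
  - have : 0 <= ereal_inf S by exact: hausdorff1_pre_ge0.
    by rewrite Soo.
have muG_ge0 x : 0 <= (diam \o uncurry G) x by exact: diam_ge0.
apply: (@le_trans _ _ (\esum_(i in setT) (diam \o uncurry G) i)).
  apply: ereal_inf_lbound => /=.
  have /card_esym/ppcard_eqP[f] := card_nat2.
  exists (uncurry G \o f).
    split=> [t [n _]|i]; last by rewrite /= /uncurry; case: (f i) => a b; exact: (PG a).1.2.
    move=> /(PG n).1.1[j _ Gt]; exists (f^-1%FUN (n, j)) => //=.
    by rewrite invK ?inE.
  rewrite -(esum_pred_image (diam \o uncurry G) _ xpredT) ?[fun=> _]set_true//.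
  by rewrite image_eq.
rewrite (_ : esum _ _ = \sum_(i <oo) \sum_(j <oo ) diam (G i j)); last first.
  pose J : nat -> set (nat * nat) := fun i => [set (i, j) | j in setT].
  rewrite (_ : setT = \bigcup_k J k); last first.
    by rewrite predeqE => -[a b]; split => // _; exists a => //; exists b.
  rewrite esum_bigcupT /=; last 2 first.
    - apply/trivIsetP => i j _ _ ij.
      rewrite predeqE => -[n m] /=; split => //= -[] [_] _ [<-{n} _].
      by move=> [m' _] [] /esym/eqP; rewrite (negbTE ij).
    - by move=> /= [n m]; exact: diam_ge0.
  rewrite -(image_id [set: nat]) -fun_true esum_pred_image//; last first.
    by move=> n _; apply: esum_ge0 => *; exact: diam_ge0.
  apply: eq_eseriesr => /= j _.
  rewrite -(esum_pred_image (diam \o uncurry G) (pair j) predT)//=;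
    [|by move=> *; exact: diam_ge0|by move=> ? ? _ _; exact: (@can_inj _ _ _ snd)].
  by congr esum; rewrite predeqE => -[a b]; split; move=> [i _ <-]; exists i.
apply: lee_nneseries => [i _ _|i _]; last exact: (PG i).2.
by apply: nneseries_ge0 => m *; exact: diam_ge0.
Qed.

Lemma arclength_sigma_subadditive : sigma_subadditive arclength.
Proof.
move=> A; apply: ge_ereal_sup => _ [d d0 <-].
apply: le_trans (hausdorff1_pre_sigma_subadditive d0 A) _.
apply: lee_nneseries => [i _ _|i _]; first exact: hausdorff1_pre_ge0.
exact: hausdorff1_pre_le.
Qed.

HB.instance Definition _ := isOuterMeasure.Build R (plane R) arclength
  arclength0 arclength_ge0 le_arclength arclength_sigma_subadditive.

Lemma arclength_separated (f : R * R -> R) (a b : R) A B :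
  (forall x y, f x - f y <= eucl_dist x y)%R -> (a < b)%R ->
  A `<=` [set x | f x <= a]%R -> B `<=` [set x | b <= f x]%R ->
  arclength A + arclength B <= arclength (A `|` B).
Proof.
move=> f_lip ab Aa Bb.
have main d : (0 < d)%R -> (d < b - a)%R ->
    hausdorff1_pre d A + hausdorff1_pre d B <= arclength (A `|` B).
  move=> d0 dab; apply: le_trans (hausdorff1_pre_le _ d0).
  apply: le_ereal_inf_tmp => _ [F [ABF dF] <-].
  pose FA i := F i `&` [set x | f x <= a]%R; pose FB i := F i `&` [set x | b <= f x]%R.
  have subdiam C D : C `<=` D -> diam C <= diam D.
    move=> CD; apply: ge_ereal_sup => t [->|[[x y] [/= Cx Cy] <-]].
      exact: diam_ge0.
    by apply: eucl_dist_le_diam; exact: CD.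
  have leA i : diam (FA i) <= diam (F i) by apply: subdiam => x [].
  have leB i : diam (FB i) <= diam (F i) by apply: subdiam => x [].
  apply: (@le_trans _ _ (\sum_(i <oo) diam (FA i) + \sum_(i <oo) diam (FB i))).
    apply: leeD; apply: ereal_inf_lbound.
      exists FA => //; split=> [x Ax|i]; last exact: le_trans (leA i) (dF i).
      by have [|i _ Fix] := ABF x; [left|exists i => //; split => //; exact: Aa].
    exists FB => //; split=> [x Bx|i]; last exact: le_trans (leB i) (dF i).
    by have [|i _ Fix] := ABF x; [right|exists i => //; split => //; exact: Bb].
  rewrite -nneseriesD; [|by move=> *; exact: diam_ge0..].
  apply: lee_nneseries => [i _ _|i _]; first by rewrite adde_ge0// diam_ge0.
  have [[x [Fx fx]]|] := pselect (FA i !=set0); last first.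
    by move/set0P/negP; rewrite negbK => /eqP ->; rewrite diam0 add0e.
  suff -> : FB i = set0 by rewrite diam0 adde0.
  rewrite -subset0 => y [Fy fy].
  have := le_trans (eucl_dist_le_diam Fy Fx) (dF i); rewrite lee_fin leNgt => /negP.
  apply; apply: lt_le_trans (f_lip y x); apply: lt_le_trans dab _.
  exact: lerB.
have ba0 : (0 < (b - a) / 2)%R by rewrite divr_gt0 ?subr_gt0.
have ltba : ((b - a) / 2 < b - a)%R by rewrite gtr_pMr ?subr_gt0// invf_lt1 ?ltr1n.
have step (d : R) (d' : R) : (0 < d)%R -> (0 < d')%R ->
    hausdorff1_pre d A + hausdorff1_pre d' B <= arclength (A `|` B).
  move=> d0 d'0; pose m := Num.min (Num.min d d') ((b - a) / 2)%R.
  have m0 : (0 < m)%R by rewrite !lt_min d0 d'0.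
  have mba : (m < b - a)%R by rewrite gt_min ltba orbT.
  apply: le_trans (main m m0 mba); apply: leeD; apply: hausdorff1_pre_anti;
    by rewrite !ge_min lexx ?orbT.
have [->|Hoo] := eqVneq (arclength (A `|` B)) +oo; first by rewrite leey.
have Hfin C : C `<=` A `|` B -> arclength C \is a fin_num.
  move=> /le_arclength CAB; rewrite ge0_fin_numE ?arclength_ge0//.
  by rewrite (le_lt_trans CAB)// ltey.
have prefin d C : (0 < d)%R -> C `<=` A `|` B -> hausdorff1_pre d C \is a fin_num.
  move=> d0 /Hfin; rewrite !ge0_fin_numE ?arclength_ge0 ?hausdorff1_pre_ge0//.
  by apply: le_lt_trans; exact: hausdorff1_pre_le.
have sA : A `<=` A `|` B by left.
have sB : B `<=` A `|` B by right.
rewrite -leeBrDr ?Hfin//; apply: ge_ereal_sup => _ [d d0 <-].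
rewrite leeBrDr ?Hfin// addeC -leeBrDr ?prefin//.
apply: ge_ereal_sup => _ [d' d'0 <-]; rewrite leeBrDr ?prefin// addeC.
exact: step.
Qed.

Lemma arclength_halfspace (f : R * R -> R) (a : R) :
  (forall x y, f x - f y <= eucl_dist x y)%R ->
  arclength.-caratheodory [set x | a < f x]%R.
Proof.
move=> f_lip; apply: le_caratheodory_measurable => X /=.
have [->|Xoo] := eqVneq (arclength X) +oo; first by rewrite leey.
pose e n : R := (n.+1%:R^-1)%R.
have e_gt0 n : (0 < e n)%R by rewrite /e invr_gt0.
have e_lt m n : (m < n)%N -> (e n < e m)%R.
  by move=> mn; rewrite /e ltf_pV2 ?posrE// ltr_nat.
have e_le m n : (m <= n)%N -> (e n <= e m)%R.
  by move=> mn; rewrite /e lef_pV2 ?posrE// ler_nat.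
pose E n := X `&` [set x | a + e n <= f x]%R.
pose L n := X `&` [set x | a + e n.+1 <= f x < a + e n]%R.
have EX n : E n `<=` X by move=> x [].
have sumL N : \sum_(0 <= n < N.+1) arclength (L n) <=
    arclength (E N.+1) + arclength (E N).
  elim: N => [|N ih].
    rewrite big_nat1 -[leLHS]adde0 leeD ?arclength_ge0//.
    by apply: le_arclength => x [Xx /andP[? _]].
  rewrite big_nat_recr//= (le_trans (leeD2r _ ih))// -addeA addeC.
  apply: leeD2r; rewrite addeC.
  apply: (@le_trans _ _ (arclength (L N.+1 `|` E N))).
    apply: (@arclength_separated f (a + e N.+1) (a + e N)) => //.
    - by rewrite ltrD2l e_lt.
    - by move=> x [_ /andP[_ /ltW]].
    - by move=> x [].
  apply: le_arclength => x [[Xx /andP[? _]]|[Xx /= fx]]; split => //=.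
  by rewrite (le_trans _ fx)// lerD2l e_le// ltnW.
have Lfin : \sum_(0 <= n <oo) arclength (L n) < +oo.
  apply: (@le_lt_trans _ _ (arclength X + arclength X)).
    apply: lime_le; first by apply: is_cvg_nneseries => *; exact: arclength_ge0.
    apply: nearW => -[|N]; first by rewrite big_geq// adde_ge0// arclength_ge0.
    by rewrite (le_trans (sumL N))// leeD// le_arclength.
  by rewrite lte_add_pinfty// ltey.
have /fine_cvgP[_ /cvgrPdist_lt tail] :=
  nneseries_tail_cvg Lfin (fun k _ => arclength_ge0 (L k)).
apply/lee_addgt0Pr => eps eps0.
have [N _ /(_ N (leqnn N))] := tail eps eps0.
set t := (X in (`|0 - fine X|)%R); rewrite /= sub0r normrN => ltN.
have t_ge0 : 0 <= t by apply: nneseries_ge0 => *; exact: arclength_ge0.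
have t_le : t <= eps%:E.
  have tfin : t \is a fin_num.
    rewrite ge0_fin_numE//; apply: le_lt_trans Lfin.
    rewrite [leRHS](nneseries_split _ N) ?add0n => [|*]; last exact: arclength_ge0.
    by rewrite leeDr// sume_ge0// => *; exact: arclength_ge0.
  by rewrite -(fineK tfin) lee_fin (le_trans (ler_norm _))// ltW.
have cover : X `&` [set x | a < f x]%R `<=` E N `|` \bigcup_(n in ~` `I_N) L n.
  move=> x [Xx /= afx]; have [fxN|fxN] := leP (a + e N)%R (f x); first by left.
  have exm : exists m, (a + e m <= f x)%R.
    by have [m am] := ltr_add_invr afx; exists m; exact: ltW.
  right; case: (ex_minnP exm) => -[|m] fm min_m.
    by have := le_lt_trans fm fxN; rewrite ltrD2l ltNge e_le.
  have fxm : (f x < a + e m)%R by rewrite ltNge; apply/negP => /min_m; rewrite ltnn.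
  exists m; last by split => //=; rewrite fm fxm.
  by move=> /= mN; have := le_lt_trans fm fxN; rewrite ltrD2l ltNge e_le.
apply: (@le_trans _ _ ((arclength (E N) + t) + arclength (X `&` ~` [set x | a < f x]%R))).
  rewrite leeD2r//; apply: le_trans (le_arclength cover) _.
  apply: le_trans (outer_measureU2 arclength _ _) _; rewrite leeD2l//.
  exact: (@outer_measure_sigma_subadditive_tail _ _ arclength).
rewrite -addeA [t + _]addeC addeA leeD//.
rewrite addeC; apply: le_trans (le_arclength (_ : (X `&` ~` [set x | a < f x]%R) `|` E N `<=` X)).
  apply: (@arclength_separated f a (a + e N)) => //.
  - by rewrite ltrDl.
  - by move=> x [_ /= /negP]; rewrite -leNgt.
  - by move=> x [].
by move=> x [[]|[]].
Qed.

Lemma eucl_dist_fst (x y : R * R) : (x.1 - y.1 <= eucl_dist x y)%R.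
Proof.
apply: le_trans (ler_norm _) _; rewrite -sqrtr_sqr ler_wsqrtr// lerDl.
exact: sqr_ge0.
Qed.

Lemma eucl_dist_snd (x y : R * R) : (x.2 - y.2 <= eucl_dist x y)%R.
Proof.
apply: le_trans (ler_norm _) _; rewrite -sqrtr_sqr ler_wsqrtr// lerDr.
exact: sqr_ge0.
Qed.

Lemma measurable_caratheodory_arclength (A : set (plane R)) :
  measurable A -> arclength.-caratheodory A.
Proof.
have cara_fun (f : R * R -> R) : (forall x y, f x - f y <= eucl_dist x y)%R ->
    measurable_fun setT (f : caratheodory_type arclength -> R).
  move=> f_lip; apply: (measurability _ (RGenOInfty.measurableE R)).
  move=> _ [_ [a ->] <-]; rewrite setTI.
  have := arclength_halfspace a f_lip; congr (_ _).
  by apply/seteqP; split => x /=; rewrite in_itv/= andbT.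
have sa : sigma_algebra setT (arclength.-caratheodory : set (set (R * R))).
  exact: (@sigma_algebra_measurable _ (caratheodory_type (@arclength))).
apply: (smallest_sub sa) => B [] [C mC <-].
  exact: (cara_fun _ eucl_dist_fst measurableT).
exact: (cara_fun _ eucl_dist_snd measurableT).
Qed.

Lemma arclength_semi_sigma_additive :
  semi_sigma_additive arclength.
Proof.
move=> F mF tF _; apply: (@caratheodory_measure_sigma_additive R (plane R)
  arclength) => // [i|].
  exact: measurable_caratheodory_arclength.
by apply: caratheodory_measurable_bigcup => i; exact: measurable_caratheodory_arclength.
Qed.

HB.instance Definition _ := isMeasure.Build _ (plane R) R arclength
  arclength0 arclength_ge0 arclength_semi_sigma_additive.

End ArcLength.

Section Domain.
Context {R : realType}.
Implicit Types (Omega : set (R * R)) (p x : R * R).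

Definition boundary Omega : set (R * R) := closure Omega `\` interior Omega.

(* Near each boundary point, in Cartesian coordinates centred there and rotated
   by the rotation of matrix ((c, s), (-s, c)), the domain is the strict
   epigraph of a Lipschitz function *)
Definition lipschitz_boundary Omega : Prop :=
  forall p, boundary Omega p -> exists (r c s : R) (phi : R -> R),
    [/\ 0 < r, c ^+ 2 + s ^+ 2 = 1, lipschitz phi &
      forall x, eucl_dist x p < r ->
        (Omega x <-> phi (c * (x.1 - p.1) + s * (x.2 - p.2)) <
                     - s * (x.1 - p.1) + c * (x.2 - p.2))].

End Domain.

Section Sobolev.
Context {R : realType}.
Implicit Types (Omega : set (R * R)) (u v f g h phi : R * R -> R)
  (G H : R * R -> R * R).

Definition area : set (plane R) -> \bar R :=
  (@lebesgue_measure R \x @lebesgue_measure R)%E.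

HB.instance Definition _ := Measure.on area.

Definition d1 f : R * R -> R := 'D_((1, 0) : R * R) f.
Definition d2 f : R * R -> R := 'D_((0, 1) : R * R) f.

Definition C1 f : Prop :=
  [/\ forall x, differentiable f x, continuous (d1 f) & continuous (d2 f)].

(* Testing with compactly supported C^1 functions defines the same weak
   derivatives as testing with smooth ones *)
Definition test_function Omega phi : Prop :=
  [/\ C1 phi, compact (closure [set x | phi x != 0]) &
      closure [set x | phi x != 0] `<=` Omega].

Definition L2 (mu : set (plane R) -> \bar R) (D : set (R * R)) f : Prop :=
  measurable_fun D (f : plane R -> R) /\ (\int[mu]_(x in D) ((f x) ^+ 2)%:E < +oo)%E.

(* sobolev Omega u G : u is in H^1(Omega) and its weak gradient is G *)
Definition sobolev Omega u G : Prop :=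
  [/\ L2 area Omega u, L2 area Omega (fst \o G), L2 area Omega (snd \o G) &
    forall phi, test_function Omega phi ->
      (\int[area]_(x in Omega) (u x * d1 phi x)%:E =
         - \int[area]_(x in Omega) ((G x).1 * phi x)%:E)%E /\
      (\int[area]_(x in Omega) (u x * d2 phi x)%:E =
         - \int[area]_(x in Omega) ((G x).2 * phi x)%:E)%E].

(* trace Omega u G g : g is the trace of the function u of H^1(Omega), G being
   the gradient of u. This is the graph of the trace operator: on a bounded
   Lipschitz domain the restrictions of C^1 functions are dense in H^1(Omega),
   and f |-> f|_boundary extends continuously to H^1(Omega) -> L^2(boundary).
   In particular every u in H^1(Omega) has a trace, unique up to null sets. *)
Definition trace Omega u G g : Prop :=
  L2 arclength (boundary Omega) g /\
  exists f : nat -> R * R -> R,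
    [/\ forall n, C1 (f n),
      (\int[area]_(x in Omega) ((f n x - u x) ^+ 2)%:E)%E @[n --> \oo] --> 0%E,
      (\int[area]_(x in Omega)
        ((d1 (f n) x - (G x).1) ^+ 2 + (d2 (f n) x - (G x).2) ^+ 2)%:E)%E
        @[n --> \oo] --> 0%E &
      (\int[arclength]_(x in boundary Omega) ((f n x - g x) ^+ 2)%:E)%E
        @[n --> \oo] --> 0%E].

End Sobolev.

Section Steklov.
Context {R : realType}.
Implicit Types (Omega : set (R * R)) (rho u v g h : R * R -> R)
  (G H : R * R -> R * R) (lam alpha : R) (k : nat).

(* lam and u satisfy the weak form of Delta u = 0 in Omega,
   d_n u = lam rho u on the boundary; u = 0 is not excluded here. *)
Definition steklov_solution Omega rho lam u : Prop :=
  exists G g, [/\ sobolev Omega u G, trace Omega u G g &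
    forall v H h, sobolev Omega v H -> trace Omega v H h ->
      (\int[area]_(x in Omega) ((G x).1 * (H x).1 + (G x).2 * (H x).2)%:E =
       lam%:E * \int[arclength]_(x in boundary Omega)
                  (rho x * g x * h x)%:E)%E].

(* Linear independence in H^1(Omega), whose elements are classes modulo
   equality almost everywhere *)
Definition independent Omega n (u : 'I_n -> R * R -> R) : Prop :=
  forall c : 'I_n -> R,
    {ae area, forall x, Omega x -> \sum_(i < n) c i * u i x = 0} ->
    forall i, c i = 0.

(* The k-th eigenvalue, counted from 0 and with multiplicity: the least t such
   that the eigenvalues not exceeding t have at least k + 1 linearly independent
   eigenfunctions in total. *)
Definition steklov_eigenvalue Omega rho k : \bar R :=
  ereal_inf [set t%:E | t in [set t : R |
    exists2 u : 'I_k.+1 -> R * R -> R, independent Omega u &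
      forall i, exists2 lam, lam <= t & steklov_solution Omega rho lam (u i)]].

Definition admissible Omega alpha : set (R * R -> R) :=
  [set rho | [/\ measurable_fun (boundary Omega) (rho : plane R -> R),
    {ae arclength, forall x, boundary Omega x -> 0 <= rho x <= 1} &
    (\int[arclength]_(x in boundary Omega) (rho x)%:E =
     alpha%:E * arclength (boundary Omega))%E]].

End Steklov.

(* Main.v *)
(* The eigenvalue lambda_k(rho) is at most t exactly when there is a k+1
   dimensional b_rho-orthonormal family of eigenvectors with eigenvalues at most
   t, where b_rho(u, v) is the integral of rho u v over the boundary.  Admissible
   densities are weakly compact, and b_rho(u, v) is continuous in rho for fixed u
   and v.  A Rellich inequality, bounding the L^2 mass on the domain and on its
   boundary by finitely many squared averages over squares plus eps times the
   Dirichlet energy, makes the L^2 norms compact with respect to energy.  With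
   the constants (on a connected domain) as the only functions of zero energy,
   this gives a coercivity constant common to all admissible rho.  Along an
   ultrafilter, normalized eigenvectors then converge strongly in H^1 to
   eigenvectors of the limit density, so lambda_k is lower semicontinuous; the
   eigenvectors of the limit density are test functions for the approximating
   ones, so lambda_k is upper semicontinuous.  Both extrema are thus attained. *)

From HB Require Import structures.
Require Import Defs.
From mathcomp Require Import all_boot all_order all_algebra.
From mathcomp Require Import all_classical all_reals all_analysis.
From mathcomp Require Import measurable_realfun.
From mathcomp Require Import ring lra.
Import Order.TTheory GRing.Theory Num.Theory numFieldNormedType.Exports.
Local Open Scope classical_set_scope.
Local Open Scope ring_scope.

Set Implicit Arguments.
Unset Strict Implicit.
Unset Printing Implicit Defensive.

(** * Abstract eigenvalue problem and its dependence on the weight *)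

(** The obstacle is that a density may vanish on most of the boundary and varies only weakly:
    [b_rho] alone controls no norm, and weak limits of densities pair only with fixed products of
    traces. Two forms independent of rho therefore carry the analysis, the energy [a] and the mass
    [b0] of the domain and the boundary together. Every [b_rho] lies below [b0], so weakly
    convergent densities can be paired with strongly convergent eigenvectors. Degeneration is
    excluded by the prescribed integral of rho, which is the value of [b_rho] on the constant 1.
    Functions are not identified modulo null sets, so the forms are only positive semidefinite. An
    element of H^1 is a tuple of a function, its boundary values and its two derivatives, in the
    closure of the tuples given by C^1 functions: inequalities between continuous quadratic forms
    extend from C^1 functions to this closure, and [trace] becomes membership in it. Ultrafilters
    stand in for subsequences: a single one gives the limits of the densities against all pairs of
    traces at once. *)

Section SemiInner.
Context {R : realType} {V : lmodType R}.
Implicit Types (q : V -> V -> R) (x y z : V).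

Definition semi_inner q : Prop :=
  [/\ forall x y, q x y = q y x,
      forall c x y z, q (c *: x + y) z = c * q x z + q y z &
      forall x, 0 <= q x x].

Definition seminorm q x : R := Num.sqrt (q x x).

Section OneForm.
Variable q : V -> V -> R.
Hypothesis qI : semi_inner q.

Lemma siC x y : q x y = q y x. Proof. by case: qI. Qed.
Lemma si_ge0 x : 0 <= q x x. Proof. by case: qI. Qed.
Lemma siDl x y z : q (x + y) z = q x z + q y z.
Proof. by case: qI => _ /(_ 1 x y z); rewrite scale1r mul1r. Qed.
Lemma si0l z : q 0 z = 0.
Proof. by have := siDl 0 0 z; rewrite addr0 => /eqP; rewrite eq_sym -subr_eq0 addrK => /eqP. Qed.
Lemma siZl c x z : q (c *: x) z = c * q x z.
Proof. by case: qI => _ /(_ c x 0 z); rewrite addr0 si0l addr0. Qed.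
Lemma siNl x z : q (- x) z = - q x z.
Proof. by rewrite -scaleN1r siZl mulN1r. Qed.
Lemma siBl x y z : q (x - y) z = q x z - q y z.
Proof. by rewrite siDl siNl. Qed.
Lemma siDr x y z : q z (x + y) = q z x + q z y.
Proof. by rewrite ![q z _]siC siDl. Qed.
Lemma siZr c x z : q z (c *: x) = c * q z x.
Proof. by rewrite ![q z _]siC siZl. Qed.
Lemma siBr x y z : q z (x - y) = q z x - q z y.
Proof. by rewrite ![q z _]siC siBl. Qed.
Lemma si_suml I (r : seq I) (F : I -> V) z :
  q (\sum_(i <- r) F i) z = \sum_(i <- r) q (F i) z.
Proof.
elim: r => [|i r ih]; first by rewrite !big_nil si0l.
by rewrite !big_cons siDl ih.
Qed.
Lemma si_sqD x y : q (x + y) (x + y) = q x x + 2 * q x y + q y y.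
Proof. by rewrite !(siDl, siDr) (siC y x); ring. Qed.
Lemma si_sqB x y : q (x - y) (x - y) = q x x - 2 * q x y + q y y.
Proof. by rewrite !(siBl, siBr) (siC y x); ring. Qed.
Lemma si_sqZ c x : q (c *: x) (c *: x) = c ^+ 2 * q x x.
Proof. by rewrite siZl siZr mulrA expr2. Qed.
Lemma si_sqBC x y : q (x - y) (x - y) = q (y - x) (y - x).
Proof. by rewrite !si_sqB (siC y x); ring. Qed.

Lemma si_CS x y : q x y ^+ 2 <= q x x * q y y.
Proof.
have [q0|qn0] := eqVneq (q y y) 0.
  rewrite q0 mulr0; suff -> : q x y = 0 by rewrite expr0n.
  apply/eqP/negP => /negP n0.
  (* When [q y y] is 0 the square is affine in the coefficient, and this coefficient makes it equal
     to -1. *)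
  have := si_ge0 (x - ((q x x + 1) / (2 * q x y)) *: y).
  rewrite si_sqB si_sqZ q0 mulr0 addr0 siZr.
  rewrite (_ : 2 * _ = q x x + 1); last by field.
  by move=> ?; lra.
have := si_ge0 (x - (q x y / q y y) *: y).
rewrite si_sqB si_sqZ siZr.
have q0 : 0 < q y y by rewrite lt_def qn0 si_ge0.
rewrite (_ : _ + _ = (q x x * q y y - q x y ^+ 2) / q y y); last by field.
by rewrite pmulr_lge0 ?invr_gt0// subr_ge0.
Qed.

Lemma seminorm_ge0 x : 0 <= seminorm q x. Proof. exact: sqrtr_ge0. Qed.
Lemma seminorm_sq x : seminorm q x ^+ 2 = q x x.
Proof. by rewrite sqr_sqrtr// si_ge0. Qed.
Lemma si_le_seminorm x y : `|q x y| <= seminorm q x * seminorm q y.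
Proof.
rewrite -sqrtrM ?si_ge0// -sqrtr_sqr ler_wsqrtr//; exact: si_CS.
Qed.
Lemma seminormD x y : seminorm q (x + y) <= seminorm q x + seminorm q y.
Proof.
rewrite -[leRHS]ger0_norm ?addr_ge0 ?seminorm_ge0// -sqrtr_sqr.
rewrite ler_wsqrtr// sqrrD !seminorm_sq si_sqD lerD2r lerD2l.
rewrite -[leRHS]mulr_natl ler_wpM2l//.
exact: le_trans (ler_norm _) (si_le_seminorm _ _).
Qed.
Lemma seminormBC x y : seminorm q (x - y) = seminorm q (y - x).
Proof. by rewrite /seminorm si_sqBC. Qed.
Lemma seminormZ c x : seminorm q (c *: x) = `|c| * seminorm q x.
Proof. by rewrite /seminorm si_sqZ sqrtrM ?sqr_ge0// sqrtr_sqr. Qed.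
Lemma seminorm_eq0 x : q x x = 0 -> seminorm q x = 0.
Proof. by rewrite /seminorm => ->; rewrite sqrtr0. Qed.
Lemma seminorm_le x (e : R) : 0 <= e -> (seminorm q x <= e) = (q x x <= e ^+ 2).
Proof. by move=> e0; rewrite -seminorm_sq ler_sqr ?nnegrE ?seminorm_ge0. Qed.

End OneForm.

Lemma seminorm_dom q p x : semi_inner p -> semi_inner q -> (forall x, q x x <= p x x) ->
  seminorm q x <= seminorm p x.
Proof. by move=> pI qI qp; rewrite ler_wsqrtr. Qed.

Lemma semi_innerD q p : semi_inner q -> semi_inner p ->
  semi_inner (fun x y => q x y + p x y).
Proof.
move=> qI pI; split => [x y|c x y z|x].
- by rewrite (siC qI) (siC pI).
- by rewrite (siDl qI) (siDl pI) (siZl qI) (siZl pI); ring.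
- by rewrite addr_ge0 ?(si_ge0 qI) ?(si_ge0 pI).
Qed.

End SemiInner.

(** * Limits along ultrafilters and completeness for seminorms *)

Section Ultra.
Context {R : realType}.

Lemma fmap_ultra T U (f : T -> U) (F : set_system T) :
  UltraFilter F -> UltraFilter (f @ F).
Proof.
move=> FU; split; first exact: fmap_proper_filter.
move=> G GP FG; apply/seteqP; split => // A GA.
have [//|FA] := in_ultra_setVsetC (f @^-1` A) FU.
have G0 : G set0 by rewrite -(setICr A); apply: filterI => //; exact: FG.
by case: (filter_not_empty _ G0).
Qed.

Lemma ultra_cvg (F : set_system nat) (x : nat -> R) (C : R) :
  UltraFilter F -> (\forall n \near F, `|x n| <= C) -> exists l : R, x n @[n --> F] --> l.
Proof.
move=> FU xC; have := @segment_compact R (- C) C; rewrite compact_ultra.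
move=> /(_ (x @ F) (fmap_ultra _ FU)) [|l [_ xl]]; last by exists l.
by rewrite /nbhs/=; near=> n; rewrite /= in_itv/= -ler_norml; near: n.
Unshelve. all: by end_near. Qed.

End Ultra.

Section Convergence.
Context {R : realType} {V : lmodType R}.
Implicit Types (q : V -> V -> R) (x : nat -> V).

Lemma si_sqD_le q (u v : V) : semi_inner q ->
  q (u + v) (u + v) <= 2 * q u u + 2 * q v v.
Proof.
move=> qI; have := si_ge0 qI (u - v); rewrite (si_sqB qI) (si_sqD qI) => ?; lra.
Qed.

Definition si_complete q : Prop := forall x : nat -> V,
  (forall e : R, 0 < e -> exists N : nat, forall n m, (N <= n)%N -> (N <= m)%N ->
     q (x n - x m) (x n - x m) <= e) ->
  exists y, forall e : R, 0 < e -> exists N : nat, forall n, (N <= n)%N ->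
     q (x n - y) (x n - y) <= e.

(** Relative to a filter, so that along an ultrafilter compactness can be stated for the whole
    sequence. *)
Definition si_cauchy (F : set_system nat) q x : Prop := forall e : R, 0 < e ->
  exists2 A, F A & forall n m, A n -> A m -> q (x n - x m) (x n - x m) <= e.

(** Completeness speaks of sequences, so the limit comes from indices [nk k] picked in the
    decreasing members [B k] of the filter; the members [A k] then compare all of [x] with that
    sequence. *)
Lemma si_complete_filter (F : set_system nat) q x : ProperFilter F ->
  semi_inner q -> si_complete q -> si_cauchy F q x ->
  exists y, q (x n - y) (x n - y) @[n --> F] --> (0 : R).
Proof.
move=> FF qI qC xC.
have /choice[A HA] (k : nat) : exists A, F A /\
    forall n m, A n -> A m -> q (x n - x m) (x n - x m) <= k.+1%:R^-1.
  by have [|A FA HA] := xC k.+1%:R^-1; [rewrite invr_gt0|exists A].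
pose B k := [set n | forall i, (i <= k)%N -> A i n].
have FB k : F (B k).
  elim: k => [|k ih].
    by apply: filterS (HA 0%N).1 => n A0 i; rewrite leqn0 => /eqP ->.
  apply: filterS (filterI ih (HA k.+1).1) => n [Bn An] i.
  by rewrite leq_eqVlt => /predU1P[->//|]; exact: Bn.
have /choice[nk Hnk] (k : nat) : exists n, B k n by exact: filter_ex (FB k).
have small (e : R) : 0 < e -> exists N : nat, N.+1%:R^-1 <= e.
  by move=> e0; have [N] := ltr_add_invr (e0 : 0 < e); rewrite add0r => /ltW ?; exists N.
have [|y Hy] := qC (x \o nk).
  move=> e /small[N Ne]; exists N => n m Nn Nm.
  by apply: le_trans Ne => /=; apply: (HA N).2; exact: Hnk.
exists y; apply/cvgrPdist_le => e e0.
have [N Ne] := small (e / 4) ltac:(lra).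
have [M HM] := Hy (e / 4) ltac:(lra).
apply: filterS (HA N).1 => n An.
rewrite sub0r normrN ger0_norm ?(si_ge0 qI)//.
pose k := maxn N M.
have -> : x n - y = (x n - x (nk k)) + (x (nk k) - y) by rewrite addrA subrK.
apply: le_trans (si_sqD_le _ _ qI) _.
have := le_trans ((HA N).2 _ _ An (Hnk k _ (leq_maxl N M))) Ne.
have := HM k (leq_maxr N M) => /= ? ?; lra.
Qed.

(** The forms [b n] vary, but all lie below [p]: expanding around [u] and [v], the error terms are
    bounded by Cauchy-Schwarz uniformly in [n]. Strong convergence of the vectors thus makes up for
    forms that converge only at fixed vectors. *)
Lemma si_cvg (F : set_system nat) p (b : nat -> V -> V -> R) (l : R) x (y : nat -> V) (u v : V) :
  ProperFilter F -> semi_inner p ->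
  (forall n, semi_inner (b n)) -> (forall n w, b n w w <= p w w) ->
  p (x n - u) (x n - u) @[n --> F] --> (0 : R) ->
  p (y n - v) (y n - v) @[n --> F] --> (0 : R) ->
  b n u v @[n --> F] --> l ->
  b n (x n) (y n) @[n --> F] --> l.
Proof.
move=> FF pI bI bp xu yv bl.
have snx : seminorm p (x n - u) @[n --> F] --> (0 : R).
  by rewrite -[X in _ --> X]sqrtr0; apply: continuous_cvg => //; exact: sqrt_continuous.
have sny : seminorm p (y n - v) @[n --> F] --> (0 : R).
  by rewrite -[X in _ --> X]sqrtr0; apply: continuous_cvg => //; exact: sqrt_continuous.
have -> : l = l + 0 by rewrite addr0.
have -> : (fun n => b n (x n) (y n)) =
    (fun n => b n u v + (b n (x n - u) (y n - v) + (b n (x n - u) v + b n u (y n - v)))).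
  apply/funext => n; have bn := bI n.
  by rewrite !(siBl bn, siBr bn); ring.
apply: cvgD => //.
apply: (@squeeze_cvgr _ F _ _ (fun n =>
  - (seminorm p (x n - u) * seminorm p (y n - v) + (seminorm p (x n - u) * seminorm p v
   + seminorm p u * seminorm p (y n - v)))) (fun n =>
  (seminorm p (x n - u) * seminorm p (y n - v) + (seminorm p (x n - u) * seminorm p v
   + seminorm p u * seminorm p (y n - v))))).
- near=> n; rewrite -ler_norml.
  have bd w w' : `|b n w w'| <= seminorm p w * seminorm p w'.
    apply: le_trans (si_le_seminorm (bI n) _ _) _.
    by rewrite ler_pM ?seminorm_ge0//; apply: seminorm_dom => //.
  apply: le_trans (ler_normD _ _) _; rewrite lerD//.
  by apply: le_trans (ler_normD _ _) _; rewrite lerD.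
- rewrite -[X in _ --> X]oppr0; apply: cvgN.
  rewrite (_ : 0 = 0 * 0 + (0 * seminorm p v + seminorm p u * 0)); last by ring.
  by apply: cvgD; [exact: cvgM|apply: cvgD; apply: cvgM => //; exact: cvg_cst].
- rewrite [X in _ --> X](_ : 0 = 0 * 0 + (0 * seminorm p v + seminorm p u * 0)); last by ring.
  by apply: cvgD; [exact: cvgM|apply: cvgD; apply: cvgM => //; exact: cvg_cst].
Unshelve. all: by end_near. Qed.

End Convergence.

(** * Min-max theory of the energy relative to a weighted form *)

Section Spectral.
Context {R : realType} {V : lmodType R}.
Variables a b0 : V -> V -> R.
Hypotheses (aI : semi_inner a) (b0I : semi_inner b0).
Let p x y := a x y + b0 x y.
Hypothesis pC : si_complete p.
Hypothesis b0_compact : forall (F : set_system nat) (x : nat -> V) (C : R),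
  UltraFilter F -> (forall n, p (x n) (x n) <= C) -> si_cauchy F b0 x.

Let pI : semi_inner p. Proof. exact: semi_innerD. Qed.

Let a_le_p w : a w w <= p w w.
Proof. by rewrite /p lerDl (si_ge0 b0I). Qed.
Let b0_le_p w : b0 w w <= p w w.
Proof. by rewrite /p lerDr (si_ge0 aI). Qed.

(** The first-order condition at a minimum, which yields both the eigenvalue equation of a Rayleigh
    minimizer and the Riesz representation. *)
Lemma linear_perturbation0 (beta gamma : R) :
  (forall s, 0 <= 2 * s * beta + s ^+ 2 * gamma) -> beta = 0.
Proof.
move=> h; apply/eqP/negP => /negP bn0.
have g0 : 0 < `|gamma| + 1 by rewrite ltr_wpDl.
have := h (- beta / (`|gamma| + 1)).
rewrite (_ : _ + _ = beta ^+ 2 / (`|gamma| + 1) * (gamma / (`|gamma| + 1) - 2)); last first.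
  by field; rewrite gt_eqF.
rewrite pmulr_rge0 ?divr_gt0// ?exprn_even_gt0// subr_ge0 ler_pdivlMr//.
have := ler_norm gamma; have := normr_ge0 gamma; lra.
Qed.

(* By the parallelogram identity, a minimizing sequence that is Cauchy for b0 is
   also Cauchy for a. *)
Lemma rayleigh_minimizer (b : V -> V -> R) (C t : R) (e : nat -> V) (j : nat) (w0 : V) :
  semi_inner b -> (forall w, b w w <= b0 w w) ->
  (forall w, b0 w w <= C * (a w w + b w w)) ->
  (forall i, (i < j)%N -> b (e i) w0 = 0) -> 0 < b w0 w0 -> a w0 w0 <= t * b w0 w0 ->
  exists u mu, [/\ forall i, (i < j)%N -> b (e i) u = 0, b u u = 1, mu <= t &
    forall v, (forall i, (i < j)%N -> b (e i) v = 0) -> a u v = mu * b u v].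
Proof.
move=> bI bb0 coer w0W bw0 aw0.
pose W : set V := [set v | forall i, (i < j)%N -> b (e i) v = 0].
have WD u v c : W u -> W v -> W (u + c *: v).
  by move=> Wu Wv i ij; rewrite (siDr bI) (siZr bI) Wu// Wv// mulr0 addr0.
pose S := [set a w w | w in W `&` [set w | b w w = 1]].
have normalize w : W w -> 0 < b w w -> S (a w w / b w w).
  move=> Ww bw; exists ((Num.sqrt (b w w))^-1 *: w); last first.
    by rewrite (si_sqZ aI) exprVn sqr_sqrtr ?ltW// mulrC.
  split; first by move=> i ij; rewrite (siZr bI) Ww// mulr0.
  by rewrite /= (si_sqZ bI) exprVn sqr_sqrtr ?ltW// mulVf// gt_eqF.
have S0 : S !=set0 by exists (a w0 w0 / b w0 w0); exact: normalize.
have Slb : lbound S 0 by move=> _ [w _ <-]; exact: (si_ge0 aI).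
have hS : has_inf S by split => //; exists 0.
pose mu := inf S.
have mu_ge0 : 0 <= mu by apply: lb_le_inf.
have mu_le w : W w -> mu * b w w <= a w w.
  move=> Ww; have := si_ge0 bI w; rewrite le_eqVlt => /predU1P[<-|bw].
    by rewrite mulr0 (si_ge0 aI).
  by rewrite -ler_pdivlMr//; apply: ge_inf; [exists 0|exact: normalize].
have mut : mu <= t.
  apply: (@le_trans _ _ (a w0 w0 / b w0 w0)).
    by apply: ge_inf; [exists 0|exact: normalize].
  by rewrite ler_pdivrMr.
have /choice[x Hx] (n : nat) : exists x, [/\ W x, b x x = 1 & a x x <= mu + n.+1%:R^-1].
  have n0 : 0 < n.+1%:R^-1 :> R by rewrite invr_gt0.
  have [_ [w [Ww bw] <-] aw] := inf_adherent n0 hS.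
  by exists w; split => //; exact: ltW.
have [F [FU FF]] := @ultraFilterLemma nat \oo _.
have inv1 n : n.+1%:R^-1 <= 1 :> R by rewrite invf_le1// ler1n.
have ax n : a (x n) (x n) <= mu + 1.
  by have [_ _] := Hx n => /le_trans; apply; rewrite lerD2l.
have C0 : 0 <= C.
  have := le_trans (bb0 w0) (coer w0) => /(lt_le_trans bw0).
  rewrite pmulr_lgt0; first exact: ltW.
  by rewrite ltr_wpDl// (si_ge0 aI).
have xC : si_cauchy F b0 x.
  apply: (b0_compact (C := (mu + 1) + C * (mu + 1 + 1))) => // n.
  apply: lerD => //; apply: le_trans (coer _) _; apply: ler_wpM2l => //.
  by have [_ -> _] := Hx n; rewrite lerD2r.
have pxC : si_cauchy F p x.
  move=> eps eps0.
  (* The parallelogram identity bounds the energy of a difference by eps / 2 plus [mu] times its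
     mass, so energy and mass together cost [mu + 1] times the mass. *)
  have [|A FA HA] := xC (eps / 2 / (mu + 1)).
    by rewrite !divr_gt0// ltr_wpDl.
  have [N Ne] := ltr_add_invr (ltac:(lra) : 0 < eps / 8); rewrite add0r in Ne.
  exists (A `&` [set n | (N <= n)%N]).
    by apply: filterI => //; apply: FF; exact: nbhs_infty_ge.
  move=> n m [An Nn] [Am Nm]; rewrite /p.
  have [Wn bn an] := Hx n; have [Wm bm am] := Hx m.
  have inN k : (N <= k)%N -> k.+1%:R^-1 <= eps / 8.
    move=> Nk; apply: le_trans (ltW Ne); rewrite lef_pV2 ?posrE//.
    by rewrite ler_nat.
  have {}an : a (x n) (x n) <= mu + eps / 8 by apply: (le_trans an); rewrite lerD2l inN.
  have {}am : a (x m) (x m) <= mu + eps / 8 by apply: (le_trans am); rewrite lerD2l inN.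
  have := mu_le (x n + 1 *: x m) (WD _ _ _ Wn Wm); rewrite scale1r.
  have bnm : b (x n + x m) (x n + x m) = 4 - b (x n - x m) (x n - x m).
    by rewrite (si_sqB bI) (si_sqD bI) bn bm; ring.
  have anm : a (x n + x m) (x n + x m) =
      2 * a (x n) (x n) + 2 * a (x m) (x m) - a (x n - x m) (x n - x m).
    by rewrite (si_sqB aI) (si_sqD aI); ring.
  rewrite bnm anm mulrBr => h.
  have hb : mu * b (x n - x m) (x n - x m) <= mu * b0 (x n - x m) (x n - x m).
    by rewrite ler_wpM2l.
  have := HA n m An Am; rewrite ler_pdivlMr; last by rewrite ltr_wpDl.
  move=> h'; lra.
have [u xu] := si_complete_filter _ pI pC pxC.
have cb v : b (x n) v @[n --> F] --> b u v.
  apply: (@si_cvg _ _ F p (fun=> b) _ _ (fun=> v) u v) => //.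
  - by move=> _ w; exact: le_trans (bb0 w) (b0_le_p w).
  - by under eq_fun do rewrite subrr (si0l pI); exact: cvg_cst.
  - exact: cvg_cst.
have bu : b u u = 1.
  have : b (x n) (x n) @[n --> F] --> b u u.
    apply: (@si_cvg _ _ F p (fun=> b) _ _ _ u u) => //.
    - by move=> _ w; exact: le_trans (bb0 w) (b0_le_p w).
    - exact: cvg_cst.
  rewrite (_ : (fun n => b (x n) (x n)) = fun=> 1); last first.
    by apply/funext => n; have [_ ->] := Hx n.
  by move=> /cvg_unique; apply => //; exact: cvg_cst.
have Wu : W u.
  move=> i ij; have := cb (e i).
  rewrite (_ : (fun n => b (x n) (e i)) = fun=> 0); last first.
    by apply/funext => n; rewrite (siC bI); have [->] := Hx n.
  by rewrite (siC bI) => /cvg_unique; apply => //; exact: cvg_cst.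
have au : a u u <= mu.
  have axu : a (x n) (x n) @[n --> F] --> a u u.
    by apply: (@si_cvg _ _ F p (fun=> a) _ _ _ u u) => //; exact: cvg_cst.
  apply/ler_addgt0Pr => eps eps0.
  rewrite -(cvg_lim _ axu)//; apply: limr_le; first by apply/cvg_ex; exists (a u u).
  have [N Ne] := ltr_add_invr eps0; rewrite add0r in Ne.
  have : F [set n | (N <= n)%N] by apply: FF; exact: nbhs_infty_ge.
  apply: filterS => n /= Nn; have [_ _] := Hx n => /le_trans; apply.
  rewrite lerD2l; apply: le_trans (ltW Ne); rewrite lef_pV2 ?posrE//.
  by rewrite ler_nat.
exists u, mu; split => // v Wv.
apply/eqP; rewrite -subr_eq0; apply/eqP.
(* [mu_le] is applied along [u + s *: v]; the constant term [a u u - mu * b u u] is at most 0 by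
   [au]. *)
apply: (@linear_perturbation0 _ (a v v - mu * b v v)) => s.
have := mu_le _ (WD u v s Wu Wv).
rewrite (si_sqD aI) (si_sqD bI) !(si_sqZ aI) !(si_sqZ bI) (siZr aI) (siZr bI) bu.
by rewrite -subr_ge0 => h; lra.
Qed.

(** The values [lam i] need not be sorted or distinct: a level [t] of the min-max principle only
    asks that they stay below it. *)
Definition eigenfamily (b : V -> V -> R) (k : nat) (t : R) (u : nat -> V) (lam : nat -> R) : Prop :=
  (forall i j, (i < k)%N -> (j < k)%N -> b (u i) (u j) = (i == j)%:R) /\
  forall i, (i < k)%N -> lam i <= t /\ forall v, a (u i) v = lam i * b (u i) v.

Definition lincomb (k : nat) (c : nat -> R) (w : nat -> V) : V := \sum_(i < k) c i *: w i.

Lemma si_lincombl (b : V -> V -> R) k c w v : semi_inner b ->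
  b (lincomb k c w) v = \sum_(i < k) c i * b (w i) v.
Proof.
by move=> bI; rewrite (si_suml bI); apply: eq_bigr => i _; rewrite (siZl bI).
Qed.

(** These are [j] homogeneous linear equations in [k > j] unknowns; the solution is a nonzero row of
    the kernel of the matrix of the [b (w i) (e l)]. *)
Lemma exists_orthogonal_comb (b : V -> V -> R) (w e : nat -> V) (k j : nat) :
  semi_inner b -> (j < k)%N ->
  exists2 c : nat -> R, exists2 i, (i < k)%N & c i != 0 &
    forall l, (l < j)%N -> b (e l) (lincomb k c w) = 0.
Proof.
move=> bI jk; pose M : 'M[R]_(k, j) := \matrix_(i, l) b (w i) (e l).
pose v := nz_row (kermx M).
have vn0 : v != 0.
  rewrite nz_row_eq0 -mxrank_eq0 mxrank_ker subn_eq0 -ltnNge.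
  exact: leq_ltn_trans (rank_leq_col _) jk.
have vM : v *m M = 0 by apply/sub_kermxP; exact: nz_row_sub.
pose c n := if @insub nat _ 'I_k n is Some l then v 0 l else 0.
have cE (l : 'I_k) : c l = v 0 l by rewrite /c valK.
exists c.
  have /rV0Pn[i vi] := vn0.
  by exists i; [exact: ltn_ord|rewrite cE].
move=> l lj; rewrite (siC bI) si_lincombl//.
have := congr1 (fun A : 'rV_j => A 0 (Ordinal lj)) vM; rewrite !mxE => h.
rewrite -[RHS]h; apply: eq_bigr => i _; by rewrite mxE cE.
Qed.

(** Eigenvectors are produced one at a time. As long as fewer than [k] are known, some nonzero
    combination of the [w i] is orthogonal to them; its quotient is at most [t], hence so is the
    minimum over the orthogonal complement. *)
Lemma minmax_eigenfamily (b : V -> V -> R) (C t : R) (w : nat -> V) (k : nat) :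
  semi_inner b -> (forall v, b v v <= b0 v v) ->
  (forall v, b0 v v <= C * (a v v + b v v)) ->
  (forall c : nat -> R, (exists2 i, (i < k)%N & c i != 0) ->
     0 < b (lincomb k c w) (lincomb k c w)) ->
  (forall c, a (lincomb k c w) (lincomb k c w) <= t * b (lincomb k c w) (lincomb k c w)) ->
  exists u lam, eigenfamily b k t u lam.
Proof.
move=> bI bb0 coer wpos wt.
suff H j : (j <= k)%N -> exists u lam, eigenfamily b j t u lam by exact: H.
elim: j => [_|j ih jk]; first by exists (fun=> 0), (fun=> 0); split.
have [u [lam [uo ue]]] := ih (ltnW jk).
have [c cn0 cW] := exists_orthogonal_comb w u bI jk.
have [v [mu [vW v1 mut vmin]]] :=
  rayleigh_minimizer bI bb0 coer cW (wpos _ cn0) (wt c).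
(* The minimizer satisfies its equation only against the orthogonal complement. The removed part of
   [z] contributes nothing, since [a (u i) v] is [lam i * b (u i) v], that is 0. *)
have ve z : a v z = mu * b v z.
  pose z' := z - lincomb j (fun i => b (u i) z) u.
  have z'W i : (i < j)%N -> b (u i) z' = 0.
    move=> ij; rewrite (siBr bI) (siC bI _ (lincomb _ _ _)) si_lincombl//.
    rewrite (bigD1 (Ordinal ij))//= uo// eqxx mulr1 big1 ?addr0 ?subrr// => l li.
    rewrite uo//; case: eqP => [E|_]; last by rewrite mulr0.
    by case/eqP: li; apply: val_inj.
  have := vmin _ z'W; rewrite (siBr bI) (siBr aI) ![_ v (lincomb _ _ _)](siC bI, siC aI).
  rewrite (siC aI v) (siC bI v) !si_lincombl// !big1; first by rewrite !subr0.
  - by move=> i _; rewrite vW// mulr0.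
  - by move=> i _; rewrite (ue _ (ltn_ord i)).2 vW// !mulr0.
exists (fun i => if (i < j)%N then u i else v), (fun i => if (i < j)%N then lam i else mu).
split=> [i l|i].
  rewrite !ltnS leq_eqVlt => ij; rewrite leq_eqVlt => lj.
  case: (ltnP i j) ij => [ij _|_]; last rewrite orbF => /eqP ->.
    case: (ltnP l j) lj => [lj _|_]; first by rewrite uo.
    by rewrite orbF => /eqP ->; rewrite vW// ltn_eqF.
  case: (ltnP l j) lj => [lj _|_]; first by rewrite (siC bI) vW// gtn_eqF.
  by rewrite orbF => /eqP ->; rewrite v1 eqxx.
by rewrite ltnS leq_eqVlt; case: ltnP => [ij _|//]; exact: ue.
Qed.

Lemma eigenfamily_normsq (b : V -> V -> R) k t u lam (c : nat -> R) : semi_inner b ->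
  eigenfamily b k t u lam -> b (lincomb k c u) (lincomb k c u) = \sum_(i < k) c i ^+ 2.
Proof.
move=> bI [uo _]; rewrite si_lincombl//; apply: eq_bigr => i _.
rewrite (siC bI) si_lincombl// (bigD1 i)//= uo// eqxx mulr1 big1 ?addr0//.
move=> l li; rewrite uo//; case: eqP => [E|_]; last by rewrite mulr0.
by case/eqP: li; apply: val_inj.
Qed.

Lemma eigenfamily_energy (b : V -> V -> R) k t u lam (c : nat -> R) : semi_inner b ->
  eigenfamily b k t u lam ->
  a (lincomb k c u) (lincomb k c u) = \sum_(i < k) lam i * c i ^+ 2.
Proof.
move=> bI [uo ue]; rewrite si_lincombl//; apply: eq_bigr => i _.
rewrite (ue _ (ltn_ord i)).2 (siC bI) si_lincombl// (bigD1 i)//= uo// eqxx mulr1.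
rewrite big1 ?addr0; first by ring.
move=> l li; rewrite uo//; case: eqP => [E|_]; last by rewrite mulr0.
by case/eqP: li; apply: val_inj.
Qed.

Lemma eigenfamily_value_ge0 (b : V -> V -> R) k t u lam i : semi_inner b ->
  eigenfamily b k t u lam -> (i < k)%N -> 0 <= lam i.
Proof.
move=> bI [uo ue] ik; have := si_ge0 aI (u i).
by rewrite (ue _ ik).2 uo// eqxx mulr1.
Qed.

(** Normalization turns energies into eigenvalues, at most [T], and the common constant [C] then
    bounds the masses. Once the eigenvectors converge for [p], orthonormality and equations pass to
    the limit by [si_cvg], although the forms themselves converge only pointwise. *)
Lemma eigenfamily_limit (F : set_system nat) (b : nat -> V -> V -> R) (bl : V -> V -> R)
    (C T t : R) (tn : nat -> R) k (u : nat -> nat -> V) (lam : nat -> nat -> R) :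
  UltraFilter F -> (forall n, semi_inner (b n)) -> (forall n v, b n v v <= b0 v v) ->
  (forall n v, b0 v v <= C * (a v v + b n v v)) ->
  (forall v w, b n v w @[n --> F] --> bl v w) ->
  (forall n, tn n <= T) -> tn n @[n --> F] --> t ->
  (forall n, eigenfamily (b n) k (tn n) (u n) (lam n)) ->
  exists v mu, eigenfamily bl k t v mu.
Proof.
move=> FU bI bb0 coer bbl tT tnt Hu.
have lam_ge0 n i : (i < k)%N -> 0 <= lam n i by exact: eigenfamily_value_ge0.
have lam_le n i : (i < k)%N -> lam n i <= T.
  by move=> ik; apply: le_trans ((Hu n).2 i ik).1 _.
have an n i : (i < k)%N -> a (u n i) (u n i) = lam n i.
  by move=> ik; rewrite ((Hu n).2 i ik).2 (Hu n).1// eqxx mulr1.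
have ubound i : (i < k)%N -> forall n, p (u n i) (u n i) <= T + `|C| * (T + 1).
  move=> ik n; rewrite /p an//; apply: lerD; first exact: lam_le.
  apply: le_trans (coer n _) _; rewrite an// (Hu n).1// eqxx.
  apply: (@le_trans _ _ (`|C| * (lam n i + 1))).
    by rewrite ler_wpM2r ?addr_ge0 ?lam_ge0 ?ler_norm.
  by rewrite ler_wpM2l// lerD2r lam_le.
(* the equations tested against u n i - u m i bound its energy by its mass *)
have uC i : (i < k)%N -> si_cauchy F p (u ^~ i).
  move=> ik eps eps0.
  have T0 : 0 <= T by apply: le_trans (lam_ge0 0%N i ik) (lam_le _ _ ik).
  have ubC := b0_compact FU (ubound i ik).
  (* The first bound leaves eps / 2 for the mass. The second, a square, bounds the [b l] norm of the
     difference, so each of the two equations contributes at most eps / 4 to the energy. *)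
  have [|A FA HA] := ubC (Num.min (eps / 2) ((eps / (4 * (T + 1))) ^+ 2)).
    by rewrite lt_min !(divr_gt0, exprn_gt0)// mulr_gt0// ltr_wpDl.
  exists A => // n m An Am; rewrite /p.
  have := HA n m An Am; rewrite le_min => /andP[h1 h2].
  set d := u n i - u m i in h1 h2 *.
  have small l : `|lam l i * b l (u l i) d| <= eps / 4.
    rewrite normrM ger0_norm ?lam_ge0//.
    apply: (@le_trans _ _ (T * (eps / (4 * (T + 1))))).
      rewrite ler_pM ?lam_ge0 ?lam_le//.
      apply: le_trans (si_le_seminorm (bI l) _ _) _.
      rewrite {1}/seminorm (Hu l).1// eqxx sqrtr1 mul1r.
      rewrite (seminorm_le (bI l)); last by rewrite divr_ge0 ?mulr_ge0 ?addr_ge0// ltW.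
      exact: le_trans (bb0 _ _) h2.
    rewrite mulrA ler_pdivrMr; last by rewrite mulr_gt0// ltr_wpDl.
    by rewrite (_ : eps / 4 * _ = eps * (T + 1)); [nra|field].
  have -> : a d d = lam n i * b n (u n i) d - lam m i * b m (u m i) d.
    by rewrite {1}/d (siBl aI) ((Hu n).2 i ik).2 ((Hu m).2 i ik).2.
  have := small n; have := small m; rewrite !ler_norml => /andP[? ?] /andP[? ?].
  lra.
have /choice[v Hv] (i : nat) : exists v, (i < k)%N ->
    p (u n i - v) (u n i - v) @[n --> F] --> (0 : R).
  have [ik|ik] := ltnP i k; last by exists 0.
  by have [v Hv] := si_complete_filter _ pI pC (uC i ik); exists v.
have /choice[mu Hmu] (i : nat) : exists mu : R, (i < k)%N -> lam n i @[n --> F] --> mu.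
  have [ik|ik] := ltnP i k; last by exists 0.
  have [|mu Hmu] := @ultra_cvg _ F (lam ^~ i) T FU; last by exists mu.
  by apply: nearW => n; rewrite ger0_norm ?lam_ge0 ?lam_le.
have bp n w : b n w w <= p w w by apply: le_trans (bb0 _ _) (b0_le_p _).
exists v, mu; split=> [i j ik jk|i ik].
  have := si_cvg (@ultra_proper _ F FU) pI bI bp (Hv i ik) (Hv j jk) (bbl (v i) (v j)).
  rewrite (_ : (fun n => b n (u n i) (u n j)) = fun=> (i == j)%:R); last first.
    by apply/funext => n; rewrite (Hu n).1.
  by move=> /cvg_unique; apply => //; exact: cvg_cst.
split.
  rewrite -(cvg_lim _ tnt)// -(cvg_lim _ (Hmu i ik))//.
  apply: ler_lim.
  - by apply/cvg_ex; exists (mu i); exact: Hmu.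
  - by apply/cvg_ex; exists t.
  - by apply: nearW => n; exact: ((Hu n).2 i ik).1.
move=> w; have w0 : p (w - w) (w - w) @[_ --> F] --> (0 : R).
  by rewrite subrr (si0l pI); exact: cvg_cst.
have h1 : a (u n i) w @[n --> F] --> a (v i) w.
  by apply: (si_cvg (b := fun=> a) _ pI _ _ (Hv i ik) w0) => //; exact: cvg_cst.
have h2 : lam n i * b n (u n i) w @[n --> F] --> mu i * bl (v i) w.
  apply: cvgM; first exact: Hmu.
  exact: (si_cvg _ pI bI bp (Hv i ik) w0 (bbl (v i) w)).
apply: (cvg_unique _ h1) => //.
rewrite (_ : (fun n => a (u n i) w) = (fun n => lam n i * b n (u n i) w))//.
by apply/funext => n; rewrite ((Hu n).2 i ik).2.
Qed.

End Spectral.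

(** * Coercivity and extremal weights over a compact family *)

Section Optimization.
Context {R : realType} {V : lmodType R} {T : Type}.
Variables (a b0 : V -> V -> R) (b : T -> V -> V -> R) (A : set T) (one : V) (beta : R).
Hypotheses (aI : semi_inner a) (b0I : semi_inner b0).
Let p x y := a x y + b0 x y.
Hypothesis pC : si_complete p.
Hypothesis b0_compact : forall (F : set_system nat) (x : nat -> V) (C : R),
  UltraFilter F -> (forall n, p (x n) (x n) <= C) -> si_cauchy F b0 x.
Hypothesis bI : forall r, A r -> semi_inner (b r).
Hypothesis b_le : forall r w, A r -> b r w w <= b0 w w.
Hypothesis a_kernel : forall w, a w w = 0 -> exists c, b0 (w - c *: one) (w - c *: one) = 0.
Hypothesis b_one : forall r, A r -> b r one one = beta.
Hypothesis beta_gt0 : 0 < beta.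
Hypothesis A_nonempty : A !=set0.
Hypothesis A_compact : forall (F : set_system nat) (r : nat -> T), UltraFilter F ->
  (forall n, A (r n)) -> exists2 s, A s & forall v w, b (r n) v w @[n --> F] --> b s v w.

Let pI : semi_inner p. Proof. exact: semi_innerD. Qed.
Let a_le_p w : a w w <= p w w.
Proof. by rewrite /p lerDl (si_ge0 b0I). Qed.
Let b0_le_p w : b0 w w <= p w w.
Proof. by rewrite /p lerDr (si_ge0 aI). Qed.

Lemma cvg_bigsum (F : set_system nat) (k : nat) (f : nat -> 'I_k -> R) (l : 'I_k -> R) :
  Filter F -> (forall i, f n i @[n --> F] --> l i) ->
  \sum_(i < k) f n i @[n --> F] --> \sum_(i < k) l i.
Proof.
move=> FF fl; suff H (s : seq 'I_k) : \sum_(i <- s) f n i @[n --> F] --> \sum_(i <- s) l i.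
  exact: H.
elim: s => [|i s ih].
  by rewrite big_nil; under eq_fun do rewrite big_nil; exact: cvg_cst.
by rewrite big_cons; under eq_fun do rewrite big_cons; apply: cvgD.
Qed.

Lemma cvg_harmonic_sub (F : set_system nat) : \oo `<=` F ->
  n.+1%:R^-1 @[n --> F] --> (0 : R).
Proof. by move=> FF B B0; apply: FF; exact: (@cvg_harmonic R). Qed.

(* A normalized sequence violating the bound would converge to a multiple of one,
   whose weighted mass is bounded below by beta > 0. *)
Lemma uniformly_coercive : exists C, forall r w, A r -> b0 w w <= C * (a w w + b r w w).
Proof.
apply: contrapT => nC.
have /choice[rw Hrw] (n : nat) : exists rw : T * V,
    [/\ A rw.1, b0 rw.2 rw.2 = 1 & a rw.2 rw.2 + b rw.1 rw.2 rw.2 <= n.+1%:R^-1].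
  apply: contrapT => nex; apply: nC; exists n.+1%:R => r w Ar; rewrite leNgt.
  apply/negP => lt; apply: nex.
  have b0w : 0 < b0 w w.
    by apply: le_lt_trans lt; rewrite mulr_ge0// addr_ge0 ?(si_ge0 aI) ?(si_ge0 (bI Ar)).
  exists (r, (Num.sqrt (b0 w w))^-1 *: w); split => //=.
    by rewrite (si_sqZ b0I) exprVn sqr_sqrtr ?ltW// mulVf// gt_eqF.
  rewrite (si_sqZ aI) (si_sqZ (bI Ar)) exprVn sqr_sqrtr ?(ltW b0w)// -mulrDr.
  by rewrite mulrC ler_pdivrMr// mulrC ler_pdivlMr// mulrC ltW.
pose r n := (rw n).1; pose x n := (rw n).2.
have Ar n : A (r n) by case: (Hrw n).
have inv1 n : n.+1%:R^-1 <= 1 :> R by rewrite invf_le1// ler1n.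
have ax n : a (x n) (x n) <= n.+1%:R^-1.
  by have [_ _] := Hrw n; apply: le_trans; rewrite lerDl (si_ge0 (bI (Ar n))).
have bx n : b (r n) (x n) (x n) <= n.+1%:R^-1.
  by have [_ _] := Hrw n; apply: le_trans; rewrite lerDr (si_ge0 aI).
have b0x n : b0 (x n) (x n) = 1 by case: (Hrw n).
have [F [FU FF]] := @ultraFilterLemma nat \oo _.
have inv0 := cvg_harmonic_sub FF.
have xC : si_cauchy F b0 x.
  apply: (b0_compact (C := 1 + 1)) => // n; rewrite /p b0x lerD2r.
  exact: le_trans (ax n) (inv1 n).
have pxC : si_cauchy F p x.
  move=> eps eps0; have [|B FB HB] := xC (eps / 2); first by rewrite divr_gt0.
  have e8 : 0 < eps / 8 by rewrite divr_gt0.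
  have : \forall n \near F, n.+1%:R^-1 < eps / 8.
    by apply: (cvgr_lt 0).
  move=> FN; exists (B `&` [set n | n.+1%:R^-1 < eps / 8]); first exact: filterI.
  move=> n m [Bn /= Nn] [Bm /= Nm]; rewrite /p.
  have := HB n m Bn Bm.
  have := le_lt_trans (ax n) Nn; have := le_lt_trans (ax m) Nm.
  have := si_ge0 aI (x n + x m); rewrite (si_sqD aI) (si_sqB aI) => ? ? ? ?; lra.
have [y xy] := si_complete_filter _ pI pC pxC.
have b0y : b0 y y = 1.
  have : b0 (x n) (x n) @[n --> F] --> b0 y y.
    by apply: (@si_cvg _ _ F p (fun=> b0) _ _ _ y y) => //; exact: cvg_cst.
  rewrite (_ : (fun n => b0 (x n) (x n)) = fun=> 1); last exact/funext.
  by move=> /cvg_unique; apply => //; exact: cvg_cst.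
have ay : a y y = 0.
  have h : a (x n) (x n) @[n --> F] --> a y y.
    by apply: (@si_cvg _ _ F p (fun=> a) _ _ _ y y) => //; exact: cvg_cst.
  apply: (cvg_unique _ h) => //.
  apply: (squeeze_cvgr _ (cvg_cst 0) inv0).
  by apply: nearW => n; rewrite (si_ge0 aI)//=.
have [c cy] := a_kernel ay.
(* [y] and [c *: one] differ by a [b0]-null vector, so the weighted norm of [c *: one] tends to 0.
   By [b_one] it is the same for every [n], which forces [c] to be 0 and contradicts
   [b0 y y = 1]. *)
have sn n : seminorm (b (r n)) (c *: one) <= seminorm p (x n - y) + Num.sqrt n.+1%:R^-1.
  have bIn := bI (Ar n).
  apply: le_trans (_ : _ <= seminorm (b (r n)) (y - c *: one) + seminorm (b (r n)) y) _.
    rewrite -{1}(subrK y (c *: one)) (seminormBC bIn y).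
    exact: (seminormD bIn).
  have -> : seminorm (b (r n)) (y - c *: one) = 0.
    apply: seminorm_eq0; apply/eqP; rewrite eq_le (si_ge0 bIn) andbT.
    by apply: le_trans (b_le _ (Ar n)) _; rewrite cy.
  rewrite add0r -{1}(subrK (x n) y); apply: le_trans (seminormD bIn _ _) _.
  rewrite lerD//; last by rewrite ler_wsqrtr.
  rewrite (seminormBC bIn); apply: (@seminorm_dom _ _ (b (r n)) p) => // w.
  exact: le_trans (b_le _ (Ar n)) (b0_le_p w).
have c0 : `|c| * Num.sqrt beta = 0.
  have s0 : seminorm p (x n - y) + Num.sqrt n.+1%:R^-1 @[n --> F] --> (0 : R).
    rewrite -[X in _ --> X]addr0 -[X in _ --> X + X]sqrtr0; apply: cvgD.
      by apply: continuous_cvg => //; exact: sqrt_continuous.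
    by apply: continuous_cvg => //; exact: sqrt_continuous.
  apply: (@cvg_unique _ _ ((fun _ : nat => `|c| * Num.sqrt beta) @ F)) => //.
    exact: cvg_cst.
  apply: (squeeze_cvgr _ (cvg_cst 0) s0).
  apply: nearW => n; rewrite mulr_ge0//=.
  have := sn n; by rewrite (seminormZ (bI (Ar n))) /seminorm b_one.
move/eqP: c0; rewrite mulf_eq0 normr_eq0 sqrtr_eq0 leNgt beta_gt0 orbF => /eqP c0.
by move: cy; rewrite c0 scale0r subr0 b0y => /eqP; rewrite oner_eq0.
Qed.

(* The Gram matrix of the limiting eigenvectors tends to the identity, so that
   they are test vectors for the min-max principle of b (r n). *)
Lemma eigenfamily_perturb (F : set_system nat) (r : nat -> T) (s : T) k t t' u lam :
  ProperFilter F -> (forall n, A (r n)) -> A s ->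
  (forall v w, b (r n) v w @[n --> F] --> b s v w) ->
  eigenfamily a (b s) k t u lam -> t < t' ->
  \forall n \near F, exists v mu, eigenfamily a (b (r n)) k t' v mu.
Proof.
move=> FF Ar As bs Hu tt'.
have [C coer] := uniformly_coercive.
have [->|k0] := posnP k; first by apply: nearW => n; exists (fun=> 0), (fun=> 0); split.
have t0 : 0 <= t.
  exact: le_trans (eigenfamily_value_ge0 aI (bI As) Hu k0) (Hu.2 _ k0).1.
have t'0 : 0 < t' by exact: le_lt_trans tt'.
pose D n i j := b (r n) (u i) (u j) - b s (u i) (u j).
have D0 : \sum_(i < k) \sum_(j < k) `|D n i j| @[n --> F] --> (0 : R).
  rewrite [X in _ --> X](_ : 0 = \sum_(i < k) \sum_(j < k) 0); last first.
    by rewrite big1// => i _; rewrite big1.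
  apply: (@cvg_bigsum F k (fun n i => \sum_(j < k) `|D n i j|)) => i.
  apply: (@cvg_bigsum F k (fun n j => `|D n i j|)) => j.
  rewrite -[X in _ --> X](@normr0 _ R); apply: cvg_norm; rewrite -(subrr (b s (u i) (u j))).
  by apply: cvgB => //; exact: cvg_cst.
(* If the Gram matrix is off by [S] in total, Rayleigh quotients are at most t / (1 - S). This
   threshold keeps them below [t'], and keeps [S] below 1/2, so that the weighted form stays
   positive on the span. *)
have eta0 : 0 < (t' - t) / (2 * t') by rewrite divr_gt0 ?mulr_gt0 ?subr_gt0.
apply: (@filterS _ F _ _ _ _ (cvgr_lt 0 D0 _ eta0)) => n.
set S : R := \sum_(i < k) _ => Sn.
have bn := bI (Ar n).
have lower (c : nat -> R) : (1 - S) * \sum_(i < k) c i ^+ 2 <= b (r n) (lincomb k c u) (lincomb k c u).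
  have e1 q : semi_inner q -> q (lincomb k c u) (lincomb k c u) =
      \sum_(i < k) \sum_(j < k) c i * c j * q (u i) (u j).
    move=> qI; rewrite si_lincombl//; apply: eq_bigr => i _.
    rewrite (siC qI) si_lincombl// mulr_sumr; apply: eq_bigr => j _.
    by rewrite (siC qI (u j)) mulrA.
  have := eigenfamily_normsq c (bI As) Hu; rewrite e1; last exact: bI.
  set N := \sum_(i < k) c i ^+ 2 => EN.
  have ci (i : 'I_k) : c i ^+ 2 <= N by rewrite /N (bigD1 i)//= lerDl sumr_ge0// => j _; exact: sqr_ge0.
  rewrite e1// -subr_ge0 mulrBl mul1r -{1}EN opprB addrCA -sumrB.
  rewrite -[X in S * N + X]opprK subr_ge0 -sumrN.
  rewrite /S mulr_suml; apply: ler_sum => i _.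
  rewrite -sumrB -sumrN mulr_suml; apply: ler_sum => j _.
  rewrite -mulrBr -/(D n i j); apply: le_trans (ler_norm _) _.
  rewrite normrN normrM mulrC ler_wpM2l//.
  rewrite normrM; have := ci i; have := ci j; rewrite -(real_normK (num_real (c i))) -(real_normK (num_real (c j))).
  have := sqr_ge0 (`|c i| - `|c j|); rewrite sqrrB => ? ? ?; lra.
have S0 : 0 <= S by rewrite sumr_ge0// => i _; rewrite sumr_ge0.
have eta_half : (t' - t) / (2 * t') <= 1 / 2.
  by rewrite ler_pdivrMr ?mulr_gt0// mulrA divfK//; lra.
have S12 : S < 1 / 2 by exact: lt_le_trans eta_half.
apply: (minmax_eigenfamily aI b0I pC b0_compact bn (C := C) (w := u)).
- by move=> v; exact: b_le.
- by move=> v; exact: coer.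
- move=> c [i ik ci]; apply: lt_le_trans (lower c); rewrite mulr_gt0//; first by lra.
  rewrite (bigD1 (Ordinal ik))//= ltr_wpDr ?exprn_even_gt0 ?ci//.
  by rewrite sumr_ge0// => j _; exact: sqr_ge0.
- move=> c; rewrite (eigenfamily_energy aI c (bI As) Hu).
  have N0 : 0 <= \sum_(i < k) c i ^+ 2 by rewrite sumr_ge0// => j _; exact: sqr_ge0.
  apply: (@le_trans _ _ (t * \sum_(i < k) c i ^+ 2)).
    rewrite mulr_sumr; apply: ler_sum => i _; rewrite ler_wpM2r ?sqr_ge0//.
    exact: (Hu.2 _ (ltn_ord i)).1.
  apply: le_trans (ler_wpM2l (ltW t'0) (lower c)).
  rewrite mulrA ler_wpM2r//.
  have : S * (2 * t') <= t' - t by rewrite -ler_pdivlMr ?mulr_gt0// ltW.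
  nra.
Qed.

(** The value is +oo when no level admits a family, for instance when the form [b r] has too small a
    rank. *)
Definition eigenvalue_of (k : nat) (r : T) : \bar R :=
  ereal_inf [set t%:E | t in [set t : R | exists u lam, eigenfamily a (b r) k.+1 t u lam]].

Lemma eigenvalue_of_le k r (t : R) u lam : eigenfamily a (b r) k.+1 t u lam ->
  (eigenvalue_of k r <= t%:E)%E.
Proof. by move=> H; apply: ereal_inf_lbound; exists t => //; exists u, lam. Qed.

Lemma eigenvalue_of_ge0 k r : A r -> (0 <= eigenvalue_of k r)%E.
Proof.
move=> Ar; apply: le_ereal_inf_tmp => _ [t [u [lam H]] <-]; rewrite lee_fin.
exact: le_trans (eigenfamily_value_ge0 aI (bI Ar) H (ltn0Sn k)) (H.2 _ (ltn0Sn k)).1.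
Qed.

Lemma eigenvalue_of_lt k r (t : R) : (eigenvalue_of k r < t%:E)%E ->
  exists u lam, eigenfamily a (b r) k.+1 t u lam.
Proof.
move=> /ereal_inf_lt[_ [s [u [lam [H1 H2]]] <-]]; rewrite lte_fin => st.
exists u, lam; split => // i ik; split; last exact: (H2 i ik).2.
exact: le_trans (H2 i ik).1 (ltW st).
Qed.

Lemma eigenvalue_of_inf k : exists2 r, A r &
  eigenvalue_of k r = ereal_inf [set eigenvalue_of k r' | r' in A].
Proof.
set S := [set _ | _ in A]; pose m := ereal_inf S; rewrite -/m.
have [C coer] := uniformly_coercive.
have m0 : (0 <= m)%E by apply: le_ereal_inf_tmp => _ [r Ar <-]; exact: eigenvalue_of_ge0.
(* If the infimum is +oo then so is every value, and any weight is a minimizer. *)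
have [moo|mfin] := eqVneq m +oo%E.
  have [r Ar] := A_nonempty; exists r => //; apply/eqP; rewrite eq_le moo leey/=.
  by rewrite -moo; apply: ereal_inf_lbound; exists r.
have mf : m \is a fin_num by rewrite ge0_fin_numE// ltey.
pose tn (n : nat) : R := fine m + n.+1%:R^-1.
have /choice[x Hx] (n : nat) : exists x : T * (nat -> V) * (nat -> R),
    A x.1.1 /\ eigenfamily a (b x.1.1) k.+1 (tn n) x.1.2 x.2.
  have : (m < (tn n)%:E)%E by rewrite -(fineK mf) lte_fin ltrDl invr_gt0.
  move=> /ereal_inf_lt[_ [r Ar <-] /eigenvalue_of_lt[u [lam H]]].
  by exists (r, u, lam).
have [F [FU FF]] := @ultraFilterLemma nat \oo _.
have [s As bs] := A_compact FU (fun n => (Hx n).1).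
exists s => //; apply/eqP; rewrite eq_le; apply/andP; split; last first.
  by apply: ereal_inf_lbound; exists s.
have [|||||||v [mu Hv]] := @eigenfamily_limit _ _ a b0 aI b0I pC b0_compact F
    (fun n => b (x n).1.1) (b s) C (fine m + 1) (fine m) tn k.+1 (fun n => (x n).1.2) (fun n => (x n).2) FU.
- by move=> n; apply: bI; exact: (Hx n).1.
- by move=> n v; apply: b_le; exact: (Hx n).1.
- by move=> n v; apply: coer; exact: (Hx n).1.
- exact: bs.
- by move=> n; rewrite lerD2l invf_le1// ler1n.
- by rewrite -[X in _ --> X]addr0; apply: cvgD; [exact: cvg_cst|exact: cvg_harmonic_sub].
- by move=> n; exact: (Hx n).2.
by rewrite -[leRHS](fineK mf); exact: eigenvalue_of_le Hv.
Qed.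

(** If the limit weight had its eigenvalue below [M], its eigenvectors would give by
    [eigenfamily_perturb] families at some level [t' < M] for weights whose eigenvalues eventually
    exceed [t']. *)
Lemma eigenvalue_of_sup k : exists2 r, A r &
  eigenvalue_of k r = ereal_sup [set eigenvalue_of k r' | r' in A].
Proof.
set S := [set _ | _ in A]; pose M := ereal_sup S; rewrite -/M.
have M0 : (0 <= M)%E.
  have [r Ar] := A_nonempty; apply: le_trans (eigenvalue_of_ge0 k Ar) _.
  by apply: ereal_sup_ubound; exists r.
(* A sequence strictly below [M] that ends up above every real below [M]; this treats finite and
   infinite suprema alike. *)
have [y yM yt] : exists2 y : nat -> R, forall n, ((y n)%:E < M)%E &
    forall t : R, (t%:E < M)%E -> \forall n \near \oo, t <= y n.
  have [Moo|Mn] := eqVneq M +oo%E.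
    exists (fun n => n%:R); first by move=> n; rewrite Moo ltey.
    by move=> t _; exact: nbhs_infty_ger.
  have Mf : M \is a fin_num by rewrite ge0_fin_numE// ltey.
  exists (fun n => fine M - n.+1%:R^-1).
    by move=> n; rewrite -[ltRHS](fineK Mf) lte_fin ltrBlDr ltrDl invr_gt0.
  move=> t; rewrite -(fineK Mf) lte_fin -subr_gt0 => tM.
  apply: (@filterS _ \oo _ _ _ _ (cvgr_lt 0 (@cvg_harmonic R) _ tM)) => n /=.
  by move=> /ltW; rewrite lerBrDr addrC -lerBrDr.
have /choice[r Hr] (n : nat) : exists r, A r /\ ((y n)%:E < eigenvalue_of k r)%E.
  by have := yM n => /ereal_sup_gt[_ [r Ar <-] yr]; exists r.
have [F [FU FF]] := @ultraFilterLemma nat \oo _.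
have [s As bs] := A_compact FU (fun n => (Hr n).1).
exists s => //; apply/eqP; rewrite eq_le; apply/andP; split.
  by apply: ereal_sup_ubound; exists s.
rewrite leNgt; apply/negP => sM.
have [_ [t [u [lam Hu]] <-] tM] := ereal_inf_lt sM.
have [t' tt' t'M] : exists2 t' : R, t < t' & (t'%:E < M)%E.
  have [Moo|Mn] := eqVneq M +oo%E.
    by exists (t + 1); [rewrite ltrDl|rewrite Moo ltey].
  have Mf : M \is a fin_num by rewrite ge0_fin_numE// ltey.
  move: tM; rewrite -(fineK Mf) lte_fin => tM.
  by exists ((t + fine M) / 2); rewrite ?lte_fin midf_lt.
have h1 := eigenfamily_perturb _ (fun n => (Hr n).1) As bs Hu tt'.
have h2 : \forall n \near F, t' <= y n by apply: FF; exact: yt.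
have [n [[v [mu Hv]] t'y]] := filter_ex (filterI (h1 _) h2).
have := (Hr n).2; rewrite ltNge => /negP; apply.
by apply: le_trans (eigenvalue_of_le Hv) _; rewrite lee_fin.
Qed.

End Optimization.

(** * Linear subspaces as types *)

Section Submodule.
Context {R : realType} {U : lmodType R}.

(** The subspace is a Prop-valued set; [submodule_type] makes it an [lmodType], which is how L^2 and
    H^1 become instances of the abstract theory. *)
Record submodule := Submodule {
  submodule_set : set U;
  submodule0 : submodule_set 0;
  submodule_linear : forall c x y, submodule_set x -> submodule_set y ->
    submodule_set (c *: x + y) }.

Variable S : submodule.

Definition submodule_pred : {pred U} := fun x => `[< submodule_set S x >].

Lemma submodule_pred_closed : submod_closed submodule_pred.
Proof.
split; first by apply/asboolP; exact: submodule0.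
by move=> c x y /asboolP Sx /asboolP Sy; apply/asboolP; exact: submodule_linear.
Qed.

HB.instance Definition _ := GRing.isSubmodClosed.Build R U submodule_pred submodule_pred_closed.

Record submodule_type := SubmoduleType { submodule_val :> U; _ : submodule_val \in submodule_pred }.
HB.instance Definition _ := [isSub for submodule_val].
HB.instance Definition _ := [Choice of submodule_type by <:].
HB.instance Definition _ := [SubChoice_isSubLmodule of submodule_type by <:].

Lemma submodule_valP (x : submodule_type) : submodule_set S (submodule_val x).
Proof. by case: x => x /= /asboolP. Qed.

Definition submodule_in x (Sx : submodule_set S x) : submodule_type := SubmoduleType (asboolT Sx).

Lemma submodule_valE c (x y : submodule_type) :
  submodule_val (c *: x + y) = c *: submodule_val x + submodule_val y.
Proof. by rewrite -[submodule_val]/val linearP. Qed.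

Lemma submodule_valB (x y : submodule_type) :
  submodule_val (x - y) = submodule_val x - submodule_val y.
Proof. by rewrite -[submodule_val]/val raddfB. Qed.
End Submodule.

(** * Square integrable functions and weak compactness of densities *)

Section SquareIntegrable.
Context d (T : measurableType d) {R : realType}.
Variables (mu : {measure set T -> \bar R}) (D : set T).
Hypothesis mD : measurable D.
Implicit Types f g h : T -> R.

(** The condition [L2] over an arbitrary measure space. *)
Definition sqint f : Prop :=
  measurable_fun D f /\ (\int[mu]_(x in D) ((f x) ^+ 2)%:E < +oo)%E.

Definition l2_ip f g : R := \int[mu]_(x in D) (f x * g x).

Lemma sqint_integrable f : sqint f -> mu.-integrable D (EFin \o (fun x => f x ^+ 2)).
Proof.
move=> [mf foo]; apply/integrableP; split.
  by apply/measurable_EFinP; exact: measurable_funX.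
by under eq_integral do rewrite /= ger0_norm ?sqr_ge0//.
Qed.

Lemma sqint_le f g : measurable_fun D f -> sqint g ->
  (forall x, D x -> f x ^+ 2 <= g x ^+ 2) -> sqint f.
Proof.
move=> mf [mg goo] fg; split => //; apply: le_lt_trans goo.
apply: ge0_le_integral => //.
- by move=> x _; rewrite lee_fin sqr_ge0.
- by apply/measurable_EFinP; exact: measurable_funX.
- by apply/measurable_EFinP; exact: measurable_funX.
Qed.

Lemma sqintM f g : sqint f -> sqint g -> mu.-integrable D (EFin \o (fun x => f x * g x)).
Proof.
move=> fS gS; have fgi := integrableD mD (sqint_integrable fS) (sqint_integrable gS).
apply: (le_integrable mD _ _ fgi).
  by apply/measurable_EFinP; apply: measurable_funM; [exact: fS.1|exact: gS.1].
move=> x _ /=; rewrite lee_fin (ger0_norm (addr_ge0 (sqr_ge0 _) (sqr_ge0 _))) ler_norml.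
have := sqr_ge0 (f x + g x); have := sqr_ge0 (f x - g x).
rewrite sqrrB sqrrD; have := sqr_ge0 (f x); have := sqr_ge0 (g x).
move=> ? ? ? ?; apply/andP; split; lra.
Qed.

Lemma sqint0 : sqint (fun=> 0).
Proof.
split; first exact: measurable_cst.
by under eq_integral do rewrite expr0n /=; rewrite integral0.
Qed.

Lemma sqint_linear c f g : sqint f -> sqint g -> sqint (fun x => c * f x + g x).
Proof.
move=> fS gS.
have mfg : measurable_fun D (fun x => c * f x + g x).
  by apply: measurable_funD; [apply: measurable_funM => //; exact: fS.1|exact: gS.1].
split => //.
have fgi := integrableD mD (integrableZl mD (2 * c ^+ 2) (sqint_integrable fS))
  (integrableZl mD 2 (sqint_integrable gS)).
apply: le_lt_trans (integrable_lty mD fgi).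
apply: ge0_le_integral => //.
- by move=> x _; rewrite lee_fin sqr_ge0.
- by apply/measurable_EFinP; exact: measurable_funX.
- exact: measurable_int fgi.
- move=> x _ /=; rewrite -!EFinM -EFinD lee_fin.
  have := sqr_ge0 (c * f x - g x); rewrite sqrrB sqrrD exprMn => ?; lra.
Qed.

Lemma sqintB f g : sqint f -> sqint g -> sqint (fun x => f x - g x).
Proof.
move=> fS gS; have := sqint_linear (-1) gS fS.
by congr sqint; apply/funext => x; rewrite mulN1r addrC.
Qed.

Lemma l2_ipC f g : l2_ip f g = l2_ip g f.
Proof. by rewrite /l2_ip; apply: eq_Rintegral => x _; rewrite mulrC. Qed.

Lemma l2_ip_linear c f g h : sqint f -> sqint g -> sqint h ->
  l2_ip (fun x => c * f x + g x) h = c * l2_ip f h + l2_ip g h.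
Proof.
move=> fS gS hS; rewrite /l2_ip -RintegralZl//; last exact: sqintM.
rewrite -RintegralD//; last exact: sqintM.
  by apply: eq_Rintegral => x _; rewrite mulrDl mulrA.
by have := integrableZl mD c (sqintM fS hS).
Qed.

Lemma l2_ip_ge0 f : 0 <= l2_ip f f.
Proof. by apply: Rintegral_ge0 => x _; rewrite -expr2 sqr_ge0. Qed.

Lemma l2_ipE f g : sqint f -> sqint g ->
  (\int[mu]_(x in D) (f x * g x)%:E)%E = (l2_ip f g)%:E.
Proof.
by move=> fS gS; rewrite fineK//; apply: integrable_fin_num => //; exact: sqintM.
Qed.

Lemma l2_sqE f : sqint f -> (\int[mu]_(x in D) (f x ^+ 2)%:E)%E = (l2_ip f f)%:E.
Proof. by move=> fS; rewrite -l2_ipE//. Qed.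

Lemma l2_sqP f (e : R) : measurable_fun D f ->
  (\int[mu]_(x in D) (f x ^+ 2)%:E <= e%:E)%E -> sqint f /\ l2_ip f f <= e.
Proof.
move=> mf fe; have fS : sqint f by split => //; apply: le_lt_trans fe (ltry _).
by split => //; rewrite -lee_fin -l2_sqE.
Qed.

(** Riesz-Fischer. A subsequence [h] with increments [dh k] of norm at most [c k] converges wherever
    the sum [G] of the [dh k ^+ 2 / c k] is finite, because |dh| <= c + dh^2 / c. The integral of
    [G] is at most the sum of the [c k], which is 1, so [G] is finite almost everywhere. *)
Lemma l2_complete (f : nat -> T -> R) : (forall n, sqint (f n)) ->
  (forall e : R, 0 < e -> exists N : nat, forall n m, (N <= n)%N -> (N <= m)%N ->
    l2_ip (fun x => f n x - f m x) (fun x => f n x - f m x) <= e) ->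
  exists2 g, sqint g & forall e : R, 0 < e -> exists N : nat, forall n, (N <= n)%N ->
    l2_ip (fun x => f n x - g x) (fun x => f n x - g x) <= e.
Proof.
move=> fS fC; pose c k : R := (2 ^+ k.+1)^-1.
have c_gt0 k : 0 < c k by rewrite invr_gt0 exprn_gt0.
have /choice[Nk HN] (k : nat) : exists N : nat, forall n m, (N <= n)%N -> (N <= m)%N ->
    l2_ip (fun x => f n x - f m x) (fun x => f n x - f m x) <= c k ^+ 2.
  by apply: fC; rewrite exprn_gt0.
(* Both [M k] and [M k.+1] are beyond [Nk k], and [M k] is at least [k]. *)
pose M k := (\sum_(i < k.+1) Nk i + k)%N.
have Mk k : (k <= M k)%N by rewrite leq_addl.
have NM k : (Nk k <= M k)%N.
  by rewrite /M big_ord_recr/= -addnA addnCA leq_addr.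
have NM1 k : (Nk k <= M k.+1)%N.
  by rewrite /M !big_ord_recr/= -!addnA addnCA leq_addr.
pose h k := f (M k); pose dh k x := h k.+1 x - h k x.
have dhS k : sqint (dh k) by apply: sqintB; exact: fS.
have fhS n k : sqint (fun x => f n x - h k x) by apply: sqintB; exact: fS.
have mh k : measurable_fun D (h k) by exact: (fS _).1.
pose G x := (\sum_(0 <= k <oo) ((c k)^-1 * dh k x ^+ 2)%:E)%E.
have Gk_ge0 k x : (0 <= ((c k)^-1 * dh k x ^+ 2)%:E)%E.
  by rewrite lee_fin mulr_ge0 ?sqr_ge0 ?invr_ge0 ?ltW.
have mGk k : measurable_fun D (fun x => ((c k)^-1 * dh k x ^+ 2)%:E).
  apply/measurable_EFinP; apply: measurable_funM => //.
  by apply: measurable_funX; exact: (dhS k).1.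
have mG : measurable_fun D G.
  by apply: ge0_emeasurable_sum => // k x _ _; exact: Gk_ge0.
have Goo : (\int[mu]_(x in D) G x < +oo)%E.
  rewrite integral_nneseries//.
  apply: (@le_lt_trans _ _ (\sum_(0 <= k <oo) (c k)%:E)%E).
    apply: lee_nneseries => [k _ _|k _]; first exact: integral_ge0.
    under eq_integral do rewrite EFinM.
    rewrite ge0_integralZl//; last 3 first.
    - by apply/measurable_EFinP; apply: measurable_funX; exact: (dhS k).1.
    - by move=> x _; rewrite lee_fin sqr_ge0.
    - by rewrite lee_fin invr_ge0 ltW.
    rewrite l2_sqE// -EFinM lee_fin mulrC ler_pdivrMr// -expr2.
    by apply: HN.
  have := @cvg_geometric_eseries_half R 1 0.
  rewrite expr0 divr1 => E.
  rewrite (_ : (\sum_(0 <= k <oo) _)%E = 1%:E) ?ltry// -[RHS](cvg_lim _ E)//.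
  congr (limn _); apply/funext => n; rewrite /eseries /=; apply: eq_bigr => k _.
  by rewrite addn1 natrX div1r.
have Gfin : {ae mu, forall x, D x -> G x \is a fin_num}.
  apply: (integrable_ae mD); apply/integrableP; split => //.
  rewrite (eq_integral G)// => x _; rewrite gee0_abs//; exact: nneseries_ge0.
have good x : D x -> G x \is a fin_num -> cvgn (h ^~ x).
  move=> Dx Gx.
  have hE n : h n x = h 0%N x + series (dh ^~ x) n.
    by rewrite /series/= telescope_sumr// addrC subrK.
  suff cs : cvgn (series (dh ^~ x)).
    rewrite (_ : h ^~ x = (fun n => h 0%N x + series (dh ^~ x) n)); last exact/funext.
    by apply: is_cvgD => //; exact: is_cvg_cst.
  apply: normed_cvg; apply: nondecreasing_is_cvgn.
    by apply: nondecreasing_series => n _ _ /=.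
  exists (1 + fine (G x)) => _ [n _ <-]; rewrite /series/=.
  apply: (@le_trans _ _ (\sum_(0 <= k < n) (c k + (c k)^-1 * dh k x ^+ 2))).
    apply: ler_sum => k _; set y := dh k x.
    have ck := c_gt0 k; rewrite -(ler_pM2l ck) mulrDr mulrA mulfV ?gt_eqF// mul1r.
    rewrite -[y ^+ 2](real_normK (num_real y)).
    have := sqr_ge0 (`|y| - c k); have := sqr_ge0 (c k); rewrite sqrrB => ? ?.
    have := mulr_ge0 (ltW ck) (normr_ge0 y); rewrite -expr2; lra.
  rewrite big_split/=; apply: lerD.
    have -> : \sum_(0 <= k < n) c k = 1 - (2 ^+ n)^-1.
      elim: n => [|n ih]; first by rewrite big_geq// expr0 invr1 subrr.
      by rewrite big_nat_recr//= ih /c exprS; field; rewrite expf_neq0.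
    by rewrite lerBlDr lerDl invr_ge0 exprn_ge0.
  rewrite -lee_fin fineK// -sumEFin.
  by apply: nneseries_lim_ge => k _ _; exact: Gk_ge0.
(* The upper limit is measurable on all of [D], whether or not the sequence converges; where it is
   infinite, [fine] returns 0. *)
pose g x := fine (limn_esup (fun k => (h k x)%:E)).
have gE x : D x -> G x \is a fin_num -> h k x @[k --> \oo] --> g x.
  move=> Dx Gx; have /cvg_ex[l hl] := good x Dx Gx.
  rewrite /g; suff -> : limn_esup (fun k => (h k x)%:E) = l%:E by [].
  have hl' : (h k x)%:E @[k --> \oo] --> l%:E by apply: cvg_EFin => //; exact: nearW.
  by rewrite (cvg_limn_einf_sup hl').2.
have mg : measurable_fun D g.
  apply: (measurableT_comp (fine_measurable measurableT)).
  by apply: measurable_fun_limn_esup => k; apply/measurable_EFinP.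
(* Fatou's lemma in [k]: a bound on [f n - h k] for large [k] passes to [f n - g]. *)
have key n (e : R) (K : nat) : (forall k, (K <= k)%N ->
    l2_ip (fun x => f n x - h k x) (fun x => f n x - h k x) <= e) ->
    (\int[mu]_(x in D) ((f n x - g x) ^+ 2)%:E <= e%:E)%E.
  move=> He; have mnk k : measurable_fun D (fun x => ((f n x - h k x) ^+ 2)%:E).
    apply/measurable_EFinP; apply: measurable_funX; apply: measurable_funB => //.
    exact: (fS n).1.
  apply: (@le_trans _ _ (\int[mu]_(x in D) limn_einf (fun k => ((f n x - h k x) ^+ 2)%:E)))%E.
    apply: ae_ge0_le_integral => //.
    - by move=> x _; rewrite lee_fin sqr_ge0.
    - apply/measurable_EFinP; apply: measurable_funX; apply: measurable_funB => //.
      exact: (fS n).1.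
    - move=> x _; rewrite limn_einf_lim; apply: lime_ge; first exact: is_cvg_einfs.
      apply: nearW => k; apply: le_ereal_inf_tmp => _ [i _ <-].
      by rewrite lee_fin sqr_ge0.
    - rewrite (_ : (fun x => _) =
          (fun x => - limn_esup (fun k => - ((f n x - h k x) ^+ 2)%:E))%E); last first.
        apply/funext => x; rewrite -limn_einfN; congr limn_einf.
        by apply/funext => k /=; rewrite opprK.
      apply: measurableT_comp => //; apply: measurable_fun_limn_esup => k.
      by apply: measurableT_comp => //; exact: mnk.
    - apply: filterS Gfin => x Gx Dx; have {}Gx := Gx Dx.
      have hg : ((f n x - h k x) ^+ 2)%:E @[k --> \oo] --> ((f n x - g x) ^+ 2)%:E.
        have h1 : f n x - h k x @[k --> \oo] --> f n x - g x.
          by apply: cvgB; [exact: cvg_cst|exact: gE].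
        apply: cvg_EFin; first exact: nearW.
        rewrite expr2 [X in X @ _](_ : _ = fun k => (f n x - h k x) * (f n x - h k x)).
          exact: cvgM.
        by apply/funext => k /=; rewrite expr2.
      by rewrite (cvg_limn_einf_sup hg).1.
  apply: le_trans (fatou mu mD mnk _) _; first by move=> k x _; rewrite lee_fin sqr_ge0.
  rewrite limn_einf_lim; apply: lime_le; first exact: is_cvg_einfs.
  exists K => // k /= Kk; apply: (@le_trans _ _ (\int[mu]_(x in D) ((f n x - h k x) ^+ 2)%:E)%E).
    by apply: ereal_inf_lbound; exists k => //=.
  by rewrite l2_sqE ?lee_fin ?He//; exact: fhS.
have key2 (e : R) : 0 < e -> exists N : nat, forall n, (N <= n)%N ->
    (\int[mu]_(x in D) ((f n x - g x) ^+ 2)%:E <= e%:E)%E.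
  move=> e0; have [N HNe] := fC e e0; exists N => n Nn.
  by apply: (key n e N) => k Nk'; apply: HNe => //; exact: leq_trans (Mk k).
have gS : sqint g.
  have [N HN1] := key2 1 ltr01.
  have mfg : measurable_fun D (fun x => f N x - g x).
    by apply: measurable_funB => //; exact: (fS N).1.
  have [fgS _] := l2_sqP mfg (HN1 N (leqnn N)).
  have := sqintB (fS N) fgS; congr sqint; apply/funext => x.
  by rewrite opprB addrC subrK.
exists g => // e e0; have [N HNe] := key2 e e0; exists N => n Nn.
by rewrite -lee_fin -l2_sqE ?HNe//; exact: sqintB.
Qed.

End SquareIntegrable.

(** * Riesz representation for a complete seminorm *)

Section Riesz.
Context {R : realType} {V : lmodType R}.

Lemma sqr_le_norm (x y : R) : 0 <= y -> x ^+ 2 <= y ^+ 2 -> `|x| <= y.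
Proof.
by move=> y0; rewrite -(real_normK (num_real x)) ler_sqr ?nnegrE.
Qed.

(** The vector minimizes [J x = q x x - 2 * L x], which is bounded below by [- K]; the first-order
    condition at the minimum is the claimed identity. *)
Lemma riesz_representation (q : V -> V -> R) (L : V -> R) (K : R) :
  semi_inner q -> si_complete q ->
  (forall c x y, L (c *: x + y) = c * L x + L y) -> (forall x, L x ^+ 2 <= K * q x x) ->
  exists v, forall y, L y = q v y.
Proof.
move=> qI qC Ll LK0.
wlog K0 : K LK0 / 0 <= K => [wlog|].
  apply: (wlog `|K|) => // x; apply: le_trans (LK0 x) _.
  by rewrite ler_wpM2r ?ler_norm ?(si_ge0 qI).
have LK := LK0.
have LD x y : L (x + y) = L x + L y by rewrite -[x]scale1r Ll scale1r mul1r.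
have L0 : L 0 = 0 by have := LD 0 0; rewrite addr0; lra.
have LZ c x : L (c *: x) = c * L x by rewrite -[c *: x]addr0 Ll L0 addr0.
have LB x y : L (x - y) = L x - L y by rewrite -scaleN1r LD LZ mulN1r.
pose J x := q x x - 2 * L x.
have J_ge x : - K <= J x.
  have h : (K + q x x) ^+ 2 >= (2 * L x) ^+ 2.
    have := LK x; have := sqr_ge0 (K - q x x); rewrite exprMn; nra.
  have := sqr_le_norm (addr_ge0 K0 (si_ge0 qI x)) h.
  by have := ler_norm (2 * L x); rewrite /J => ? ?; lra.
pose S := range J.
have hS : has_inf S.
  by split; [exists (J 0), 0|exists (- K) => _ [x _ <-]].
pose j := inf S.
have j_le x : j <= J x by apply: ge_inf; [exact: hS.2|exists x].
have /choice[x Hx] (n : nat) : exists x, J x <= j + n.+1%:R^-1.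
  have n0 : 0 < n.+1%:R^-1 :> R by rewrite invr_gt0.
  by have [_ [w _ <-] Jw] := inf_adherent n0 hS; exists w; exact: ltW.
have [F [FU FF]] := @ultraFilterLemma nat \oo _.
have small (e : R) : 0 < e -> \forall n \near F, J (x n) <= j + e.
  move=> e0; have [N Ne] := ltr_add_invr e0; rewrite add0r in Ne.
  have : F [set n | (N <= n)%N] by apply: FF; exact: nbhs_infty_ge.
  apply: filterS => n /= Nn; apply: le_trans (Hx n) _; rewrite lerD2l.
  by apply: le_trans (ltW Ne); rewrite lef_pV2 ?posrE// ler_nat.
have xC : si_cauchy F q x.
  move=> e e0; exists [set n | J (x n) <= j + e / 4]; first by apply: small; rewrite divr_gt0.
  move=> n m /= Jn Jm; have := j_le ((2^-1) *: (x n + x m)).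
  rewrite /J (si_sqZ qI) LZ LD (si_sqD qI) (si_sqB qI); rewrite /J in Jn Jm; lra.
have [v xv] := si_complete_filter _ qI qC xC.
have qx y : q (x n) y @[n --> F] --> q v y.
  apply: (@si_cvg _ _ F q (fun=> q) _ _ (fun=> y) v y) => //; last exact: cvg_cst.
  by under eq_fun do rewrite subrr (si0l qI); exact: cvg_cst.
have qxx : q (x n) (x n) @[n --> F] --> q v v.
  by apply: (@si_cvg _ _ F q (fun=> q) _ _ _ v v) => //; exact: cvg_cst.
have Lx : L (x n) @[n --> F] --> L v.
  apply/cvgrPdist_le => e e0.
  have d0 : 0 < e ^+ 2 / (`|K| + 1) by rewrite divr_gt0 ?exprn_gt0// ltr_wpDl.
  apply: (@filterS _ F _ _ _ _ (cvgr_le 0 xv _ d0)) => n hn.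
  rewrite -LB; apply: sqr_le_norm; first exact: ltW.
  apply: le_trans (LK _) _; rewrite (si_sqBC qI).
  move: hn; rewrite ler_pdivlMr ?ltr_wpDl// => hn.
  have := si_ge0 qI (x n - v); have := ler_norm K; nra.
have Jv : J v <= j.
  have Jx : J (x n) @[n --> F] --> J v.
    by apply: cvgB => //; apply: cvgM => //; exact: cvg_cst.
  apply/ler_addgt0Pr => e e0.
  rewrite -(cvg_lim _ Jx)//; apply: limr_le; first by apply/cvg_ex; exists (J v).
  exact: small.
exists v => y; apply/eqP; rewrite -subr_eq0 -opprB oppr_eq0; apply/eqP.
apply: (@linear_perturbation0 _ _ (q y y)) => s.
have := j_le (v + s *: y); rewrite /J in Jv *.
by rewrite (si_sqD qI) (si_sqZ qI) (siZr qI) LD LZ => h; lra.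
Qed.

End Riesz.

Section L2Space.
Context d (T : measurableType d) {R : realType}.
Variables (mu : {measure set T -> \bar R}) (D : set T).
Hypothesis mD : measurable D.

Definition sqint_submodule : @submodule R (T -> R) :=
  Submodule (sqint0 mu D) (fun c f g => @sqint_linear _ _ _ mu D mD c f g).

Definition l2_form (x y : submodule_type sqint_submodule) : R :=
  l2_ip mu D (submodule_val x) (submodule_val y).

Let vP (v : submodule_type sqint_submodule) : sqint mu D (submodule_val v).
Proof. exact: (submodule_valP v). Qed.

Lemma l2_formI : semi_inner l2_form.
Proof.
split=> [x y|c x y z|x]; first exact: l2_ipC.
  by rewrite /l2_form submodule_valE; exact: l2_ip_linear.
exact: l2_ip_ge0.
Qed.

Lemma l2_form_complete : si_complete l2_form.
Proof.
move=> x xC; have [||g gS Hg] := @l2_complete _ _ _ mu D mD (fun n => submodule_val (x n)).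
- by move=> n; exact: vP.
- by move=> e /xC[N HN]; exists N => n m Nn Nm; have := HN n m Nn Nm; rewrite /l2_form submodule_valB.
exists (@submodule_in _ _ sqint_submodule g gS) => e /Hg[N HN]; exists N => n Nn.
by have := HN n Nn; rewrite /l2_form submodule_valB.
Qed.

Lemma l2_CS f g : sqint mu D f -> sqint mu D g ->
  l2_ip mu D f g ^+ 2 <= l2_ip mu D f f * l2_ip mu D g g.
Proof.
move=> fS gS; exact: (si_CS l2_formI (@submodule_in _ _ sqint_submodule f fS)
  (@submodule_in _ _ sqint_submodule g gS)).
Qed.

End L2Space.

(** * Weak compactness of densities *)

Section WeakStar.
Context d (T : measurableType d) {R : realType}.
Variables (mu : {measure set T -> \bar R}) (D : set T).
Hypothesis mD : measurable D.
Hypothesis finD : (mu D < +oo)%E.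
Implicit Types f g h r : T -> R.

(** The bounds hold at every point of [D]. Admissible densities, bounded only almost everywhere, are
    brought to this form by [clamp]. *)
Definition density r : Prop := measurable_fun D r /\ forall x, D x -> 0 <= r x <= 1.

Lemma sqint_bounded (M : R) f : measurable_fun D f -> (forall x, D x -> `|f x| <= M) ->
  sqint mu D f.
Proof.
move=> mf fM; split => //; apply: (@le_lt_trans _ _ (\int[mu]_(x in D) (M ^+ 2)%:E)%E).
  apply: ge0_le_integral => //.
  - by move=> x _; rewrite lee_fin sqr_ge0.
  - by apply/measurable_EFinP; exact: measurable_funX.
  - move=> x Dx; rewrite lee_fin -(real_normK (num_real (f x))).
    by rewrite ler_sqr ?nnegrE ?fM// (le_trans _ (fM x Dx)).
by rewrite integral_cst// lte_mul_pinfty// ?lee_fin ?sqr_ge0.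
Qed.

Lemma sqint_integrable1 f : sqint mu D f -> mu.-integrable D (EFin \o f).
Proof.
move=> fS; have oneS : sqint mu D (fun=> 1) by apply: (@sqint_bounded 1) => // x _; rewrite normr1.
by have := sqintM mD fS oneS; congr (_.-integrable _ _); apply/funext => x /=; rewrite mulr1.
Qed.

Lemma density_sqint r : density r -> sqint mu D r.
Proof.
move=> [mr r01]; apply: (@sqint_bounded 1) => // x Dx.
by have /andP[r0 r1] := r01 x Dx; rewrite ger0_norm.
Qed.

Lemma integrable_density r f : density r -> mu.-integrable D (EFin \o f) ->
  mu.-integrable D (EFin \o (fun x => r x * f x)).
Proof.
move=> [mr r01] fi; apply: (le_integrable mD _ _ fi).
  apply/measurable_EFinP; apply: measurable_funM => //.
  exact/measurable_EFinP/(measurable_int _ fi).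
move=> x Dx /=; have /andP[r0 r1] := r01 x Dx.
by rewrite lee_fin normrM (ger0_norm r0) ler_piMl.
Qed.

Let V := submodule_type (sqint_submodule mu mD).
Let q : V -> V -> R := @l2_form _ T R mu D mD.
Let vP (v : V) : sqint mu D (submodule_val v). Proof. exact: (submodule_valP v). Qed.
Let qI : semi_inner q. Proof. exact: l2_formI. Qed.
Let qC : si_complete q. Proof. exact: l2_form_complete. Qed.

(** A product of two traces is integrable but need not be square integrable, whereas the weak limit
    is built in L^2. Truncation bridges the gap, as densities are bounded by 1. *)
Lemma truncation_L1 f (e : R) : mu.-integrable D (EFin \o f) -> 0 < e ->
  exists2 w, sqint mu D w & \int[mu]_(x in D) `|f x - w x| <= e.
Proof.
move=> fi e0; have mf : measurable_fun D f by exact/measurable_EFinP/(measurable_int _ fi).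
pose w (n : nat) x := Num.max (- n%:R) (Num.min n%:R (f x)) : R.
have mw n : measurable_fun D (w n).
  by apply: measurable_maxr => //; apply: measurable_minr.
have wf n x : `|f x - w n x| <= `|f x|.
  rewrite /w; have n0 : 0 <= n%:R :> R by [].
  have [h1|h1] := leP n%:R (f x).
    rewrite max_r; last by lra.
    by rewrite !ger0_norm ?subr_ge0 ?(le_trans n0)// gerBl.
  have [h2|h2] := leP (- n%:R) (f x); first by rewrite subrr normr0.
  by rewrite !ler0_norm; lra.
have dc : (\int[mu]_(x in D) (`|f x - w n x|)%:E @[n --> \oo] --> 0)%E.
  rewrite [X in _ --> X](_ : _ = \int[mu]_(x in D) (cst 0 x))%E; last by rewrite integral0.
  apply: (@dominated_cvg _ _ _ mu D mD (fun n x => (`|f x - w n x|)%:E) (cst 0%E) (fun x => `|(f x)%:E|%E)).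
  - move=> n; apply/measurable_EFinP; apply: measurableT_comp => //.
    exact: measurable_funB.
  - move=> x Dx; apply: cvg_near_cst.
    have := nbhs_infty_ger `|f x|; apply: filterS => n fn.
    rewrite /w min_r; last exact: le_trans (ler_norm _) fn.
    by rewrite max_r ?subrr ?normr0//; move: fn; rewrite ler_norml => /andP[].
  - by [].
  - exact: integrable_abse fi.
  - by move=> n x Dx /=; rewrite lee_fin normr_id wf.
have /fine_cvgP[_ /cvgrPdist_le/(_ e e0)[N _ /(_ N (leqnn N))]] := dc.
rewrite sub0r normrN /= => h; exists (w N).
  apply: (@sqint_bounded N%:R) => // x _; rewrite /w ler_norml.
  have n0 : 0 <= N%:R :> R by [].
  by rewrite le_max lexx/= ge_max ge_min lexx andbT (le_trans _ n0)// oppr_le0.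
exact: le_trans (ler_norm _) h.
Qed.

(** Inner products with the densities converge along the ultrafilter, and Riesz represents their
    limits by some [s0] in L^2. Testing shows that [s0] lies between 0 and 1 almost everywhere, and
    truncation extends the convergence to integrable test functions. *)
Lemma density_weak_compact (F : set_system nat) (r : nat -> T -> R) :
  UltraFilter F -> (forall n, density (r n)) ->
  exists2 s, density s & forall f, mu.-integrable D (EFin \o f) ->
    \int[mu]_(x in D) (r n x * f x) @[n --> F] --> \int[mu]_(x in D) (s x * f x).
Proof.
move=> FU rD.
have rS n := density_sqint (rD n).
pose rv n : V := @submodule_in _ _ (sqint_submodule mu mD) (r n) (rS n).
pose K := q (rv 0%N) (rv 0%N).
pose K1 := \int[mu]_(x in D) (1 : R).
have oneS : sqint mu D (fun=> 1) by apply: (@sqint_bounded 1) => // x _; rewrite normr1.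
have one_int := sqint_integrable1 oneS.
have rK n : q (rv n) (rv n) <= K1.
  apply: le_Rintegral => //; first exact: sqintM.
  move=> x Dx /=; have /andP[r0 r1] := (rD n).2 x Dx; rewrite -(mulr1 1).
  exact: ler_pM.
have K1_ge0 : 0 <= K1 by exact: Rintegral_ge0.
have qb v n : `|q (rv n) v| <= Num.sqrt K1 * seminorm q v.
  apply: le_trans (si_le_seminorm qI _ _) _; rewrite ler_wpM2r ?seminorm_ge0//.
  by rewrite ler_wsqrtr.
have /choice[L HL] (v : V) : exists l : R, q (rv n) v @[n --> F] --> l.
  by apply: (@ultra_cvg _ F _ (Num.sqrt K1 * seminorm q v)) => //; exact: nearW.
have [||sv Hs] := @riesz_representation _ _ q L K1 qI qC.
- move=> c x y; apply: (cvg_unique _ (HL (c *: x + y))) => //.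
  rewrite (_ : (fun n => _) = (fun n => c * q (rv n) x + q (rv n) y)); last first.
    by apply/funext => n; rewrite (siDr qI) (siZr qI).
  by apply: cvgD => //; apply: cvgM => //; exact: cvg_cst.
- move=> x; rewrite -(seminorm_sq qI) -(sqr_sqrtr K1_ge0) -exprMn.
  rewrite -[leLHS](real_normK (num_real _)) ler_sqr ?nnegrE ?mulr_ge0 ?sqrtr_ge0//.
  rewrite -(cvg_lim _ (cvg_norm (HL x)))//; apply: limr_le.
    by apply/cvg_ex; eexists; exact: cvg_norm (HL x).
  exact: nearW.
pose s0 := submodule_val sv; have s0S : sqint mu D s0 by exact: (submodule_valP sv).
have s0w w : sqint mu D w -> l2_ip mu D (r n) w @[n --> F] --> l2_ip mu D s0 w.
  move=> wS; have := HL (@submodule_in _ _ (sqint_submodule mu mD) w wS).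
  by rewrite Hs.
have ms0 := s0S.1.
(* The violations of the two bounds. Against [w1] the limit is nonnegative but equals minus its
   squared norm; [w2] is treated in the same way with [1 - s0]. *)
pose w1 x := Num.max (- s0 x) 0; pose w2 x := Num.max (s0 x - 1) 0.
have w1S : sqint mu D w1.
  apply: (sqint_le mD _ s0S); first by apply: measurable_maxr => //; exact: measurableT_comp.
  move=> x _; rewrite /w1; have [h|h] := leP (- s0 x) 0; last by rewrite sqrrN.
  by rewrite [leLHS]expr2 mul0r sqr_ge0.
have s1S : sqint mu D (fun x => s0 x - 1) by exact: sqintB.
have w2S : sqint mu D w2.
  apply: (sqint_le mD _ s1S); first by apply: measurable_maxr => //; exact: s1S.1.
  move=> x _; rewrite /w2; have [h|h] := leP (s0 x - 1) 0; last by [].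
  by rewrite [leLHS]expr2 mul0r sqr_ge0.
have limit_ge0 c w : sqint mu D w -> (forall n, 0 <= l2_ip mu D (r n) w + c) ->
    0 <= l2_ip mu D s0 w + c.
  move=> wS h; have cw : l2_ip mu D (r n) w + c @[n --> F] --> l2_ip mu D s0 w + c.
    by apply: cvgD; [exact: s0w|exact: cvg_cst].
  rewrite -(cvg_lim _ cw)//; apply: limr_ge; first by apply/cvg_ex; eexists; exact: cw.
  exact: nearW.
have ipN x y : sqint mu D x -> sqint mu D y ->
    l2_ip mu D (fun t => - x t) y = - l2_ip mu D x y.
  move=> xS yS; rewrite /l2_ip -mulN1r -RintegralZl//; last exact: sqintM.
  by apply: eq_Rintegral => t _; rewrite mulN1r mulNr.
have w1_0 : l2_ip mu D w1 w1 = 0.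
  apply/eqP; rewrite eq_le l2_ip_ge0 andbT.
  have : 0 <= l2_ip mu D s0 w1 + 0.
    apply: limit_ge0 => // n; rewrite addr0; apply: Rintegral_ge0 => x Dx.
    by have /andP[r0 _] := (rD n).2 x Dx; rewrite mulr_ge0// /w1 le_max lexx orbT.
  rewrite addr0 -oppr_le0 -ipN//; congr (_ <= _).
  apply: eq_Rintegral => x _; rewrite /w1; case: leP => h //; by rewrite !mulr0.
have w2_0 : l2_ip mu D w2 w2 = 0.
  apply/eqP; rewrite eq_le l2_ip_ge0 andbT.
  have w2N : sqint mu D (fun x => - w2 x).
    by have := sqintB mD (sqint0 mu D) w2S; congr sqint; apply/funext => x; rewrite sub0r.
  have : 0 <= l2_ip mu D s0 (fun x => - w2 x) + l2_ip mu D (fun=> 1) w2.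
    apply: limit_ge0 => // n; rewrite l2_ipC ipN// addrC subr_ge0 l2_ipC.
    apply: le_Rintegral => //; [exact: sqintM|exact: sqintM|] => x Dx.
    have /andP[_ r1] := (rD n).2 x Dx; rewrite ler_wpM2r//.
    by rewrite /w2 le_max lexx orbT.
  rewrite l2_ipC ipN// l2_ipC addrC subr_ge0 => h.
  suff -> : l2_ip mu D w2 w2 = l2_ip mu D (fun x => (-1) * 1 + s0 x) w2.
    by rewrite (l2_ip_linear mD (-1) oneS s0S w2S); lra.
  apply: eq_Rintegral => x _; rewrite /w2; case: leP => h'; rewrite ?mulr0//.
  by rewrite mulr1 addrC.
(* Clipping makes the bounds hold everywhere and changes [s0] only by functions of norm 0. *)
pose s x := Num.max 0 (Num.min 1 (s0 x)).
have sE x : s x = s0 x + w1 x - w2 x.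
  rewrite /s /w1 /w2; have [h1|h1] := leP 1 (s0 x).
    rewrite max_r// [Num.max _ 0]max_r ?[Num.max _ 0]max_l; lra.
  have [h2|h2] := leP 0 (s0 x); first by rewrite !max_r; lra.
  by rewrite max_l ?max_r; lra.
have sD : density s.
  split; last by move=> x _; rewrite /s le_max lexx/= ge_max ler01/= ge_min lexx.
  by apply: measurable_maxr => //; exact: measurable_minr.
have sS := density_sqint sD.
have sw w : sqint mu D w -> l2_ip mu D s w = l2_ip mu D s0 w.
  move=> wS; have CS x : sqint mu D x -> l2_ip mu D x x = 0 -> l2_ip mu D x w = 0.
    move=> xS x0.
    have := si_CS qI (@submodule_in _ _ (sqint_submodule mu mD) x xS) (@submodule_in _ _ (sqint_submodule mu mD) w wS).
    rewrite /q/l2_form/= x0 mul0r => h; apply/eqP; rewrite -sqrf_eq0 eq_le h sqr_ge0.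
    by [].
  have -> : s = (fun x => (-1) * w2 x + (1 * w1 x + s0 x)).
    by apply/funext => x; rewrite sE; ring.
  have w1s0S := sqint_linear mD 1 w1S s0S.
  rewrite (l2_ip_linear mD _ w2S w1s0S wS) (l2_ip_linear mD _ w1S s0S wS).
  by rewrite (CS _ w1S w1_0) (CS _ w2S w2_0); ring.
exists s => // f fi; apply/cvgrPdist_le => e e0.
have [w wS fw] := truncation_L1 fi (ltac:(lra) : 0 < e / 3).
have wi := sqint_integrable1 wS.
have fwi : mu.-integrable D (EFin \o (fun x => f x - w x)) by exact: (integrableB mD fi wi).
have close t : density t -> `|\int[mu]_(x in D) (t x * f x) - l2_ip mu D t w| <= e / 3.
  move=> tD; rewrite -RintegralB//; [|exact: integrable_density|exact: integrable_density].
  apply: le_trans fw; apply: le_trans (le_normr_Rintegral mD _) _.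
    have := integrable_density tD fwi; apply: eq_integrable => // x _ /=.
    by rewrite mulrBr.
  apply: le_Rintegral => //.
  - have := integrable_norm (integrable_density tD fwi); apply: eq_integrable => // x _ /=.
    by rewrite mulrBr.
  - exact: (integrable_norm fwi).
  - move=> x Dx; have /andP[t0 t1] := tD.2 x Dx.
    by rewrite -mulrBr normrM (ger0_norm t0) ler_piMl.
have e3 : 0 < e / 3 by lra.
have /cvgrPdist_le/(_ _ e3) := s0w w wS.
apply: (@filterS _ F _) => n hn.
have := close _ sD; have := close _ (rD n); rewrite sw// => h1 h2.
move: hn h1 h2; rewrite !ler_norml => /andP[? ?] /andP[? ?] /andP[? ?].
by apply/andP; split; lra.
Qed.
End WeakStar.

(** * Integration in the plane *)

Section PlaneMeasurability.
Context {R : realType}.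

Lemma nbhs_box (x : R * R) (A : set (R * R)) :
  nbhs x A <-> exists2 e : R, 0 < e &
    forall y : R * R, `|y.1 - x.1| < e -> `|y.2 - x.2| < e -> A y.
Proof.
rewrite -nbhs_ballE; split=> [[e /= e0 eA]|[e e0 eA]].
  by exists e => // y y1 y2; apply: eA; split; rewrite /ball/= distrC.
by exists e => // y [y1 y2]; apply: eA; rewrite distrC.
Qed.

Lemma open_box (O : set (R * R)) (x : R * R) : open O -> O x -> exists2 e : R, 0 < e &
    forall y : R * R, `|y.1 - x.1| < e -> `|y.2 - x.2| < e -> O y.
Proof. by move=> oO Ox; apply/nbhs_box; exact: open_nbhs_nbhs. Qed.

(** The sigma-algebra is a product of Borel ones; an open set is the union of the countably many
    rational squares [Q a b n] that it contains. *)
Lemma open_measurable_plane (O : set (R * R)) : open O -> measurable (O : set (plane R)).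
Proof.
move=> oO; pose I (a : rat) (n : nat) : set R := [set x | `|x - ratr a| < n.+1%:R^-1].
have mI a n : measurable (I a n : set (measurableTypeR R)).
  rewrite (_ : I a n = `]ratr a - n.+1%:R^-1, ratr a + n.+1%:R^-1[%classic) //.
  by apply/seteqP; split => x; rewrite /I /= in_itv/= ltr_distl.
pose Q a b n : set (R * R) := if `[< I a n `*` I b n `<=` O >] then I a n `*` I b n else set0.
rewrite (_ : O = \bigcup_(a : rat) \bigcup_(b : rat) \bigcup_(n : nat) Q a b n).
  apply: bigcupT_measurable_rat => a; apply: bigcupT_measurable_rat => b.
  apply: bigcupT_measurable => n; rewrite /Q; case: ifP => _ //.
  exact: measurableX.
apply/seteqP; split=> [[x y] Oxy|x [a _ [b _ [n _]]]]; last first.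
  by rewrite /Q; case: ifP => // /asboolP; apply.
have [e e0 eO] := open_box oO Oxy.
have e2 : 0 < e / 2 by lra.
have [n ne] := ltr_add_invr e2; rewrite add0r in ne.
have n0 : 0 < n.+1%:R^-1 :> R by rewrite invr_gt0.
have rat_near (z : R) : exists a : rat, I a n z.
  have [|a] := @rat_in_itvoo R z (z + n.+1%:R^-1); first by rewrite ltrDl.
  by rewrite in_itv/= => /andP[za az]; exists a; rewrite /I/= ltr_distl ltrBlDr az/= (lt_trans za)// ltrDl.
have [a xa] := rat_near x; have [b yb] := rat_near y.
have close (z z' : R) c : I c n z -> I c n z' -> `|z' - z| < e.
  move: ne; rewrite /I /= !ltr_distl; move: (n.+1%:R^-1) => dn dne /andP[? ?] /andP[? ?].
  by apply/andP; split; lra.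
exists a => //; exists b => //; exists n => //; rewrite /Q; case: ifP => [//|/asboolP[]].
by move=> [x' y'] [/= x'a y'b]; apply: eO; [exact: close xa _|exact: close yb _].
Qed.

Lemma closed_measurable_plane (C : set (R * R)) : closed C -> measurable (C : set (plane R)).
Proof.
by move=> cC; rewrite -(setCK C); apply: measurableC; apply: open_measurable_plane; exact: closed_openC.
Qed.

Lemma continuous_measurable_plane (f : R * R -> R) : continuous f ->
  measurable_fun setT (f : plane R -> R).
Proof.
move=> cf; apply: (measurability _ (RGenOInfty.measurableE R)).
move=> _ [_ [a ->] <-]; rewrite setTI; apply: open_measurable_plane.
by apply: open_comp => // x _; exact: cf.
Qed.

End PlaneMeasurability.

Section LebesgueShift.
Context {R : realType}.
Local Open Scope ereal_scope.
Notation leb := (@lebesgue_measure R).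

Lemma lebesgue_measure_shift (a : R) (A : set R) : measurable A ->
  pushforward leb ((fun x => x + a)%R : _ -> measurableTypeR R) A = leb A.
Proof.
move=> mA; apply/esym.
apply: (@lebesgue_measure_unique R (pushforward leb ((fun x => x + a)%R : measurableTypeR R -> measurableTypeR R))) => //=.
  by apply: measurable_funD.
move=> _ _ [[b c]] _ <-.
rewrite /pushforward.
have -> : (fun x => x + a)%R @^-1` [set` `]b, c]%R] = [set` `](b - a)%R, (c - a)%R]%R].
  by apply/seteqP; split => x /=; rewrite !in_itv/= ltrBlDr lerBrDr.
rewrite !lebesgue_measure_itv/= !lte_fin.
by rewrite ltrD2r -!EFinD opprB addrA subrK.
Qed.

Lemma integral_shift (f : R -> \bar R) (a : R) : measurable_fun setT f ->
  (forall x, 0 <= f x) -> \int[leb]_x f (x + a)%R = \int[leb]_x f x.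
Proof.
move=> mf f0.
have ms : measurable_fun setT ((fun x => x + a)%R : measurableTypeR R -> measurableTypeR R).
  exact: measurable_funD.
transitivity (\int[pushforward leb ((fun x => x + a)%R : _ -> measurableTypeR R)]_x f x).
  by rewrite ge0_integral_pushforward.
by apply: eq_measure_integral => //= A mA _; exact: lebesgue_measure_shift.
Qed.

Lemma integral_reflect (f : R -> \bar R) : measurable_fun setT f ->
  (forall x, 0 <= f x) -> \int[leb]_x f (- x)%R = \int[leb]_x f x.
Proof.
move=> mf f0.
transitivity (\int[pushforward leb (-%R : _ -> measurableTypeR R)]_x f x).
  by rewrite ge0_integral_pushforward.
by apply: eq_measure_integral => //= A mA _; exact: lebesgue_measureN.
Qed.

End LebesgueShift.

Section PlaneIntegral.
Context {R : realType}.
Local Open Scope ereal_scope.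
Notation leb := (@lebesgue_measure R).
Implicit Types H : plane R -> \bar R.

Lemma area_tonelli12 H : measurable_fun setT H -> (forall x, 0 <= H x) ->
  \int[area]_z H z = \int[leb]_x \int[leb]_y H (x, y).
Proof. by move=> mH H0; rewrite -(fubini_tonelli1 (m1 := leb) (m2 := leb) H). Qed.

Lemma area_tonelli21 H : measurable_fun setT H -> (forall x, 0 <= H x) ->
  \int[area]_z H z = \int[leb]_y \int[leb]_x H (x, y).
Proof.
by move=> mH H0; rewrite area_tonelli12// (fubini_tonelli (m1 := leb) (m2 := leb) H).
Qed.

Lemma area_shear2 H (psi : R -> R) : measurable_fun setT H -> (forall x, 0 <= H x) ->
  measurable_fun setT (psi : measurableTypeR R -> R) ->
  \int[area]_z H (z.1, z.2 + psi z.1)%R = \int[area]_z H z.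
Proof.
move=> mH H0 mpsi.
have mH' : measurable_fun setT (fun z : plane R => H (z.1, (z.2 + psi z.1)%R)).
  apply: (measurableT_comp mH); apply: measurable_fun_pair => //=.
  by apply: measurable_funD => //; exact: measurableT_comp.
rewrite !area_tonelli12//; apply: eq_integral => x _.
rewrite -[RHS](@integral_shift R (fun y => H (x, y)) (psi x))//.
by apply: (measurableT_comp mH); exact: measurable_fun_pair.
Qed.

Lemma area_swap H : measurable_fun setT H -> (forall x, 0 <= H x) ->
  \int[area]_z H (z.2, z.1) = \int[area]_z H z.
Proof.
move=> mH H0.
have mH' : measurable_fun setT (fun z : plane R => H (z.2, z.1)).
  by apply: (measurableT_comp mH); exact: measurable_fun_pair.
by rewrite area_tonelli21// area_tonelli12.
Qed.

Lemma area_reflect2 H : measurable_fun setT H -> (forall x, 0 <= H x) ->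
  \int[area]_z H (z.1, - z.2)%R = \int[area]_z H z.
Proof.
move=> mH H0.
have mH' : measurable_fun setT (fun z : plane R => H (z.1, (- z.2)%R)).
  apply: (measurableT_comp mH); apply: measurable_fun_pair => //=.
  exact: measurableT_comp.
rewrite !area_tonelli12//; apply: eq_integral => x _.
rewrite -[RHS](@integral_reflect R (fun y => H (x, y)))//.
by apply: (measurableT_comp mH); exact: measurable_fun_pair.
Qed.

End PlaneIntegral.

(** * Rigid motions and shears preserve area *)

Section Rotation.
Context {R : realType}.
Implicit Types S T : plane R -> plane R.

(** An identity between integrals of nonnegative functions, the form that Tonelli delivers and that
    composes directly. *)
Definition preserves_area T : Prop := measurable_fun setT T /\
  forall H : plane R -> \bar R, measurable_fun setT H -> (forall x, 0 <= H x)%E ->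
    (\int[area]_z H (T z) = \int[area]_z H z)%E.

Lemma preserves_area_comp S T : preserves_area S -> preserves_area T ->
  preserves_area (S \o T).
Proof.
move=> [mS pS] [mT pT]; split; first exact: measurableT_comp.
move=> H mH H0; rewrite -(pS H mH H0) -(pT (H \o S))//; last by move=> x; exact: H0.
exact: measurableT_comp.
Qed.

Lemma preserves_area_swap : preserves_area (fun z : plane R => (z.2, z.1)).
Proof. by split; [exact: measurable_fun_pair|exact: area_swap]. Qed.

Lemma preserves_area_shear2 (psi : R -> R) :
  measurable_fun setT (psi : measurableTypeR R -> R) ->
  preserves_area (fun z : plane R => (z.1, z.2 + psi z.1)).
Proof.
move=> mpsi; split; last by move=> H mH H0; exact: area_shear2.
by apply: measurable_fun_pair => //=; apply: measurable_funD => //; exact: measurableT_comp.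
Qed.

Lemma preserves_area_shear1 (psi : R -> R) :
  measurable_fun setT (psi : measurableTypeR R -> R) ->
  preserves_area (fun z : plane R => (z.1 + psi z.2, z.2)).
Proof.
move=> mpsi; exact: (preserves_area_comp preserves_area_swap
  (preserves_area_comp (preserves_area_shear2 mpsi) preserves_area_swap)).
Qed.

Lemma preserves_area_reflect2 : preserves_area (fun z : plane R => (z.1, - z.2)).
Proof.
split; last exact: area_reflect2.
by apply: measurable_fun_pair => //=; exact: measurableT_comp.
Qed.

(** A rotation is a product of three shears, the horizontal ones with coefficient -t for t = (1 - c)
    / s, the tangent of half the angle. For s = 0 it is the identity or a half turn, which is a
    product of reflections. *)
Lemma preserves_area_rotation (c s : R) : c ^+ 2 + s ^+ 2 = 1 ->
  preserves_area (fun z : plane R => (c * z.1 - s * z.2, s * z.1 + c * z.2)).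
Proof.
move=> cs; have ml (a : R) : measurable_fun setT ((fun x => a * x) : measurableTypeR R -> R).
  exact: measurable_funM.
have [s0|s0] := eqVneq s 0.
  have cE : c = 1 \/ c = -1.
    have : (c - 1) * (c + 1) = 0 by rewrite -[RHS](subrr 1) -{3}cs s0; ring.
    by move/eqP; rewrite mulf_eq0 subr_eq0 addr_eq0 => /orP[]/eqP; [left|right].
  case: cE => ->; rewrite s0.
    rewrite (_ : (fun z => _) = id); first by split.
    by apply/funext => -[x y] /=; congr pair; ring.
  rewrite (_ : (fun z => _) = (fun z : plane R => (z.1, - z.2)) \o
    ((fun z : plane R => (z.2, z.1)) \o ((fun z : plane R => (z.1, - z.2)) \o
     (fun z : plane R => (z.2, z.1))))).
    apply: preserves_area_comp; first exact: preserves_area_reflect2.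
    apply: preserves_area_comp; first exact: preserves_area_swap.
    by apply: preserves_area_comp; [exact: preserves_area_reflect2|exact: preserves_area_swap].
  by apply/funext => -[x y] /=; congr pair; ring.
pose t := (1 - c) / s.
have p1 := preserves_area_shear1 (ml (- t)); have p2 := preserves_area_shear2 (ml s).
have := preserves_area_comp p1 (preserves_area_comp p2 p1).
congr preserves_area; apply/funext => -[x y] /=.
have st : s * t = 1 - c by rewrite /t mulrC divfK.
have tc : t * (1 + c) = s.
  apply: (mulfI s0); rewrite mulrA st; rewrite -expr2; nra.
have c1 : 1 - s * t = c by rewrite st; ring.
have c2 : 2 - s * t = 1 + c by rewrite st; ring.
congr pair.
  transitivity ((1 - s * t) * x - (t * (2 - s * t)) * y); first by ring.
  by rewrite c1 c2 tc.
transitivity (s * x + (1 - s * t) * y); first by ring.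
by rewrite c1.
Qed.

Lemma preserves_area_rigid (p : R * R) (c s : R) : c ^+ 2 + s ^+ 2 = 1 ->
  preserves_area (fun z : plane R => (p.1 + (c * z.1 - s * z.2), p.2 + (s * z.1 + c * z.2))).
Proof.
move=> cs; have mc (a : R) : measurable_fun setT ((fun=> a) : measurableTypeR R -> R) by [].
have := preserves_area_comp (preserves_area_shear1 (mc p.1))
  (preserves_area_comp (preserves_area_shear2 (mc p.2)) (preserves_area_rotation cs)).
by congr preserves_area; apply/funext => -[x y] /=; congr pair; rewrite addrC.
Qed.

End Rotation.

(** * Functions of one variable: increments and end values *)

Section Line.
Context {R : realType}.
Notation leb := (@lebesgue_measure R).
Implicit Types F G : R -> R.

Lemma continuous_measurable1 F : continuous F ->
  measurable_fun setT (F : measurableTypeR R -> R).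
Proof. exact: continuous_measurable_fun. Qed.

Lemma continuous_itv_bounded F (a b : R) : continuous F ->
  exists M, forall x, a <= x <= b -> `|F x| <= M.
Proof.
move=> cF; have [ab|ab] := leP a b; last first.
  by exists 0 => x /andP[ax xb]; have := le_lt_trans (le_trans ax xb) ab; rewrite ltxx.
have [c _ cM] := EVT_max ab (continuous_subspaceT (fun x => @continuous_comp _ _ _ F Num.norm x (cF x) (@norm_continuous _ R _)) : {within `[a, b], continuous (Num.norm \o F)}).
by exists `|F c| => x xab; apply: cM; rewrite in_itv.
Qed.

Lemma continuous_sqint_itv F (a b : R) (c d : bool) : continuous F ->
  sqint leb [set` Interval (BSide c a) (BSide d b)] F.
Proof.
move=> cF; have [M HM] := continuous_itv_bounded a b cF.
apply: (@sqint_bounded _ _ _ _ _ _ _ M) => //.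
- have := lebesgue_measure_itv (Interval (BSide c a) (BSide d b)) => /= ->.
  by case: ifP => _; rewrite ?ltry// -EFinB ltry.
- exact: measurable_funS (continuous_measurable1 cF).
- move=> x; rewrite /= in_itv/=; case: c; case: d => /andP[ax xb]; apply: HM;
    by apply/andP; split => //; exact: ltW.
Qed.

Variables F F' : R -> R.
Hypothesis dF : forall x : R, is_derive x (1 : R) F (F' x).
Hypothesis cF' : continuous F'.

Lemma is_derive_continuous : continuous F.
Proof.
by move=> x; apply: differentiable_continuous; apply/derivable1_diffP; have := dF x.
Qed.

Lemma ftc_itv (a b : R) : a <= b -> \int[leb]_(x in `[a, b]) F' x = F b - F a.
Proof.
rewrite le_eqVlt => /predU1P[<-|ab].
  by rewrite set_itv1 Rintegral_set1 subrr.
have cF := is_derive_continuous.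
rewrite /Rintegral (continuous_FTC2 (F := F) ab)//.
- by move=> x; apply: continuous_subspaceT.
- split; first by move=> x _; have := dF x.
  + by apply: cvg_at_right_filter; exact: cF.
  + by apply: cvg_at_left_filter; exact: cF.
- by move=> x _; rewrite derive1E; have := dF x => /@derive_val.
Qed.

(** Cauchy-Schwarz for the integral of [F'] between the two points. The boolean end types serve both
    closed segments and the half-open sides of squares. *)
Lemma sq_increment_le (a b x y : R) (c d : bool) :
  x \in Interval (BSide c a) (BSide d b) -> y \in Interval (BSide c a) (BSide d b) ->
  (((F x - F y) ^+ 2)%:E <=
   (b - a)%:E * \int[leb]_(t in [set` Interval (BSide c a) (BSide d b)]) (F' t ^+ 2)%:E)%E.
Proof.
set I := Interval _ _.
wlog yx : x y / y <= x => [wlg xI yI|xI yI].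
  have [yx|/ltW xy] := leP y x; first exact: wlg.
  by rewrite -sqrrN opprB; exact: wlg.
have cF'2 := cF'.
have S1 := continuous_sqint_itv y x true false cF'.
have S2 := continuous_sqint_itv y x true false (@cst_continuous R R 1).
have mI : measurable (`[y, x]%classic : set (measurableTypeR R)) by exact: measurable_itv.
have := l2_CS mI S1 S2.
rewrite {1}/l2_ip; under eq_Rintegral do rewrite mulr1.
rewrite ftc_itv// => h.
have len : l2_ip leb `[y, x] (fun=> 1) (fun=> 1) = x - y.
  rewrite /l2_ip Rintegral_cst//= mulr1 mul1r.
  have := lebesgue_measure_itv `[y, x] => /= ->; rewrite lte_fin.
  by case: ltP => // xy; apply/eqP; rewrite eq_sym subr_eq0 eq_le xy.
rewrite len in h.
apply: (@le_trans _ _ (((x - y) * l2_ip leb `[y, x] F' F')%:E)); first by rewrite lee_fin mulrC.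
rewrite EFinM -l2_sqE//.
have sub : `[y, x]%classic `<=` [set` I].
  move=> t /=; move: xI yI; rewrite /I !in_itv/= => /andP[_ xb] /andP[ay _] /andP[yt tx].
  apply/andP; split; [case: (c) ay => ay|case: (d) xb => xb] => /=.
  - exact: le_trans yt.
  - exact: lt_le_trans yt.
  - exact: le_lt_trans xb.
  - exact: le_trans xb.
apply: lee_pmul.
- by rewrite lee_fin subr_ge0.
- by apply: integral_ge0 => t _; rewrite lee_fin sqr_ge0.
- rewrite lee_fin; move: xI yI; rewrite /I !in_itv/= => /andP[_ xb] /andP[ay _].
  have ay' : a <= y by case: (c) ay => //= /ltW.
  have xb' : x <= b by case: (d) xb => //= /ltW.
  by lra.
- apply: ge0_subset_integral => //=.
  + apply/measurable_EFinP; apply: measurable_funX.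
    exact: measurable_funS (continuous_measurable1 cF').
  + by move=> t _; rewrite lee_fin sqr_ge0.
Qed.

(** From F(0)^2 <= 2 F(t)^2 + 2 (F(t) - F(0))^2, integrated over [t] between [dl] and [2 * dl]. The
    values of [F] are taken at distance at least [dl] from the end, hence inside the domain when the
    end is on its boundary. *)
Lemma line_trace_le (dl : R) : 0 < dl ->
  ((dl * F 0 ^+ 2)%:E <= 2%:E * \int[leb]_(t in `]dl%R, (2 * dl)%R]) (F t ^+ 2)%:E +
    (4 * dl ^+ 2)%:E * \int[leb]_(t in `[0%R, (2 * dl)%R]) (F' t ^+ 2)%:E)%E.
Proof.
move=> dl0; set Q := (\int[leb]_(t in `[0%R, (2 * dl)%R]) _)%E.
have cF := is_derive_continuous.
have Qfin : Q \is a fin_num.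
  have mI : measurable (`[0%R, (2 * dl)%R]%classic : set (measurableTypeR R)) by exact: measurable_itv.
  by rewrite /Q (l2_sqE mI (continuous_sqint_itv _ _ _ _ cF')).
have pt t : t \in `]dl%R, (2 * dl)%R] -> ((F 0 ^+ 2)%:E <= 2%:E * (F t ^+ 2)%:E + (4 * dl)%:E * Q)%E.
  rewrite in_itv/= => /andP[dt td].
  have : (((F t - F 0) ^+ 2)%:E <= (2 * dl - 0)%:E * Q)%E.
    by apply: sq_increment_le; rewrite in_itv/=; apply/andP; split; lra.
  rewrite -(fineK Qfin) -!EFinM -EFinD !lee_fin subr0 => h.
  have := sqr_ge0 (2 * F t - F 0); rewrite !sqrrB exprMn in h * => ?; nra.
have len : leb `]dl%R, (2 * dl)%R] = dl%:E.
  rewrite lebesgue_measure_itv/= lte_fin ifT; last by lra.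
  by rewrite -EFinB; congr EFin; ring.
have integral_const_len (r : \bar R) : (\int[leb]_(t in `]dl%R, (2 * dl)%R]) r = r * dl%:E)%E.
  by rewrite -len integral_cst.
have mF2 : measurable_fun `]dl%R, (2 * dl)%R] (fun t => (F t ^+ 2)%:E).
  apply/measurable_EFinP; apply: measurable_funX.
  exact: measurable_funS (continuous_measurable1 cF).
have -> : ((dl * F 0 ^+ 2)%:E = \int[leb]_(t in `]dl%R, (2 * dl)%R]) (F 0 ^+ 2)%:E)%E.
  by rewrite integral_const_len mulrC EFinM.
apply: (@le_trans _ _ (\int[leb]_(t in `]dl%R, (2 * dl)%R]) (2%:E * (F t ^+ 2)%:E + (4 * dl)%:E * Q))%E).
  apply: ge0_le_integral => //.
  - by move=> t _; rewrite lee_fin sqr_ge0.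
  - by apply: emeasurable_funD => //; exact: measurable_funeM.
have Q0 : (0 <= (4 * dl)%:E * Q)%E.
  apply: mule_ge0; first by rewrite lee_fin; lra.
  by apply: integral_ge0 => t _; rewrite lee_fin sqr_ge0.
rewrite ge0_integralD//; last 2 first.
- by move=> t _; rewrite mule_ge0 ?lee_fin ?sqr_ge0.
- exact: measurable_funeM.
rewrite ge0_integralZl//; last by move=> t _; rewrite lee_fin sqr_ge0.
rewrite leeD2l// integral_const_len -(fineK Qfin) -!EFinM lee_fin; lra.
Qed.

End Line.

(** * Functions of two variables and the Poincaré inequality on squares *)

Section C1Functions.
Context {R : realType}.
Notation leb := (@lebesgue_measure R).
Implicit Types (f g : R * R -> R) (x e : R * R).

Lemma C1_continuous f : C1 f -> continuous f.
Proof. by move=> [df _ _] x; exact: differentiable_continuous. Qed.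

Definition grad2 f x : R := d1 f x ^+ 2 + d2 f x ^+ 2.

Lemma grad2_ge0 f x : 0 <= grad2 f x.
Proof. by rewrite addr_ge0 ?sqr_ge0. Qed.

Lemma continuous_pair_line x e : continuous (fun t : R => (x.1 + t * e.1, x.2 + t * e.2)).
Proof.
move=> t.
have lc (a b : R) : a + u * b @[u --> t] --> a + t * b.
  by apply: cvgD; [exact: cvg_cst|apply: cvgM; [exact: cvg_id|exact: cvg_cst]].
exact: cvg_pair (lc x.1 e.1) (lc x.2 e.2).
Qed.

Lemma is_derive_line f x e (t : R) : C1 f ->
  is_derive t (1 : R) (fun t => f (x.1 + t * e.1, x.2 + t * e.2))
   (e.1 * d1 f (x.1 + t * e.1, x.2 + t * e.2) + e.2 * d2 f (x.1 + t * e.1, x.2 + t * e.2)).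
Proof.
move=> [df _ _]; set z := (_, _).
have De : 'D_e f z = e.1 * d1 f z + e.2 * d2 f z.
  rewrite /d1 /d2 !deriveE//.
  have eE : e = e.1 *: ((1, 0) : R * R) + e.2 *: ((0, 1) : R * R).
    rewrite [LHS]surjective_pairing; congr pair;
    by rewrite /= ?scaler0 ?addr0 ?add0r /GRing.scale/= mulr1.
  by rewrite {1}eE linearD !linearZ.
have shiftE : (fun h : R => h^-1 *: (((fun t => f (x.1 + t * e.1, x.2 + t * e.2)) \o shift t) (h *: (1 : R)) -
      f z)) = (fun h : R => h^-1 *: ((f \o shift z) (h *: e) - f z)).
  apply/funext => h /=; congr (_ *: (f _ - _)); rewrite /z /shift/=.
  have -> : h *: e = (h * e.1, h * e.2) by [].
  by rewrite [h%:A]mulr1; congr pair; rewrite /=; ring.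
have dz : derivable f z e by apply: diff_derivable.
rewrite -De; split; first by rewrite /derivable shiftE.
by rewrite /derive shiftE.
Qed.

Lemma continuous_box_bounded f (M : R) : continuous f ->
  exists K, forall x, `|x.1| <= M -> `|x.2| <= M -> `|f x| <= K.
Proof.
move=> cf; have cpt : compact ([set` `[- M, M]] `*` [set` `[- M, M]] : set (R * R)).
  by apply: compact_setX; exact: segment_compact.
have : compact (f @` ([set` `[- M, M]] `*` [set` `[- M, M]])).
  by apply: continuous_compact => //; exact: continuous_subspaceT.
move=> /compact_bounded[K [_ HK]]; exists (K + 1) => x x1 x2.
apply: (HK (K + 1)); first by rewrite ltrDl.
by exists x => //; split; rewrite /= in_itv/= -ler_norml.
Qed.

Lemma continuous_sqint_area f (D : set (R * R)) (M : R) : continuous f ->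
  measurable (D : set (plane R)) -> (forall x, D x -> `|x.1| <= M /\ `|x.2| <= M) ->
  (area D < +oo)%E -> sqint area D (f : plane R -> R).
Proof.
move=> cf mD DM Dfin; have [K HK] := continuous_box_bounded M cf.
apply: (@sqint_bounded _ _ _ _ _ mD Dfin K).
  exact: measurable_funS (continuous_measurable_plane cf).
by move=> x /DM[x1 x2]; exact: HK.
Qed.

Lemma area_rect (A B : set R) (H : plane R -> \bar R) :
  measurable (A : set (measurableTypeR R)) -> measurable (B : set (measurableTypeR R)) ->
  measurable_fun setT H -> (forall x, 0 <= H x)%E ->
  (\int[area]_(z in A `*` B) H z = \int[leb]_(x in A) \int[leb]_(y in B) H (x, y))%E.
Proof.
move=> mA mB mH H0; rewrite integral_mkcond area_tonelli12; last 2 first.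
- apply/(measurable_restrictT H (measurableX mA mB)).
  exact: measurable_funS mH.
- by move=> x; rewrite patchE; case: ifP.
rewrite [RHS]integral_mkcond; apply: eq_integral => x _.
rewrite [RHS]patchE; case: ifP => xA.
  rewrite [RHS]integral_mkcond; apply: eq_integral => y _; rewrite !patchE.
  by rewrite in_setX xA.
rewrite -[RHS](integral0 leb setT); apply: eq_integral => y _; rewrite patchE in_setX xA.
by [].
Qed.

Lemma area_rect21 (A B : set R) (H : plane R -> \bar R) :
  measurable (A : set (measurableTypeR R)) -> measurable (B : set (measurableTypeR R)) ->
  measurable_fun setT H -> (forall x, 0 <= H x)%E ->
  (\int[area]_(z in A `*` B) H z = \int[leb]_(y in B) \int[leb]_(x in A) H (x, y))%E.
Proof.
move=> mA mB mH H0; rewrite integral_mkcond area_tonelli21; last 2 first.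
- apply/(measurable_restrictT H (measurableX mA mB)).
  exact: measurable_funS mH.
- by move=> x; rewrite patchE; case: ifP.
rewrite [RHS]integral_mkcond; apply: eq_integral => y _.
rewrite [RHS]patchE; case: ifP => yB.
  rewrite [RHS]integral_mkcond; apply: eq_integral => x _; rewrite !patchE.
  by rewrite in_setX yB andbT.
rewrite -[RHS](integral0 leb setT); apply: eq_integral => x _; rewrite patchE in_setX yB andbF.
by [].
Qed.

(** Half-open, so that a square is the disjoint union of its four quarters. *)
Definition sq (a b h : R) : set (R * R) := [set` `]a, (a + h)]] `*` [set` `]b, (b + h)]].

Lemma measurable_itvR (i : interval R) : measurable ([set` i] : set (measurableTypeR R)).
Proof. exact: measurable_itv. Qed.

Lemma measurable_sq a b h : measurable (sq a b h : set (plane R)).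
Proof. by apply: measurableX; exact: measurable_itvR. Qed.

Lemma leb_itv_len (a h : R) : 0 < h -> leb [set` `]a, (a + h)]] = h%:E.
Proof.
move=> h0; rewrite lebesgue_measure_itv/= lte_fin ltrDl h0 -EFinB; congr EFin; ring.
Qed.

Lemma integral_cst_itv (a h : R) (r : \bar R) : 0 < h ->
  (\int[leb]_(x in [set` `]a%R, (a + h)%R]]) r = r * h%:E)%E.
Proof. by move=> h0; rewrite -(leb_itv_len a h0) integral_cst//; exact: measurable_itvR. Qed.

Lemma area_sq (a b h : R) : 0 < h -> area (sq a b h) = (h * h)%:E.
Proof.
move=> h0; pose I : set R := [set` `]a, (a + h)]]; pose J : set R := [set` `]b, (b + h)]].
transitivity (leb I * leb J)%E.
  by apply: product_measure1E; exact: measurable_itvR.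
by rewrite !leb_itv_len.
Qed.

Lemma integral_cst_sq (a b h : R) (r : \bar R) : 0 < h ->
  (\int[area]_(x in sq a b h) r = r * (h * h)%:E)%E.
Proof.
by move=> h0; rewrite -(area_sq a b h0) integral_cst//; exact: measurable_sq.
Qed.

Lemma sq_bounded (a b h : R) x : sq a b h x ->
  `|x.1| <= `|a| + `|b| + `|h| /\ `|x.2| <= `|a| + `|b| + `|h|.
Proof.
move=> [/=]; rewrite !in_itv/= => /andP[? ?] /andP[? ?].
have := ler_norm a; have := ler_norm b; have := ler_norm h.
have := ler_norm (- a); have := ler_norm (- b); have := ler_norm (- h).
rewrite !normrN => ? ? ? ? ? ?.
have := normr_ge0 a; have := normr_ge0 b; have := normr_ge0 h => ? ? ?.
by split; rewrite ler_norml; apply/andP; split; lra.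
Qed.

Lemma continuous_sqint_sq f (a b h : R) : 0 < h -> continuous f ->
  sqint area (sq a b h) (f : plane R -> R).
Proof.
move=> h0 cf; apply: (continuous_sqint_area cf (measurable_sq _ _ _) (@sq_bounded a b h)).
by rewrite area_sq// ltry.
Qed.

Lemma continuous_sq_measurable f : continuous f ->
  measurable_fun setT (fun z : plane R => ((f z) ^+ 2)%:E).
Proof.
by move=> cf; apply/measurable_EFinP; apply: measurable_funX; exact: continuous_measurable_plane.
Qed.

Lemma C1_hline f (y : R) : C1 f -> (forall t : R, is_derive t (1 : R) (fun s => f (s, y)) (d1 f (t, y))).
Proof.
move=> Cf t; have := is_derive_line (0, y) (1, 0) t Cf => /=.
rewrite add0r mulr1 mulr0 addr0 mul1r mul0r addr0.
by congr is_derive; apply/funext => s; rewrite add0r mulr1 mulr0 addr0.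
Qed.

Lemma C1_vline f (x : R) : C1 f -> (forall t : R, is_derive t (1 : R) (fun s => f (x, s)) (d2 f (x, t))).
Proof.
move=> Cf t; have := is_derive_line (x, 0) (0, 1) t Cf => /=.
rewrite add0r mulr1 mulr0 addr0 mul1r mul0r add0r.
by congr is_derive; apply/funext => s; rewrite add0r mulr1 mulr0 addr0.
Qed.

Lemma continuous_hline f (y : R) : continuous f -> continuous (fun s => f (s, y)).
Proof.
move=> cf t; apply: (@continuous_comp _ _ _ (fun s : R => (s, y)) f); last exact: cf.
exact: cvg_pair cvg_id (cvg_cst y).
Qed.

Lemma continuous_vline f (x : R) : continuous f -> continuous (fun s => f (x, s)).
Proof.
move=> cf t; apply: (@continuous_comp _ _ _ (fun s : R => (x, s)) f); last exact: cf.
exact: cvg_pair (cvg_cst x) cvg_id.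
Qed.

(** [A y] does not depend on the first coordinate, so integrating it over the square only brings a
    factor [h]. The existential hides the integral that defines [A]. *)
Lemma hslice_energy (g : R * R -> R) (a b h : R) : 0 < h -> continuous g ->
  exists A : R -> \bar R, [/\ forall y, (0 <= A y)%E,
    measurable_fun setT (A : measurableTypeR R -> \bar R),
    forall y, A y = (\int[leb]_(s in [set` `]a, (a + h)%R]]) (g (s, y) ^+ 2)%:E)%E &
    (\int[area]_(z in sq a b h) A z.2 = h%:E * \int[area]_(z in sq a b h) (g z ^+ 2)%:E)%E].
Proof.
move=> h0 cg; pose I := [set` `]a, (a + h)]]; pose J := [set` `]b, (b + h)]].
have mI : measurable (I : set (measurableTypeR R)) by exact: measurable_itvR.
have mJ : measurable (J : set (measurableTypeR R)) by exact: measurable_itvR.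
have mH := continuous_sq_measurable cg.
have H_0 (z : plane R) : (0 <= (g z ^+ 2)%:E)%E by rewrite lee_fin sqr_ge0.
pose A (y : R) := (\int[leb]_(s in I) (g (s, y) ^+ 2)%:E)%E.
have A0 (y : R) : (0 <= A y)%E by apply: integral_ge0 => s _; exact: (H_0 (s, y)).
have mA : measurable_fun setT (A : measurableTypeR R -> \bar R).
  pose H (z : plane R) := (g z ^+ 2)%:E.
  have mres : measurable_fun setT (H \_ (I `*` setT)).
    apply/(measurable_restrictT H (measurableX mI measurableT)).
    exact: measurable_funS mH.
  have res0 (z : plane R) : (0 <= (H \_ (I `*` setT)) z)%E.
    by rewrite patchE; case: ifP => _ //; exact: H_0.
  have := measurable_fun_fubini_tonelli_G (m1 := leb) _ mres res0.
  congr measurable_fun; apply/funext => y; rewrite /fubini_G /A [RHS]integral_mkcond.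
  by apply: eq_integral => s _; rewrite !patchE in_setX in_setT andbT.
have mA2 : measurable_fun setT (fun z : plane R => A z.2).
  by apply: (measurableT_comp mA); exact: measurable_snd.
exists A; split; [exact: A0|exact: mA|by []|].
rewrite (area_rect21 mI mJ mH H_0) (area_rect21 mI mJ mA2); last by move=> z; exact: A0.
rewrite -(ge0_integralZl leb mJ (f := A)).
- by apply: eq_integral => y _; rewrite /= (integral_cst_itv a (A y) h0) muleC.
- exact: measurable_funS mA.
- by move=> y _; exact: A0.
- by rewrite lee_fin ltW.
Qed.

Lemma vslice_energy (g : R * R -> R) (a b h : R) : 0 < h -> continuous g ->
  exists B : R -> \bar R, [/\ forall x : R, (0 <= B x)%E,
    measurable_fun setT (B : measurableTypeR R -> \bar R),
    forall x : R, B x = (\int[leb]_(t in [set` `]b, (b + h)%R]]) (g (x, t) ^+ 2)%:E)%E &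
    (\int[area]_(z in sq a b h) B z.1 = h%:E * \int[area]_(z in sq a b h) (g z ^+ 2)%:E)%E].
Proof.
move=> h0 cg; pose I := [set` `]a, (a + h)]]; pose J := [set` `]b, (b + h)]].
have mI : measurable (I : set (measurableTypeR R)) by exact: measurable_itvR.
have mJ : measurable (J : set (measurableTypeR R)) by exact: measurable_itvR.
have mH := continuous_sq_measurable cg.
have H_0 (z : plane R) : (0 <= (g z ^+ 2)%:E)%E by rewrite lee_fin sqr_ge0.
pose B (x : R) := (\int[leb]_(t in J) (g (x, t) ^+ 2)%:E)%E.
have B0 (x : R) : (0 <= B x)%E by apply: integral_ge0 => t _; exact: (H_0 (x, t)).
have mB : measurable_fun setT (B : measurableTypeR R -> \bar R).
  pose H (z : plane R) := (g z ^+ 2)%:E.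
  have mres : measurable_fun setT (H \_ (setT `*` J)).
    apply/(measurable_restrictT H (measurableX measurableT mJ)).
    exact: measurable_funS mH.
  have res0 (z : plane R) : (0 <= (H \_ (setT `*` J)) z)%E.
    by rewrite patchE; case: ifP => _ //; exact: H_0.
  have := measurable_fun_fubini_tonelli_F (m2 := leb) _ mres res0.
  congr measurable_fun; apply/funext => x; rewrite /fubini_F /B [RHS]integral_mkcond.
  by apply: eq_integral => s _; rewrite !patchE in_setX in_setT.
have mB1 : measurable_fun setT (fun z : plane R => B z.1).
  by apply: (measurableT_comp mB); exact: measurable_fst.
exists B; split; [exact: B0|exact: mB|by []|].
rewrite (area_rect mI mJ mH H_0) (area_rect mI mJ mB1); last by move=> z; exact: B0.
rewrite -(ge0_integralZl leb mI (f := B)).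
- by apply: eq_integral => x _; rewrite /= (integral_cst_itv b (B x) h0) muleC.
- exact: measurable_funS mB.
- by move=> x _; exact: B0.
- by rewrite lee_fin ltW.
Qed.

(** Two points are joined through the corner [(y.1, x.2)]. The increment is then bounded by the
    energy of a horizontal slice that depends only on [x.2] and that of a vertical slice that
    depends only on [y.1]; integration over both points gives the factor 2 h^2. *)
Lemma square_poincare f (a b h : R) : C1 f -> 0 < h ->
  (\int[area]_(z in sq a b h) (f z ^+ 2)%:E <=
    ((\int[area]_(z in sq a b h) f z) ^+ 2 / h ^+ 2)%:E +
    (2 * h ^+ 2)%:E * \int[area]_(z in sq a b h) (grad2 f z)%:E)%E.
Proof.
move=> Cf h0; have [_ cd1 cd2] := Cf; have cf := C1_continuous Cf.
have mQ := measurable_sq a b h; set Q := sq a b h.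
have fS := continuous_sqint_sq a b h0 cf.
have oneS := continuous_sqint_sq a b h0 (@cst_continuous (R * R)%type R 1).
have [A [A0 mA AE intA]] := hslice_energy a b h0 cd1.
have [B [B0 mB BE intB]] := vslice_energy a b h0 cd2.
have mA2 : measurable_fun setT (fun z : plane R => A z.2).
  by apply: (measurableT_comp mA); exact: measurable_snd.
have mB1 : measurable_fun setT (fun z : plane R => B z.1).
  by apply: (measurableT_comp mB); exact: measurable_fst.
have mH1 := continuous_sq_measurable cd1; have mH2 := continuous_sq_measurable cd2.
have H1_0 (z : plane R) : (0 <= (d1 f z ^+ 2)%:E)%E by rewrite lee_fin sqr_ge0.
have H2_0 (z : plane R) : (0 <= (d2 f z ^+ 2)%:E)%E by rewrite lee_fin sqr_ge0.
set E1 := (\int[area]_(z in sq a b h) (d1 f z ^+ 2)%:E)%E in intA.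
set E2 := (\int[area]_(z in sq a b h) (d2 f z ^+ 2)%:E)%E in intB.
rewrite -/Q in intA intB.
have E1_0 : (0 <= E1)%E by apply: integral_ge0 => z _; exact: H1_0.
have E2_0 : (0 <= E2)%E by apply: integral_ge0 => z _; exact: H2_0.
have h20 : (0 <= (2 * h)%:E)%E by rewrite lee_fin; lra.
have pt x y : Q x -> Q y ->
    (((f x - f y) ^+ 2)%:E <= (2 * h)%:E * A x.2 + (2 * h)%:E * B y.1)%E.
  case: x => x1 x2; case: y => y1 y2 [/= x1I x2J] [/= y1I y2J].
  have := sq_increment_le (C1_hline x2 Cf) (continuous_hline (y:=x2) cd1) x1I y1I.
  have := sq_increment_le (C1_vline y1 Cf) (continuous_vline (x:=y1) cd2) x2J y2J.
  rewrite -(BE y1) -(AE x2) !(addrC _ h) !addrK => hB hA.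
  have -> : f (x1, x2) - f (y1, y2) = (f (x1, x2) - f (y1, x2)) + (f (y1, x2) - f (y1, y2)) by ring.
  apply: (@le_trans _ _ (2%:E * ((f (x1, x2) - f (y1, x2)) ^+ 2)%:E +
                         2%:E * ((f (y1, x2) - f (y1, y2)) ^+ 2)%:E)%E).
    rewrite -!EFinM -EFinD lee_fin.
    by move: (f (x1, x2) - _) (f (y1, x2) - _) => u v; have := sqr_ge0 (u - v); nra.
  by apply: leeD; rewrite (EFinM 2 h) -muleA lee_wpmul2l// lee_fin.
pose N := l2_ip area Q f f; pose M := \int[area]_(z in Q) f z.
have ME : M = l2_ip area Q f (fun=> 1) by apply: eq_Rintegral => z _; rewrite mulr1.
have M1 : l2_ip area Q (fun=> 1) (fun=> 1) = h ^+ 2.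
  by rewrite /l2_ip Rintegral_cst//= area_sq//= !mul1r expr2.
pose kap := N - M ^+ 2 / h ^+ 2.
(* [kap] is the integral of the squared deviation from the mean, which is least among all constants,
   in particular at most that from [f x]. *)
have lower x : (kap%:E <= \int[area]_(y in Q) ((f x - f y) ^+ 2)%:E)%E.
  have cS : sqint area Q (fun y : plane R => f x * 1 + (-1 * f y + 0)).
    by do 2 (apply: sqint_linear => //); exact: sqint0.
  have -> : (\int[area]_(y in Q) ((f x - f y) ^+ 2)%:E =
      \int[area]_(y in Q) ((f x * 1 + (-1 * f y + 0)) ^+ 2)%:E)%E.
    by apply: eq_integral => y _; rewrite mulr1 addr0 mulN1r.
  rewrite l2_sqE// lee_fin.
  pose v1 := submodule_in (oneS : submodule_set (sqint_submodule _ mQ) (fun=> 1)).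
  pose vf := submodule_in (fS : submodule_set (sqint_submodule _ mQ) f).
  have -> : l2_ip area Q (fun y => f x * 1 + (-1 * f y + 0)) (fun y => f x * 1 + (-1 * f y + 0)) =
      l2_form (f x *: v1 - vf) (f x *: v1 - vf).
    by rewrite /l2_form submodule_valB -[f x *: v1]addr0 submodule_valE /=;
       apply: eq_Rintegral => y _; rewrite /= !addr0 mulN1r.
  have qI := @l2_formI _ _ R (@area R) Q mQ.
  rewrite (si_sqB qI) (si_sqZ qI) (siZl qI) (siC qI v1 vf).
  rewrite /l2_form /= -/N -ME M1 /kap -subr_ge0.
  have -> : (f x ^+ 2 * h ^+ 2 - 2 * (f x * M) + N - (N - M ^+ 2 / h ^+ 2)) =
    (f x * h - M / h) ^+ 2 by field; rewrite gt_eqF.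
  exact: sqr_ge0.
have upper x : Q x -> (kap%:E <= (2 * h ^+ 3)%:E * A x.2 + (2 * h ^+ 2)%:E * E2)%E.
  move=> Qx; apply: le_trans (lower x) _.
  apply: (@le_trans _ _ (\int[area]_(y in Q) ((2 * h)%:E * A x.2 + (2 * h)%:E * B y.1))%E).
    apply: ge0_le_integral => //.
    - by move=> y _; rewrite lee_fin sqr_ge0.
    - apply/measurable_EFinP; apply: measurable_funX; apply: measurable_funB => //.
      exact: fS.1.
    - apply: emeasurable_funD => //; apply: measurable_funeM.
      exact: measurable_funS mB1.
    - by move=> y Qy; exact: pt.
  rewrite ge0_integralD//; last 3 first.
  - by move=> y _; rewrite mule_ge0.
  - by move=> y _; rewrite mule_ge0.
  - by apply: measurable_funeM; exact: measurable_funS mB1.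
  rewrite integral_cst_sq// ge0_integralZl//; last exact: measurable_funS mB1.
  rewrite intB muleA -EFinM muleAC -EFinM.
  by apply: leeD; rewrite lee_wpmul2r// lee_fin; nra.
have total : ((kap * (h * h))%:E <= (2 * h ^+ 3)%:E * (h%:E * E1) + (2 * h ^+ 2)%:E * E2 * (h * h)%:E)%E.
  have k0 : 0 <= kap.
    rewrite /kap subr_ge0 ler_pdivrMr ?exprn_gt0// ME -M1.
    exact: l2_CS.
  rewrite EFinM -(integral_cst_sq a b _ h0) -intA.
  have c3 : (0 <= (2 * h ^+ 3)%:E)%E by rewrite lee_fin mulr_ge0// exprn_ge0// ltW.
  have c2 : (0 <= (2 * h ^+ 2)%:E)%E by rewrite lee_fin mulr_ge0// exprn_ge0// ltW.
  rewrite -ge0_integralZl//; last exact: measurable_funS mA2.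
  rewrite -(integral_cst_sq a b _ h0) -ge0_integralD//; last 3 first.
  - by move=> y _; rewrite mule_ge0.
  - by apply: measurable_funeM; exact: measurable_funS mA2.
  - by move=> y _; rewrite mule_ge0.
  apply: ge0_le_integral => //.
  by apply: emeasurable_funD => //; apply: measurable_funeM; exact: measurable_funS mA2.
have gradE : (\int[area]_(z in Q) (grad2 f z)%:E = E1 + E2)%E.
  transitivity (\int[area]_(z in Q) ((d1 f z ^+ 2)%:E + (d2 f z ^+ 2)%:E))%E.
    by apply: eq_integral => z _; rewrite -EFinD.
  apply: (ge0_integralD area mQ).
  - by move=> z _; exact: H1_0.
  - exact: (measurable_funS _ _ mH1).
  - by move=> z _; exact: H2_0.
  - exact: (measurable_funS _ _ mH2).
rewrite gradE l2_sqE// -/N -/M.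
have E1f : E1 \is a fin_num.
  by rewrite /E1 (l2_sqE mQ (continuous_sqint_sq a b h0 cd1)).
have E2f : E2 \is a fin_num.
  by rewrite /E2 (l2_sqE mQ (continuous_sqint_sq a b h0 cd2)).
clearbody E1 E2.
have [r1 r1E] : exists r1, E1 = r1%:E by exists (fine E1); exact/esym/fineK.
have [r2 r2E] : exists r2, E2 = r2%:E by exists (fine E2); exact/esym/fineK.
rewrite r1E r2E -(EFinD r1 r2) -(EFinM _ (r1 + r2)) -EFinD lee_fin.
move: total; rewrite r1E r2E -(EFinM h r1) -(EFinM _ (h * r1)) -(EFinM _ r2) -(EFinM _ (h * h)).
rewrite -EFinD lee_fin => total.
rewrite -lerBlDl -/kap.
have hh : 0 < h * h by rewrite mulr_gt0.
rewrite -(ler_pM2r hh); apply: le_trans total _; rewrite le_eqVlt; apply/orP; left; apply/eqP; ring.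
Qed.

End C1Functions.

(** * Boundary charts *)

Section LipschitzCurve.
Context {R : realType}.
Notation leb := (@lebesgue_measure R).
Variables (gamma : R -> R * R) (C : R).
Hypothesis C_gt0 : 0 < C.
Hypothesis gamma_lip : forall s t, eucl_dist (gamma s) (gamma t) <= C * `|s - t|.

Lemma diam_lipschitz_itv (a b : R) : a <= b ->
  (diam (gamma @` [set` `[a, b]]) <= (C * (b - a))%:E)%E.
Proof.
move=> ab; have Cab : 0 <= C * (b - a) by rewrite mulr_ge0 ?subr_ge0// ltW.
apply: ge_ereal_sup => _ [->|[[x y] [/= [s sI <-] [t tI <-]] <-]]; first by rewrite lee_fin.
rewrite lee_fin; apply: le_trans (gamma_lip s t) _; rewrite ler_pM2l//.
move: sI tI; rewrite /= !in_itv/= => /andP[? ?] /andP[? ?].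
by rewrite ler_norml; apply/andP; split; lra.
Qed.

(** The interval is cut into equal pieces, fine enough for the diameters of their images to be at
    most [d]; the bounds on these diameters add up to [C * (b - a)] for any number of pieces. *)
Lemma arclength_lipschitz_itv (a b : R) : a <= b ->
  (arclength (gamma @` [set` `]a, b]]) <= (C * (b - a))%:E)%E.
Proof.
move=> ab; have ba0 : 0 <= b - a by rewrite subr_ge0.
apply: ge_ereal_sup => _ [d d0 <-].
have [n Hn] : exists n : nat, C * (b - a) / d < n.+1%:R.
  have [n _ Hn] := nbhs_infty_gtr (C * (b - a) / d).
  by exists n; apply: Hn => /=.
pose l := (b - a) / n.+1%:R.
have l0 : 0 <= l by rewrite divr_ge0.
have ln : n.+1%:R * l = b - a by rewrite /l mulrC divfK ?pnatr_eq0.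
have Cl : C * l <= d.
  rewrite /l mulrA ler_pdivrMr// [leRHS]mulrC -ler_pdivrMr//; exact: ltW.
pose F (i : nat) : set (R * R) := if (i < n.+1)%N then
  gamma @` [set` `[a + i%:R * l, a + i.+1%:R * l]] else set0.
have dF i : (diam (F i) <= (if (i < n.+1)%N then C * l else 0)%:E)%E.
  rewrite /F; case: ifP => _; last by rewrite diam0.
  have -> : C * l = C * ((a + i.+1%:R * l) - (a + i%:R * l)).
    by rewrite -natr1; ring.
  by apply: diam_lipschitz_itv; rewrite lerD2l ler_wpM2r// ler_nat.
have Cl0 : 0 <= C * l by rewrite mulr_ge0// ltW.
apply: (@le_trans _ _ (\sum_(i <oo) diam (F i))%E).
  apply: ereal_inf_lbound; exists F => //; split=> [_ [s sI <-]|i].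
    move: sI; rewrite /= in_itv/= => /andP[sa sb].
    have exj : exists j : nat, s <= a + j%:R * l.
      by exists n.+1; rewrite ln; lra.
    case: (ex_minnP exj) => -[|j] sj jmin; first by rewrite mul0r addr0 leNgt sa in sj.
    have jn : (j < n.+1)%N by apply: jmin; rewrite ln; lra.
    exists j => //; rewrite /F jn; exists s => //=; rewrite in_itv/= sj andbT.
    by rewrite leNgt; apply/negP => /ltW/jmin; rewrite ltnn.
  by apply: le_trans (dF i) _; rewrite lee_fin; case: ifP => // _; exact: ltW.
rewrite (nneseries_split _ n.+1); last by move=> k _; exact: diam_ge0.
rewrite add0n [X in (_ + X)%E]eseries0 ?adde0; last first.
  by move=> i ni _; rewrite /F ltnNge ni/= diam0.
apply: (@le_trans _ _ (\sum_(0 <= i < n.+1) (C * l)%:E)%E).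
  rewrite !big_nat; apply: lee_sum => i /andP[_ ni]; apply: le_trans (dF i) _.
  by rewrite ni.
rewrite sumEFin lee_fin big_const_nat subn0 iter_addr addr0 -mulr_natl mulrCA ln.
by [].
Qed.

(** Lebesgue measure is the outer measure of interval lengths: the bound for intervals is summed
    over a cover of [B], by countable subadditivity of arc length. *)
Lemma arclength_lipschitz (B : set R) : measurable (B : set (measurableTypeR R)) ->
  (arclength (gamma @` B) <= C%:E * leb B)%E.
Proof.
move=> mB; rewrite -lee_pdivrMl//.
have -> : leb B = ((@wlength R idfun)^*)%mu B by [].
apply: le_ereal_inf_tmp => _ [A [mA BA] <-]; rewrite lee_pdivrMl//.
apply: (@le_trans _ _ (arclength (\bigcup_i (gamma @` A i)))).
  apply: le_arclength => _ [s Bs <-]; have [i _ Ais] := BA s Bs.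
  by exists i => //; exists s.
apply: le_trans (arclength_sigma_subadditive _) _.
rewrite -nneseriesZl; last by move=> i _; exact: wlength_ge0.
apply: lee_nneseries => i _; first by move=> _; exact: arclength_ge0.
have [[a b] _ <-] := mA i => /=.
have [ab|ba] := leP b a.
  rewrite set_itv_ge ?bnd_simp -?leNgt//.
  by rewrite image_set0 arclength0 mule_ge0// ?lee_fin ?ltW// wlength_ge0.
rewrite wlength_itv/= lte_fin ba -EFinD -EFinM.
by apply: arclength_lipschitz_itv; exact: ltW.
Qed.

End LipschitzCurve.

Section CurveIntegral.
Context {R : realType}.
Notation leb := (@lebesgue_measure R).

(** On [G], arc length is dominated by [C] times the image of Lebesgue measure under [gamma].
    Restricting it to [G] makes the domination hold for all measurable sets, and integrals
    follow. *)
Lemma arclength_integral_le (gamma : R -> R * R) (C : R) (G : set (R * R))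
    (h : plane R -> \bar R) :
  0 < C -> (forall s t, eucl_dist (gamma s) (gamma t) <= C * `|s - t|) ->
  measurable_fun setT (gamma : measurableTypeR R -> plane R) ->
  measurable (G : set (plane R)) -> G `<=` range gamma ->
  measurable_fun setT h -> (forall x, 0 <= h x)%E ->
  (\int[arclength]_(x in G) h x <= C%:E * \int[leb]_(s in gamma @^-1` G) h (gamma s))%E.
Proof.
move=> C0 glip mg mG Gg mh h0.
pose m1 : {measure set (plane R) -> \bar R} := mrestr (@arclength R) mG.
have -> : (\int[arclength]_(x in G) h x = \int[m1]_(x in G) h x)%E.
  apply: eq_measure_integral => A mA AG; rewrite /m1/= /mrestr; congr (arclength _).
  by apply/esym/setIidPl.
pose k : {nonneg R} := NngNum (ltW C0).
pose mp : {measure set (plane R) -> \bar R} := pushforward leb (gamma : measurableTypeR R -> plane R).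
pose m2 : {measure set (plane R) -> \bar R} := mscale k (mp mg).
apply: (@le_trans _ _ (\int[m2]_(x in G) h x)%E).
  apply: ge0_le_measure_integral => // S mS.
  rewrite /m1 /m2 /mp /= /mrestr /mscale /= /pushforward.
  apply: le_trans (arclength_lipschitz C0 glip _); last first.
    by rewrite -[_ @^-1` _]setTI; exact (mg measurableT _ mS).
  by apply: le_arclength => x [Sx /Gg[s _ sx]]; exists s => //=; rewrite sx.
rewrite ge0_integral_mscale//; last exact: measurable_funS mh.
rewrite ge0_integral_pushforward//; exact: measurable_funS mh.
Qed.

End CurveIntegral.

Section Slices.
Context {R : realType}.
Notation leb := (@lebesgue_measure R).

Lemma integrate_slices (I : set R) (g : R -> R) (H1 H2 : plane R -> \bar R) (k0 k1 k2 : R) :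
  measurable (I : set (measurableTypeR R)) -> continuous g -> (forall u, 0 <= g u) ->
  measurable_fun setT H1 -> (forall z, 0 <= H1 z)%E ->
  measurable_fun setT H2 -> (forall z, 0 <= H2 z)%E ->
  0 <= k0 -> 0 <= k1 -> 0 <= k2 ->
  (forall u, I u -> ((k0 * g u)%:E <=
     k1%:E * \int[leb]_v H1 (u, v) + k2%:E * \int[leb]_v H2 (u, v))%E) ->
  (k0%:E * \int[leb]_(u in I) (g u)%:E <=
     k1%:E * \int[area]_z H1 z + k2%:E * \int[area]_z H2 z)%E.
Proof.
move=> mI cg g0 mH1 H10 mH2 H20 k00 k10 k20 le_slice.
have mg : measurable_fun setT (fun u : measurableTypeR R => (g u)%:E).
  by apply/measurable_EFinP; exact: continuous_measurable1.
pose S1 (u : measurableTypeR R) := (\int[leb]_v H1 (u, v))%E.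
pose S2 (u : measurableTypeR R) := (\int[leb]_v H2 (u, v))%E.
have mS1 : measurable_fun setT S1 by exact: (measurable_fun_fubini_tonelli_F (m2 := leb) _ mH1 H10).
have mS2 : measurable_fun setT S2 by exact: (measurable_fun_fubini_tonelli_F (m2 := leb) _ mH2 H20).
have S10 u : (0 <= S1 u)%E by apply: integral_ge0 => v _; exact: H10.
have S20 u : (0 <= S2 u)%E by apply: integral_ge0 => v _; exact: H20.
rewrite (area_tonelli12 mH1 H10) (area_tonelli12 mH2 H20) -/(S1 _) -/(S2 _).
have mks1 : measurable_fun setT (fun u => k1%:E * S1 u)%E by exact: measurable_funeM.
have mks2 : measurable_fun setT (fun u => k2%:E * S2 u)%E by exact: measurable_funeM.
have k1S u : (0 <= k1%:E * S1 u)%E by apply: mule_ge0; rewrite ?lee_fin.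
have k2S u : (0 <= k2%:E * S2 u)%E by apply: mule_ge0; rewrite ?lee_fin.
have msum : measurable_fun setT (fun u => k1%:E * S1 u + k2%:E * S2 u)%E by exact: emeasurable_funD.
rewrite -(ge0_integralZl leb mI (f := fun u => (g u)%:E)); last 3 first.
- exact: measurable_funS mg.
- by move=> u _; rewrite lee_fin.
- by rewrite lee_fin.
apply: (@le_trans _ _ (\int[leb]_(u in I) (k1%:E * S1 u + k2%:E * S2 u))%E).
  apply: (ge0_le_integral leb mI).
  - by move=> u _; rewrite -EFinM lee_fin mulr_ge0.
  - by apply: measurable_funeM; exact: measurable_funS mg.
  - exact: measurable_funS msum.
  - by move=> u Iu; rewrite -EFinM; exact: le_slice.
apply: (@le_trans _ _ (\int[leb]_u (k1%:E * S1 u + k2%:E * S2 u))%E).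
  apply: (ge0_subset_integral leb mI measurableT msum) => //.
  by move=> u _; apply: adde_ge0.
rewrite (ge0_integralD leb measurableT (f1 := fun u => k1%:E * S1 u)%E); last 4 first.
- by move=> u _; exact: k1S.
- exact: mks1.
- by move=> u _; exact: k2S.
- exact: mks2.
rewrite (ge0_integralZl leb measurableT (f := S1)); last 3 first.
- exact: mS1.
- by move=> u _; exact: S10.
- by rewrite lee_fin.
rewrite (ge0_integralZl leb measurableT (f := S2)); last 3 first.
- exact: mS2.
- by move=> u _; exact: S20.
- by rewrite lee_fin.
exact: lexx.
Qed.

Lemma integral_shift_sub (h : R -> \bar R) (J : set R) (a : R) :
  measurable (J : set (measurableTypeR R)) ->
  measurable_fun setT (h : measurableTypeR R -> \bar R) -> (forall v, 0 <= h v)%E ->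
  (\int[leb]_(t in J) h (a + t)%R <= \int[leb]_v h v)%E.
Proof.
move=> mJ mh h0; rewrite -(integral_shift a mh h0).
under eq_integral do rewrite addrC.
apply: (ge0_subset_integral leb mJ measurableT).
- by apply: (measurableT_comp mh); apply: measurable_funD.
- by move=> t _; exact: h0.
- by [].
Qed.

(** The segment excludes 0 because its starting point may lie on the boundary, where the gradient is
    not counted in the energy of the open domain. *)
Lemma line_trace_le_oc (F F' : R -> R) (dl : R) :
  (forall x : R, is_derive x (1 : R) F (F' x)) -> continuous F' -> 0 < dl ->
  ((dl * F 0 ^+ 2)%:E <= 2%:E * \int[leb]_(t in `]dl%R, (2 * dl)%R]) (F t ^+ 2)%:E +
    (4 * dl ^+ 2)%:E * \int[leb]_(t in `]0%R, (2 * dl)%R]) (F' t ^+ 2)%:E)%E.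
Proof.
move=> dF cF' dl0; have := line_trace_le dF cF' dl0.
have -> // : (\int[leb]_(t in `[0%R, (2 * dl)%R]) (F' t ^+ 2)%:E =
  \int[leb]_(t in `]0%R, (2 * dl)%R]) (F' t ^+ 2)%:E)%E.
apply/esym/integral_itv_obnd_cbnd; apply/measurable_EFinP; apply: measurable_funX.
exact: measurable_funS (continuous_measurable1 cF').
Qed.

End Slices.

(** * Estimates in one Lipschitz chart *)

Section Chart.
Context {R : realType}.
Notation leb := (@lebesgue_measure R).
Variables (Omega : set (R * R)) (p : R * R) (r c s L : R) (phi : R -> R).
Hypotheses (Omega_open : open Omega) (p_bd : boundary Omega p) (r_gt0 : 0 < r)
  (cs1 : c ^+ 2 + s ^+ 2 = 1) (L_ge0 : 0 <= L)
  (phi_lip : forall x y, `|phi x - phi y| <= L * `|x - y|)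
  (chart : forall x, eucl_dist x p < r ->
     (Omega x <-> phi (c * (x.1 - p.1) + s * (x.2 - p.2)) <
                  - s * (x.1 - p.1) + c * (x.2 - p.2))).

(** [xi] and [eta] are the rotated coordinates centred at [p], and [X] recovers the point. [Psi]
    replaces [eta] by the height above the graph. Its inverse [Phi], a shear followed by a rigid
    motion, preserves area and maps positive heights near 0 into [Omega]. *)
Let xi (x : R * R) : R := c * (x.1 - p.1) + s * (x.2 - p.2).
Let eta (x : R * R) : R := - s * (x.1 - p.1) + c * (x.2 - p.2).
Let X (z : R * R) : R * R := (p.1 + (c * z.1 - s * z.2), p.2 + (s * z.1 + c * z.2)).
Let Phi (z : R * R) : R * R := X (z.1, z.2 + phi z.1).
Let Psi (x : R * R) : R * R := (xi x, eta x - phi (xi x)).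

Let XK x : X (xi x, eta x) = x.
Proof.
case: x => a b; rewrite /X /xi /eta /=; congr pair.
  transitivity (p.1 + (c ^+ 2 + s ^+ 2) * (a - p.1)); first by ring.
  by rewrite cs1; ring.
transitivity (p.2 + (c ^+ 2 + s ^+ 2) * (b - p.2)); first by ring.
by rewrite cs1; ring.
Qed.

Let xiX z : xi (X z) = z.1.
Proof.
rewrite /xi /X /=; transitivity ((c ^+ 2 + s ^+ 2) * z.1); first by ring.
by rewrite cs1 mul1r.
Qed.

Let etaX z : eta (X z) = z.2.
Proof.
rewrite /eta /X /=; transitivity ((c ^+ 2 + s ^+ 2) * z.2); first by ring.
by rewrite cs1 mul1r.
Qed.

Let PhiK z : Psi (Phi z) = z.
Proof. by rewrite /Psi /Phi xiX etaX /= addrK -surjective_pairing. Qed.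

Let PsiK x : Phi (Psi x) = x.
Proof. by rewrite /Phi /Psi /= subrK XK. Qed.

Let phi_cont : continuous phi.
Proof.
move=> x; apply/cvgrPdist_le => e e0.
have L1 : 0 < L + 1 by rewrite ltr_wpDl.
near=> y; apply: le_trans (phi_lip _ _) _.
apply: (@le_trans _ _ ((L + 1) * `|x - y|)); first by rewrite ler_wpM2r// lerDl.
rewrite -ler_pdivlMl// mulrC; near: y.
by apply: cvgr_dist_le; [exact: cvg_id|rewrite divr_gt0].
Unshelve. all: by end_near. Qed.

Let xi_cont : continuous xi.
Proof.
move=> x; apply: cvgD; apply: cvgM; (try exact: cvg_cst); apply: cvgB; (try exact: cvg_cst).
- exact: cvg_fst.
- exact: cvg_snd.
Qed.

Let eta_cont : continuous eta.
Proof.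
move=> x; apply: cvgD; apply: cvgM; (try exact: cvg_cst); apply: cvgB; (try exact: cvg_cst).
- exact: cvg_fst.
- exact: cvg_snd.
Qed.

Let Psi_cont : continuous Psi.
Proof.
move=> x; have h2 : eta y - phi (xi y) @[y --> x] --> eta x - phi (xi x).
  apply: cvgB; first exact: eta_cont.
  by apply: (@continuous_comp _ _ _ xi phi); [exact: xi_cont|exact: phi_cont].
have h1 : xi y @[y --> x] --> xi x by exact: xi_cont.
exact: (cvg_pair h1 h2).
Qed.

Let Phi_cont : continuous Phi.
Proof.
move=> z.
have h1 : z'.1 @[z' --> z] --> z.1 by exact: cvg_fst.
have h2 : z'.2 + phi z'.1 @[z' --> z] --> z.2 + phi z.1.
  apply: cvgD; first exact: cvg_snd.
  by apply: (@continuous_comp _ _ _ fst phi); [exact: cvg_fst|exact: phi_cont].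
have h3 : p.1 + (c * z'.1 - s * (z'.2 + phi z'.1)) @[z' --> z] -->
    p.1 + (c * z.1 - s * (z.2 + phi z.1)).
  by apply: cvgD; [exact: cvg_cst|apply: cvgB; apply: cvgM => //; exact: cvg_cst].
have h4 : p.2 + (s * z'.1 + c * (z'.2 + phi z'.1)) @[z' --> z] -->
    p.2 + (s * z.1 + c * (z.2 + phi z.1)).
  by apply: cvgD; [exact: cvg_cst|apply: cvgD; apply: cvgM => //; exact: cvg_cst].
exact: (cvg_pair h3 h4).
Qed.

Let mphi : measurable_fun setT (phi : measurableTypeR R -> R).
Proof. exact: continuous_measurable1. Qed.

Let Phi_area : preserves_area (Phi : plane R -> plane R).
Proof. exact: (preserves_area_comp (preserves_area_rigid p cs1) (preserves_area_shear2 mphi)). Qed.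

Let eucl_distX z w : eucl_dist (X z) (X w) = Num.sqrt ((z.1 - w.1) ^+ 2 + (z.2 - w.2) ^+ 2).
Proof.
rewrite /eucl_dist /X /=; congr Num.sqrt.
transitivity ((c ^+ 2 + s ^+ 2) * ((z.1 - w.1) ^+ 2 + (z.2 - w.2) ^+ 2)); first by ring.
by rewrite cs1 mul1r.
Qed.

Lemma sqrt_sqD_le (a b : R) : Num.sqrt (a ^+ 2 + b ^+ 2) <= `|a| + `|b|.
Proof.
rewrite -[leRHS]ger0_norm ?addr_ge0// -sqrtr_sqr ler_wsqrtr// sqrrD !real_normK ?num_real//.
by rewrite -addrA lerD2l lerDr mulrn_wge0// mulr_ge0.
Qed.

Let intO : interior Omega = Omega.
Proof.
have := Omega_open; rewrite openE => sub; apply/seteqP; split => //.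
exact: interior_subset.
Qed.

(** The point [p] is on the graph: above it, [p] would belong to the open set [Omega]; below it, a
    neighbourhood of [p] would miss [Omega]. *)
Let phi0 : phi 0 = 0.
Proof.
have xip : xi p = 0 by rewrite /xi !subrr !mulr0 addr0.
have etap : eta p = 0 by rewrite /eta !subrr !mulr0 addr0.
have pp : eucl_dist p p < r by rewrite /eucl_dist !subrr expr0n/= addr0 sqrtr0.
case: p_bd => clp; rewrite intO.
have := (chart pp); rewrite -/(xi p) -/(eta p) xip etap => -[_ Op] nOp.
have phi_ge0 : 0 <= phi 0 by rewrite leNgt; apply/negP => /Op.
apply/eqP; rewrite eq_le phi_ge0 andbT leNgt; apply/negP => phi_gt0.
pose N : set (R * R) := [set x | eta x - phi (xi x) < 0] `&` [set x | eucl_dist x p < r].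
have Np : nbhs p N.
  apply: filterI.
    have : (Psi x).2 @[x --> p] --> (Psi p).2.
      by apply: (@continuous_comp _ _ _ Psi snd); [exact: Psi_cont|exact: cvg_snd].
    by move=> h; apply: (cvgr_lt _ h); rewrite /Psi/= xip etap sub0r oppr_lt0.
  apply/nbhs_box; exists (r / 2); first by rewrite divr_gt0.
  move=> y y1 y2 /=; apply: le_lt_trans (sqrt_sqD_le _ _) _; lra.
have [x [Ox [/= x1 x2]]] := clp _ Np.
by have := (chart x2).1 Ox; rewrite -/(xi x) -/(eta x) -subr_gt0 ltNge ltW.
Qed.

(** For coordinates at most [kap], the point [Phi z] is within (2 + L) kap < r of [p], hence where
    the chart describes [Omega]. *)
Let kap := r / (2 * (3 + L)).

Let kap_gt0 : 0 < kap.
Proof. by rewrite divr_gt0// mulr_gt0// ltr_wpDr. Qed.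

Let Phi_close z : `|z.1| <= kap -> `|z.2| <= kap -> eucl_dist (Phi z) p < r.
Proof.
move=> z1 z2; have -> : p = X (0, 0) by rewrite /X/= !mulr0 subrr addr0 !addr0 -surjective_pairing.
rewrite eucl_distX /= !subr0; apply: le_lt_trans (sqrt_sqD_le _ _) _.
have : `|phi z.1| <= L * kap.
  have := phi_lip z.1 0; rewrite phi0 !subr0 => /le_trans; apply.
  by rewrite ler_wpM2l.
have := ler_normD z.2 (phi z.1).
have : kap * (2 * (3 + L)) = r by rewrite divfK// gt_eqF// mulr_gt0// ltr_wpDr.
rewrite (_ : kap * _ = 6 * kap + 2 * (L * kap)); last by ring.
have k0 := kap_gt0; have := mulr_ge0 L_ge0 (ltW k0).
move: (L * kap) => Lk ? E ? ?; rewrite -E; lra.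
Qed.

Let Omega_Phi z : `|z.1| <= kap -> `|z.2| <= kap -> Omega (Phi z) <-> 0 < z.2.
Proof.
move=> z1 z2; have := chart (Phi_close z1 z2); rewrite -/(xi _) -/(eta _).
by rewrite /Phi xiX etaX /= ltrDr.
Qed.

(** The height is halved so that vertical segments of length [2 * dl <= kap / 2] starting in the
    window stay below height [kap]. *)
Definition chart_window : set (R * R) :=
  [set x | `|(Psi x).1| < kap /\ `|(Psi x).2| < kap / 2].

Lemma chart_window_open : open chart_window.
Proof.
have -> : chart_window = Psi @^-1` ([set u : R | `|u| < kap] `*` [set u : R | `|u| < kap / 2]) by [].
apply: open_comp; first by move=> x _; exact: Psi_cont.
have on (e : R) : open [set u : R | `|u| < e].
  have := @open_comp _ _ (@Num.norm _ R) [set y | y < e].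
  by apply; [move=> x _; exact: norm_continuous|exact: open_lt].
move=> z [z1 z2]; exists ([set u : R | `|u| < kap], [set u : R | `|u| < kap / 2]) => //=.
by split; apply: open_nbhs_nbhs; split.
Qed.

Lemma chart_window_center : chart_window p.
Proof.
rewrite /chart_window /Psi /= (_ : xi p = 0); last by rewrite /xi !subrr !mulr0 addr0.
rewrite phi0 subr0 (_ : eta p = 0); last by rewrite /eta !subrr !mulr0 addr0.
by rewrite normr0; split=> //; rewrite divr_gt0.
Qed.

Lemma boundary_chart x : boundary Omega x -> chart_window x -> Psi x = ((Psi x).1, 0).
Proof.
move=> [clx nx] [x1 x2]; rewrite [LHS]surjective_pairing; congr pair.
have x2' : `|(Psi x).2| <= kap by apply: le_trans (ltW x2) _; have := kap_gt0; lra.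
have := Omega_Phi (ltW x1) x2'; rewrite PsiK => OE.
rewrite intO in nx.
apply/eqP; rewrite eq_le; apply/andP; split; rewrite leNgt; apply/negP => h.
  by apply: nx; apply/OE.
have Wx : nbhs x (chart_window `&` [set y | (Psi y).2 < 0]).
  apply: filterI; first by apply: open_nbhs_nbhs; split; [exact: chart_window_open|].
  have : (Psi y).2 @[y --> x] --> (Psi x).2.
    by apply: (@continuous_comp _ _ _ Psi snd); [exact: Psi_cont|exact: cvg_snd].
  by move=> h'; exact: (cvgr_lt _ h').
have [y [Oy [[y1 y2] /= y0]]] := clx _ Wx.
have y2' : `|(Psi y).2| <= kap by apply: le_trans (ltW y2) _; have := kap_gt0; lra.
have := (Omega_Phi (ltW y1) y2').1; rewrite PsiK => /(_ Oy); by rewrite ltNge ltW.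
Qed.

Definition chart_inner (dl : R) : set (R * R) := Phi @` ([set` `[- kap, kap]] `*` [set` `[dl, kap]]).

Lemma chart_inner_compact dl : compact (chart_inner dl).
Proof.
apply: continuous_compact; first by apply: continuous_subspaceT; exact: Phi_cont.
by apply: compact_setX; exact: segment_compact.
Qed.

Lemma chart_inner_sub dl : 0 < dl -> chart_inner dl `<=` Omega.
Proof.
move=> dl0 _ [z [/= z1 z2] <-]; move: z1 z2; rewrite !in_itv/= -ler_norml => z1 /andP[dz z2].
have z0 : 0 < z.2 by exact: lt_le_trans dz.
by apply/Omega_Phi => //; rewrite gtr0_norm.
Qed.

Let Ik : set R := [set` `]- kap, kap[].

(** On the segment going up from height [tau0], the averaged values lie in [chart_inner dl] and the
    derivatives in [Omega]. Integration over [u] gives area integrals because [Phi] preserves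
    area. *)
Lemma chart_line_estimate (f : R * R -> R) (tau0 dl : R) : C1 f -> 0 <= tau0 -> tau0 <= kap / 2 ->
  0 < dl -> dl <= kap / 4 ->
  (dl%:E * \int[leb]_(u in Ik) (f (Phi (u, tau0)) ^+ 2)%:E <=
   2%:E * \int[area]_(x in chart_inner dl) (f x ^+ 2)%:E +
   (4 * dl ^+ 2)%:E * \int[area]_(x in Omega) (grad2 f x)%:E)%E.
Proof.
move=> Cf t00 t0k dl0 dlk; have [_ cd1 cd2] := Cf; have cf := C1_continuous Cf.
have mK : measurable (chart_inner dl : set (plane R)).
  apply: closed_measurable_plane; apply: compact_closed; last exact: chart_inner_compact.
  exact: norm_hausdorff.
have mO : measurable (Omega : set (plane R)) by exact: open_measurable_plane.
pose h1 : plane R -> \bar R := (fun x => (f x ^+ 2)%:E) \_ (chart_inner dl).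
pose h2 : plane R -> \bar R := (fun x => (grad2 f x)%:E) \_ Omega.
have mh1 : measurable_fun setT h1.
  apply/(measurable_restrictT _ mK); exact: measurable_funS (continuous_sq_measurable cf).
have mh2 : measurable_fun setT h2.
  apply/(measurable_restrictT _ mO); apply/measurable_EFinP.
  have mg : measurable_fun setT (grad2 f : plane R -> R).
    by apply: measurable_funD; apply: measurable_funX; exact: continuous_measurable_plane.
  exact: measurable_funS mg.
have h10 x : (0 <= h1 x)%E by rewrite /h1 patchE; case: ifP => // _; rewrite lee_fin sqr_ge0.
have h20 x : (0 <= h2 x)%E by rewrite /h2 patchE; case: ifP => // _; rewrite lee_fin grad2_ge0.
have [mPhi pPhi] := Phi_area.
have mH1 : measurable_fun setT (h1 \o (Phi : plane R -> plane R)) by exact: (measurableT_comp mh1 mPhi).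
have mH2 : measurable_fun setT (h2 \o (Phi : plane R -> plane R)) by exact: (measurableT_comp mh2 mPhi).
have H10 z : (0 <= (h1 \o Phi) z)%E by exact: h10.
have H20 z : (0 <= (h2 \o Phi) z)%E by exact: h20.
rewrite [X in (_ <= _ * X + _)%E]integral_mkcond [X in (_ <= _ + _ * X)%E]integral_mkcond -/h1 -/h2.
rewrite -(pPhi h1 mh1 h10) -(pPhi h2 mh2 h20).
pose g (u : R) := f (Phi (u, tau0)) ^+ 2.
have cg : continuous g.
  move=> u; apply: (@continuous_comp _ _ _ (fun u => f (Phi (u, tau0))) (fun y : R => y ^+ 2)); last exact: exprn_continuous.
  apply: (@continuous_comp _ _ _ (fun u : R => (u, tau0)) (f \o Phi)).
    exact: cvg_pair cvg_id (cvg_cst tau0).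
  by apply: continuous_comp; [exact: Phi_cont|exact: cf].
apply: (@integrate_slices _ _ g (h1 \o Phi) (h2 \o Phi)) => //.
- exact: measurable_itvR.
- by move=> u; exact: sqr_ge0.
- exact: ltW.
- by rewrite mulr_ge0// sqr_ge0.
move=> u; rewrite /Ik /= in_itv/= => /andP[uk ku].
have uk' : `|u| <= kap by rewrite ler_norml !ltW.
(* Raising the height moves the point along the unit vector (-s, c), so the curve is a straight
   segment although the graph is only Lipschitz. *)
have Phi_line (t : R) : ((Phi (u, tau0)).1 + t * - s, (Phi (u, tau0)).2 + t * c) = Phi (u, tau0 + t).
  by rewrite /Phi /X /=; congr pair; ring.
pose F (t : R) := f ((Phi (u, tau0)).1 + t * - s, (Phi (u, tau0)).2 + t * c).
pose F' (t : R) := - s * d1 f ((Phi (u, tau0)).1 + t * - s, (Phi (u, tau0)).2 + t * c) +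
   c * d2 f ((Phi (u, tau0)).1 + t * - s, (Phi (u, tau0)).2 + t * c).
have dF (t : R) : is_derive t (1 : R) F (F' t) by exact: (is_derive_line (Phi (u, tau0)) (- s, c) t Cf).
have cF' : continuous F'.
  have cl := @continuous_pair_line R (Phi (u, tau0)) (- s, c).
  move=> t; apply: cvgD; apply: cvgM; (try exact: cvg_cst).
    by apply: (@continuous_comp _ _ _ _ (d1 f)); [exact: cl|exact: cd1].
  by apply: (@continuous_comp _ _ _ _ (d2 f)); [exact: cl|exact: cd2].
have := line_trace_le_oc dF cF' dl0.
rewrite {1}/F !mul0r !addr0 -surjective_pairing -/(g u) => /le_trans; apply.
have mslice (h : plane R -> \bar R) : measurable_fun setT h ->
    measurable_fun setT ((fun v => h (u, v)) : measurableTypeR R -> \bar R).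
  by move=> mh; apply: (measurableT_comp mh); exact: measurable_pair1.
apply: leeD; apply: lee_wpmul2l; rewrite ?lee_fin ?mulr_ge0 ?sqr_ge0//.
- apply: le_trans (integral_shift_sub (J := `]dl, (2 * dl)%R]) tau0 (measurable_itvR _) (mslice _ mH1) (fun v => H10 (u, v))).
  rewrite le_eqVlt; apply/orP; left; apply/eqP; apply: eq_integral => t.
  rewrite inE/= in_itv/= => /andP[td dt]; rewrite /F Phi_line /h1 patchE ifT// inE.
  by exists (u, tau0 + t) => //; split => /=; rewrite in_itv/= -?ler_norml//; apply/andP; split; lra.
- by apply: ltW.
- by apply: ltW.
- apply: le_trans (integral_shift_sub (J := `]0%R, (2 * dl)%R]) tau0 (measurable_itvR _) (mslice _ mH2) (fun v => H20 (u, v))).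
  have mI2 := measurable_itvR `]0%R, (2 * dl)%R].
  apply: (ge0_le_integral leb mI2).
  + by move=> t _; rewrite lee_fin sqr_ge0.
  + apply/measurable_EFinP; apply: measurable_funX.
    exact: measurable_funS (continuous_measurable1 cF').
  + have m3 := mslice _ mH2.
    have : measurable_fun setT ((fun t => (h2 \o Phi) (u, tau0 + t)) : measurableTypeR R -> \bar R).
      by apply: (measurableT_comp m3); apply: measurable_funD.
    exact: measurable_funS.
  + move=> t /=; rewrite in_itv/= => /andP[t0 td].
    have Ot : Omega (Phi (u, tau0 + t)).
      by apply/Omega_Phi => //=; [rewrite ger0_norm; lra|lra].
    rewrite /h2 patchE ifT ?inE// lee_fin /F' Phi_line /grad2.
    move: (d1 f _) (d2 f _) => x y.
    (* The gradient squared splits into the parts along (-s, c) and along (c, s); the second is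
       dropped. *)
    have -> : x ^+ 2 + y ^+ 2 = (c ^+ 2 + s ^+ 2) * (x ^+ 2 + y ^+ 2) by rewrite cs1 mul1r.
    by rewrite -subr_ge0 (_ : _ - _ = (c * x + s * y) ^+ 2) ?sqr_ge0//; ring.
Qed.

Let gamma (u : R) : R * R := Phi (u, 0).

Let gamma_lip u v : eucl_dist (gamma u) (gamma v) <= (1 + L) * `|u - v|.
Proof.
rewrite /gamma /Phi eucl_distX /=; apply: le_trans (sqrt_sqD_le _ _) _.
by rewrite !add0r mulrDl mul1r lerD2l.
Qed.

Let mgamma : measurable_fun setT (gamma : measurableTypeR R -> plane R).
Proof.
have [mPhi _] := Phi_area; apply: (measurableT_comp mPhi).
by apply: measurable_fun_pair.
Qed.

Let C_gt0 : 0 < 1 + L. Proof. by rewrite ltr_pwDl. Qed.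

Let G : set (R * R) := boundary Omega `&` chart_window.

Let mboundary : measurable (boundary Omega : set (plane R)).
Proof.
apply: measurableD; first by apply: closed_measurable_plane; exact: closed_closure.
by apply: open_measurable_plane; exact: open_interior.
Qed.

Let mwindow : measurable (chart_window : set (plane R)).
Proof. by apply: open_measurable_plane; exact: chart_window_open. Qed.

Let mG : measurable (G : set (plane R)). Proof. exact: measurableI. Qed.

Let G_gamma : G `<=` gamma @` Ik.
Proof.
move=> x [bx Wx]; exists (Psi x).1; last by rewrite /gamma -(boundary_chart bx Wx) PsiK.
by case: Wx => x1 _; rewrite /Ik /= in_itv/= -ltr_norml.
Qed.

Let mIk : measurable (Ik : set (measurableTypeR R)).
Proof. exact: measurable_itvR. Qed.

Lemma chart_arclength_finite : (arclength G < +oo)%E.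
Proof.
apply: (@le_lt_trans _ _ ((1 + L)%:E * leb Ik)%E).
  apply: le_trans (le_arclength G_gamma) _.
  exact: (arclength_lipschitz C_gt0 gamma_lip mIk).
have -> : leb Ik = (2 * kap)%:E.
  rewrite /Ik lebesgue_measure_itv/= lte_fin ifT; last by have := kap_gt0; lra.
  by rewrite -EFinB; congr EFin; ring.
by rewrite -EFinM ltry.
Qed.

Let continuous_slice (f : R * R -> R) (tau0 : R) : continuous f ->
  measurable_fun setT (fun u : measurableTypeR R => (f (Phi (u, tau0)) ^+ 2)%:E).
Proof.
move=> cf; have [mPhi _] := Phi_area.
have m1 := measurableT_comp (continuous_sq_measurable cf) mPhi.
by apply: (measurableT_comp m1); apply: measurable_fun_pair.
Qed.

Lemma chart_boundary_estimate (f : R * R -> R) : continuous f ->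
  (\int[arclength]_(x in G) (f x ^+ 2)%:E <=
   (1 + L)%:E * \int[leb]_(u in Ik) (f (Phi (u, 0)) ^+ 2)%:E)%E.
Proof.
move=> cf; have h0 (x : plane R) : (0 <= (f x ^+ 2)%:E)%E by rewrite lee_fin sqr_ge0.
have Gr : G `<=` range gamma by move=> x /G_gamma[u _ ux]; exists u.
apply: le_trans (arclength_integral_le C_gt0 gamma_lip mgamma mG Gr (continuous_sq_measurable cf) h0) _.
apply: lee_wpmul2l; first by rewrite lee_fin ltW.
apply: (ge0_subset_integral leb (A := gamma @^-1` G) (B := Ik)).
- by rewrite -[_ @^-1` _]setTI; exact: mgamma.
- exact: mIk.
- exact: measurable_funS (continuous_slice 0 cf).
- by move=> u _; exact: h0.
- move=> u [_ [u1 _]]; move: u1; rewrite /gamma PhiK /= => u1.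
  by rewrite /Ik /= in_itv/= -ltr_norml.
Qed.

(** The part of [Omega] in the window consists of the heights between 0 and [kap / 2], so a bound
    common to all slices is integrated over an interval of that length. *)
Lemma chart_volume_estimate (f : R * R -> R) (dl : R) (B : \bar R) : continuous f -> 0 < dl ->
  (0 <= B)%E ->
  (forall tau, 0 <= tau -> tau <= kap / 2 ->
    (dl%:E * \int[leb]_(u in Ik) (f (Phi (u, tau)) ^+ 2)%:E <= B)%E) ->
  (dl%:E * \int[area]_(x in Omega `&` chart_window) (f x ^+ 2)%:E <= B * (kap / 2)%:E)%E.
Proof.
move=> cf dl0 B0 le_slice; have [mPhi pPhi] := Phi_area.
have mOW : measurable (Omega `&` chart_window : set (plane R)).
  by apply: measurableI; [exact: open_measurable_plane|exact: mwindow].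
pose h : plane R -> \bar R := (fun x => (f x ^+ 2)%:E) \_ (Omega `&` chart_window).
have mh : measurable_fun setT h.
  apply/(measurable_restrictT _ mOW); exact: measurable_funS (continuous_sq_measurable cf).
have h0 x : (0 <= h x)%E by rewrite /h patchE; case: ifP => // _; rewrite lee_fin sqr_ge0.
have mhP : measurable_fun setT (fun z : plane R => h (Phi z)) by exact: (measurableT_comp mh mPhi).
have hP0 (z : plane R) : (0 <= h (Phi z))%E by exact: h0.
rewrite integral_mkcond -/h -(pPhi h mh h0) (area_tonelli21 mhP hP0).
pose S (t : measurableTypeR R) := (\int[leb]_u h (Phi (u, t)))%E.
have mS : measurable_fun setT S by exact: (measurable_fun_fubini_tonelli_G (m1 := leb) _ mhP hP0).
have S0 t : (0 <= S t)%E by apply: integral_ge0 => u _; exact: h0.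
have inW u t : (Omega `&` chart_window) (Phi (u, t)) -> `|u| < kap /\ 0 < t < kap / 2.
  case=> OP [u1 t1]; move: u1 t1; rewrite PhiK /= => u1 t1.
  have t1' : `|t| <= kap by apply: le_trans (ltW t1) _; have := kap_gt0; lra.
  have t0 := (Omega_Phi (z := (u, t)) (ltW u1) t1').1 OP.
  by split=> //; rewrite t0; move: t1; rewrite gtr0_norm.
have S_out t : ~ (0 < t < kap / 2) -> S t = 0%E.
  move=> nt; rewrite /S -[RHS](integral0 leb setT); apply: eq_integral => u _.
  by rewrite /h patchE; case: ifPn => // /set_mem/inW[_ /nt].
have S_in t : 0 < t < kap / 2 -> (dl%:E * S t <= B)%E.
  move=> /andP[t0 tk]; apply: le_trans (le_slice t (ltW t0) (ltW tk)).
  apply: lee_wpmul2l; first by rewrite lee_fin ltW.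
  rewrite /S [leRHS]integral_mkcond; apply: (ge0_le_integral leb measurableT).
  - by move=> u _; exact: h0.
  - by apply: (measurableT_comp mhP); exact: measurable_pair2.
  - apply/(measurable_restrictT _ mIk); exact: measurable_funS (continuous_slice t cf).
  - move=> u _; rewrite /h patchE; case: ifPn => [/set_mem/inW[u1 _]|_].
      by rewrite patchE ifT// inE /Ik /= in_itv/= -ltr_norml.
    by rewrite patchE; case: ifP => // _; rewrite lee_fin sqr_ge0.
rewrite -/S -(ge0_integralZl leb measurableT mS); last 2 first.
- by move=> t _; exact: S0.
- by rewrite lee_fin ltW.
pose J : set R := [set` `]0, (0 + kap / 2)]].
have mJ : measurable (J : set (measurableTypeR R)) by exact: measurable_itvR.
have k2 : 0 < kap / 2 by rewrite divr_gt0.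
rewrite -(integral_cst_itv 0 B k2) -/J [leRHS]integral_mkcond.
apply: (ge0_le_integral leb measurableT).
- by move=> t _; apply: mule_ge0; [rewrite lee_fin ltW|exact: S0].
- exact: measurable_funeM.
- by apply/(measurable_restrictT _ mJ).
- move=> t _; rewrite patchE; case: ifPn => [/set_mem|/negP ntJ].
    rewrite /J /= add0r in_itv/= => /andP[t0 tk].
    have [tk'|] := ltP t (kap / 2); first by apply: S_in; rewrite t0.
    by move=> kt; rewrite S_out ?mule0// => /andP[_]; rewrite ltNge kt.
  rewrite S_out ?mule0// => /andP[t0 tk]; apply: ntJ; rewrite inE /J /= add0r in_itv/=.
  by rewrite t0 ltW.
Qed.

(** The same bound on slices serves twice: height 0 gives the boundary, with the Lipschitz constant
    1 + L of the curve, and all heights give the volume, with the factor [kap / 2]. *)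
Lemma chart_estimate (f : R * R -> R) (dl : R) : C1 f -> 0 < dl -> dl <= kap / 4 ->
  (dl%:E * (\int[area]_(x in Omega `&` chart_window) (f x ^+ 2)%:E +
            \int[arclength]_(x in G) (f x ^+ 2)%:E) <=
   (1 + L + kap / 2)%:E * (2%:E * \int[area]_(x in chart_inner dl) (f x ^+ 2)%:E +
   (4 * dl ^+ 2)%:E * \int[area]_(x in Omega) (grad2 f x)%:E))%E.
Proof.
move=> Cf dl0 dlk; have cf := C1_continuous Cf.
set B := (2%:E * _ + _)%E.
have B0 : (0 <= B)%E.
  apply: adde_ge0; apply: mule_ge0.
  - by rewrite lee_fin.
  - by apply: integral_ge0 => x _; rewrite lee_fin sqr_ge0.
  - by rewrite lee_fin mulr_ge0// sqr_ge0.
  - by apply: integral_ge0 => x _; rewrite lee_fin grad2_ge0.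
have le_slice tau : 0 <= tau -> tau <= kap / 2 ->
    (dl%:E * \int[leb]_(u in Ik) (f (Phi (u, tau)) ^+ 2)%:E <= B)%E.
  by move=> t0 tk; exact: chart_line_estimate.
have vol := chart_volume_estimate cf dl0 B0 le_slice.
have k2 : 0 <= kap / 2 by rewrite divr_ge0// ltW.
have bdy : (dl%:E * \int[arclength]_(x in G) (f x ^+ 2)%:E <= (1 + L)%:E * B)%E.
  apply: (@le_trans _ _ ((1 + L)%:E * (dl%:E * \int[leb]_(u in Ik) (f (Phi (u, 0)) ^+ 2)%:E))%E).
    rewrite muleCA; apply: lee_wpmul2l; first by rewrite lee_fin ltW.
    exact: chart_boundary_estimate.
  by apply: lee_wpmul2l; [rewrite lee_fin ltW|exact: le_slice].
rewrite ge0_muleDr; last 2 first.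
- by apply: integral_ge0 => x _; rewrite lee_fin sqr_ge0.
- by apply: integral_ge0 => x _; rewrite lee_fin sqr_ge0.
rewrite (EFinD (1 + L)) ge0_muleDl ?lee_fin ?(ltW C_gt0)// addeC.
by apply: leeD; [exact: bdy|rewrite [leRHS]muleC; exact: vol].
Qed.

End Chart.

Section BoundaryEstimate.
Context {R : realType}.

(* Along the vertical segments of a chart, values near the boundary are controlled
   by values at depth comparable to dl, which stay in the compact K, and by the
   gradient.  After division by dl the energy carries a factor of order dl. *)
Lemma boundary_chart_estimate (Omega : set (R * R)) (p : R * R) :
  open Omega -> lipschitz_boundary Omega -> boundary Omega p ->
  exists W : set (R * R), [/\ open W, W p, (arclength (boundary Omega `&` W) < +oo)%E &
    exists A d0 : R, [/\ 0 < A, 0 < d0 & forall dl, 0 < dl -> dl <= d0 ->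
      exists K : set (R * R), [/\ compact K, K `<=` Omega & forall f, C1 f ->
        (dl%:E * (\int[area]_(x in Omega `&` W) (f x ^+ 2)%:E +
            \int[arclength]_(x in boundary Omega `&` W) (f x ^+ 2)%:E) <=
         A%:E * (2%:E * \int[area]_(x in K) (f x ^+ 2)%:E +
         (4 * dl ^+ 2)%:E * \int[area]_(x in Omega) (grad2 f x)%:E))%E]]].
Proof.
move=> oO lipO bp; have [r [c [s [phi [r0 cs1 lip chart]]]]] := lipO p bp.
have [L L0 phi_lip] : exists2 L : R, 0 <= L & forall x y, `|phi x - phi y| <= L * `|x - y|.
  have [M [_ HM]] := lip.
  exists (Num.max 0 (M + 1)); first by rewrite le_max lexx.
  move=> x y; have M1 : M < Num.max 0 (M + 1) by rewrite lt_max ltrDl ltr01 orbT.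
  exact: (HM _ M1 (x, y)).
have k0 : 0 < r / (2 * (3 + L)) by rewrite divr_gt0// mulr_gt0// ltr_wpDr.
exists (chart_window p r c s L phi); split.
- exact: chart_window_open.
- exact: (chart_window_center oO bp r0 L0 phi_lip chart).
- exact: (chart_arclength_finite oO bp r0 cs1 L0 phi_lip chart).
exists (1 + L + r / (2 * (3 + L)) / 2), (r / (2 * (3 + L)) / 4); split.
- by apply: addr_gt0; [rewrite ltr_pwDl|rewrite divr_gt0].
- by rewrite divr_gt0.
move=> dl dl0 dlk; exists (chart_inner p r c s L phi dl); split.
- exact: chart_inner_compact.
- exact: (chart_inner_sub oO bp r0 cs1 L0 phi_lip chart).
- by move=> f Cf; exact: (chart_estimate oO bp r0 cs1 L0 phi_lip chart).
Qed.

End BoundaryEstimate.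

(** * Rellich inequality *)

(** If [P K] failed, the sets whose complement in [K] satisfies [P] would form a proper filter
    containing [K]. At a cluster point in [K], an open neighbourhood [U] with [P U] would have its
    complement in this filter. *)
Lemma compact_induction (T : topologicalType) (K : set T) (P : set T -> Prop) :
  compact K -> P set0 -> (forall A B, A `<=` B -> P B -> P A) ->
  (forall A B, P A -> P B -> P (A `|` B)) ->
  (forall x, K x -> exists U, [/\ open U, U x & P U]) -> P K.
Proof.
move=> cK P0 Ps PU PO; apply: contrapT => nPK.
pose F : set_system T := [set A | P (K `\` A)].
have FF : ProperFilter F.
  split; first by rewrite /F /= setD0.
  split; first by rewrite /F /= setDT.
    by move=> A B FA FB; rewrite /F /= setDIr; exact: PU.
  by move=> A B AB; apply: Ps => x [Kx nB]; split=> // /AB.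
have KF : F K by rewrite /F /= setDv.
have [x [Kx clx]] := cK F FF KF.
have [U [oU Ux PU']] := PO x Kx.
have nF : F (~` U) by apply: Ps PU'; rewrite setDE setCK => y [].
by have [y [/= nOy Oy]] := clx _ _ nF (open_nbhs_nbhs (conj oU Ux)).
Qed.

Section Rellich.
Context {R : realType}.
Notation leb := (@lebesgue_measure R).
Implicit Types f : R * R -> R.

(* weight, then lower left corner and side length *)
Definition square : Type := (R * (R * R * R))%type.
Definition square_set (q : square) : set (R * R) := sq q.2.1.1 q.2.1.2 q.2.2.
Definition square_term (q : square) f : R := q.1 * (\int[area]_(z in square_set q) f z) ^+ 2.
Definition square_in (D : set (R * R)) (q : square) : Prop :=
  [/\ 0 <= q.1, 0 < q.2.2 & square_set q `<=` D].

Lemma measurable_square q : measurable (square_set q : set (plane R)).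
Proof. exact: measurable_sq. Qed.

Lemma measurable_sqfun f : C1 f -> measurable_fun setT (fun x : plane R => (f x ^+ 2)%:E).
Proof. by move=> Cf; apply: continuous_sq_measurable; exact: C1_continuous. Qed.

Lemma measurable_grad2 f : C1 f -> measurable_fun setT (fun x : plane R => (grad2 f x)%:E).
Proof.
move=> [_ c1 c2]; apply/measurable_EFinP.
by apply: measurable_funD; apply: measurable_funX; exact: continuous_measurable_plane.
Qed.

Lemma sq_halves (h : R) (a b : R) : 0 < h ->
  sq a b h = (sq a b (h / 2) `|` sq (a + h / 2) b (h / 2)) `|`
    (sq a (b + h / 2) (h / 2) `|` sq (a + h / 2) (b + h / 2) (h / 2)).
Proof.
move=> h0; apply/seteqP; split=> [[x y]|[x y]]; rewrite /sq /=.
  move=> [] /=; rewrite !in_itv/= => /andP[x1 x2] /andP[y1 y2].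
  have xh : (x <= a + h / 2) || (a + h / 2 < x) by case: leP.
  have yh : (y <= b + h / 2) || (b + h / 2 < y) by case: leP.
  case/orP: xh => xh; case/orP: yh => yh.
  - by left; left; split; rewrite /= ?in_itv/=; apply/andP; split; lra.
  - by right; left; split; rewrite /= ?in_itv/=; apply/andP; split; lra.
  - by left; right; split; rewrite /= ?in_itv/=; apply/andP; split; lra.
  - by right; right; split; rewrite /= ?in_itv/=; apply/andP; split; lra.
by move=> [[[]|[]]|[[]|[]]] /=; rewrite !in_itv/= => /andP[x1 x2] /andP[y1 y2];
  split; apply/andP; split; lra.
Qed.

Lemma integral_sq_halves (H : plane R -> \bar R) (h a b : R) : 0 < h ->
  measurable_fun setT H -> (forall z, 0 <= H z)%E ->
  (\int[area]_(z in sq a b h) H z =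
   (\int[area]_(z in sq a b (h / 2)%R) H z + \int[area]_(z in sq (a + h / 2)%R b (h / 2)%R) H z) +
   (\int[area]_(z in sq a (b + h / 2)%R (h / 2)%R) H z +
    \int[area]_(z in sq (a + h / 2)%R (b + h / 2)%R (h / 2)%R) H z))%E.
Proof.
move=> h0 mH H0; rewrite (sq_halves a b h0).
have m1 := measurable_sq a b (h / 2); have m2 := measurable_sq (a + h / 2) b (h / 2).
have m3 := measurable_sq a (b + h / 2) (h / 2).
have m4 := measurable_sq (a + h / 2) (b + h / 2) (h / 2).
have add (A B : set (plane R)) : measurable A -> measurable B -> [disjoint A & B] ->
    (\int[area]_(z in A `|` B) H z = \int[area]_(z in A) H z + \int[area]_(z in B) H z)%E.
  move=> mA mB AB; apply: (ge0_integral_setU _ mA mB).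
  - exact: measurable_funS mH.
  - by move=> z _; exact: H0.
  - exact: AB.
have disj (A B : set (plane R)) : (forall z, A z -> B z -> False) -> [disjoint A & B].
  by move=> AB; apply/disj_setPS => z [Az Bz]; exact: AB z Az Bz.
rewrite !add//.
- by apply: disj => -[x y] [/= + _] [/= + _]; rewrite !in_itv/= => /andP[_ ?] /andP[? _]; lra.
- by apply: disj => -[x y] [/= + _] [/= + _]; rewrite !in_itv/= => /andP[_ ?] /andP[? _]; lra.
- exact: measurableU.
- exact: measurableU.
- by apply: disj => -[x y] [[/= _ +]|[/= _ +]] [[/= _ +]|[/= _ +]];
    rewrite !in_itv/= => /andP[_ ?] /andP[? _]; lra.
Qed.

(** The Poincaré inequality on the dyadic squares of side h / 2^n: finitely many more averages buy
    an arbitrarily small coefficient of the energy. *)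
Lemma square_refine n (a b h : R) : 0 < h -> exists l : seq square,
  (forall q, q \in l -> square_in (sq a b h) q) /\
  forall f, C1 f -> (\int[area]_(z in sq a b h) (f z ^+ 2)%:E <=
    (\sum_(q <- l) square_term q f)%:E +
    (2 * (h / 2 ^+ n) ^+ 2)%:E * \int[area]_(z in sq a b h) (grad2 f z)%:E)%E.
Proof.
elim: n a b h => [|n ih] a b h h0.
  exists [:: ((h ^+ 2)^-1, (a, b, h))]; split.
    by move=> q; rewrite inE => /eqP ->; split => //=; rewrite invr_ge0 sqr_ge0.
  move=> f Cf; rewrite big_seq1 /square_term /square_set/= expr0 divr1 mulrC.
  exact: square_poincare.
have h2 : 0 < h / 2 by rewrite divr_gt0.
have [l1 [s1 H1]] := ih a b (h / 2) h2.
have [l2 [s2 H2]] := ih (a + h / 2) b (h / 2) h2.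
have [l3 [s3 H3]] := ih a (b + h / 2) (h / 2) h2.
have [l4 [s4 H4]] := ih (a + h / 2) (b + h / 2) (h / 2) h2.
have sub := sq_halves a b h0.
exists ((l1 ++ l2) ++ (l3 ++ l4)); split.
  have sin (D : set (R * R)) l q : (forall q, q \in l -> square_in D q) -> D `<=` sq a b h ->
      q \in l -> square_in (sq a b h) q.
    by move=> sl Dl /sl[? ? qD]; split => //; exact: subset_trans Dl.
  move=> q; rewrite !mem_cat => /orP[/orP[]|/orP[]].
  - by apply: sin s1 _; rewrite sub => z; left; left.
  - by apply: sin s2 _; rewrite sub => z; left; right.
  - by apply: sin s3 _; rewrite sub => z; right; left.
  - by apply: sin s4 _; rewrite sub => z; right; right.
move=> f Cf; rewrite !big_cat/=.
have := measurable_sqfun Cf => mf; have mg := measurable_grad2 Cf.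
rewrite (integral_sq_halves a b h0 mf); last by move=> z; rewrite lee_fin sqr_ge0.
rewrite (integral_sq_halves a b h0 mg); last by move=> z; rewrite lee_fin grad2_ge0.
have -> : h / 2 ^+ n.+1 = h / 2 / 2 ^+ n by rewrite exprS invfM mulrA.
have := H1 f Cf; have := H2 f Cf; have := H3 f Cf; have := H4 f Cf.
have g0 D : (0 <= \int[area]_(z in D) (grad2 f z)%:E)%E.
  by apply: integral_ge0 => z _; rewrite lee_fin grad2_ge0.
move: (g0 (sq a b (h / 2))) (g0 (sq (a + h / 2) b (h / 2)))
  (g0 (sq a (b + h / 2) (h / 2))) (g0 (sq (a + h / 2) (b + h / 2) (h / 2))).
set G1 := (\int[area]_(z in sq a b (h / 2)%R) (grad2 f z)%:E)%E.
set G2 := (\int[area]_(z in sq (a + h / 2)%R b (h / 2)%R) (grad2 f z)%:E)%E.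
set G3 := (\int[area]_(z in sq a (b + h / 2)%R (h / 2)%R) (grad2 f z)%:E)%E.
set G4 := (\int[area]_(z in sq (a + h / 2)%R (b + h / 2)%R (h / 2)%R) (grad2 f z)%:E)%E.
clearbody G1 G2 G3 G4 => g1 g2 g3 g4 i4 i3 i2 i1.
rewrite !EFinD ge0_muleDr ?adde_ge0// ge0_muleDr// [X in (_ <= _ + (_ + X))%E]ge0_muleDr//.
rewrite [leRHS]addeACA; apply: leeD.
  by rewrite [leRHS]addeACA; apply: leeD.
by rewrite [leRHS]addeACA; apply: leeD.
Qed.

Section Domain.
Variable Omega : set (R * R).
Hypothesis Omega_open : open Omega.

Let mO : measurable (Omega : set (plane R)). Proof. exact: open_measurable_plane. Qed.

Let mboundary : measurable (boundary Omega : set (plane R)).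
Proof.
apply: measurableD; first by apply: closed_measurable_plane; exact: closed_closure.
by apply: open_measurable_plane; exact: open_interior.
Qed.

Definition mass f (B : set (R * R)) : \bar R :=
  (\int[area]_(x in Omega `&` B) (f x ^+ 2)%:E + \int[arclength]_(x in boundary Omega `&` B) (f x ^+ 2)%:E)%E.

Definition energy f : \bar R := (\int[area]_(x in Omega) (grad2 f x)%:E)%E.

Lemma energy_ge0 f : (0 <= energy f)%E.
Proof. by apply: integral_ge0 => x _; rewrite lee_fin grad2_ge0. Qed.

Definition finite_rank_bound (B : set (R * R)) : Prop := forall eps : R, 0 < eps ->
  exists l : seq square, (forall q, q \in l -> square_in Omega q) /\
  forall f, C1 f -> (mass f B <= (\sum_(q <- l) square_term q f)%:E + eps%:E * energy f)%E.

(** Passing to a measurable superset makes the property monotone on arbitrary sets, as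
    [compact_induction] demands. *)
Definition finite_rank_cover (A : set (R * R)) : Prop :=
  exists B : set (R * R), [/\ measurable (B : set (plane R)), A `<=` B & finite_rank_bound B].

Lemma ge0_integral_setU_le (mu : {measure set (plane R) -> \bar R}) (A B : set (plane R))
    (H : plane R -> \bar R) : measurable A -> measurable B ->
  measurable_fun setT H -> (forall z, 0 <= H z)%E ->
  (\int[mu]_(x in A `|` B) H x <= \int[mu]_(x in A) H x + \int[mu]_(x in B) H x)%E.
Proof.
move=> mA mB mH H0.
have mBA : measurable (B `\` A) by exact: measurableD.
have -> : A `|` B = A `|` (B `\` A) by rewrite setUDr setDv setD0.
rewrite (ge0_integral_setU mu mA mBA).
- apply: leeD => //; apply: (ge0_subset_integral mu mBA mB).
  + exact: measurable_funS mH.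
  + by move=> z _; exact: H0.
  + exact: subDsetl.
- exact: measurable_funS mH.
- by move=> z _; exact: H0.
- by apply/disj_setPS => z [Az [_ nAz]]; exact: nAz.
Qed.

Lemma mass_setU f (A B : set (R * R)) : C1 f -> measurable (A : set (plane R)) ->
  measurable (B : set (plane R)) -> (mass f (A `|` B) <= mass f A + mass f B)%E.
Proof.
move=> Cf mA mB; have mf := measurable_sqfun Cf.
have f0 (x : plane R) : (0 <= (f x ^+ 2)%:E)%E by rewrite lee_fin sqr_ge0.
have mOA : measurable (Omega `&` A : set (plane R)) by exact: measurableI.
have mOB : measurable (Omega `&` B : set (plane R)) by exact: measurableI.
have mbA : measurable (boundary Omega `&` A : set (plane R)) by exact: measurableI.
have mbB : measurable (boundary Omega `&` B : set (plane R)) by exact: measurableI.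
rewrite /mass !setIUr [leRHS]addeACA; apply: leeD.
  exact: ge0_integral_setU_le.
exact: ge0_integral_setU_le.
Qed.

Lemma finite_rank_cover_setU A B :
  finite_rank_cover A -> finite_rank_cover B -> finite_rank_cover (A `|` B).
Proof.
move=> [A' [mA AA' HA]] [B' [mB BB' HB]]; exists (A' `|` B'); split.
- exact: measurableU.
- exact: setUSS.
move=> eps eps0; have e2 : 0 < eps / 2 by rewrite divr_gt0.
have [lA [sA lAE]] := HA _ e2; have [lB [sB lBE]] := HB _ e2.
exists (lA ++ lB); split.
  by move=> q; rewrite mem_cat => /orP[/sA|/sB].
move=> f Cf; rewrite big_cat/= EFinD.
have -> : (eps%:E * energy f = (eps / 2)%:E * energy f + (eps / 2)%:E * energy f)%E.
  rewrite -ge0_muleDl ?lee_fin ?ltW// -EFinD; congr (_%:E * _)%E; lra.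
rewrite addeACA; apply: le_trans (mass_setU Cf mA mB) _.
by apply: leeD; [exact: lAE|exact: lBE].
Qed.

Lemma finite_rank_cover_interior x : Omega x -> exists W, [/\ open W, W x & finite_rank_cover W].
Proof.
move=> Ox; have [e e0 eO] := open_box Omega_open Ox.
pose W : set (R * R) := [set y | `|y.1 - x.1| < e / 2] `&` [set y | `|y.2 - x.2| < e / 2].
have oW : open W.
  have on (g : R * R -> R) : continuous g -> open [set y | `|g y| < e / 2].
    move=> cg; apply: (@open_comp _ _ (fun y => `|g y|) [set z | z < e / 2]).
      move=> y _; apply: (@continuous_comp _ _ _ g Num.norm); [exact: cg|exact: norm_continuous].
    exact: open_lt.
  apply: openI.
    by apply: (on (fun y => y.1 - x.1)) => y; apply: cvgB; [exact: cvg_fst|exact: cvg_cst].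
  by apply: (on (fun y => y.2 - x.2)) => y; apply: cvgB; [exact: cvg_snd|exact: cvg_cst].
have WO : W `<=` Omega.
  by move=> y [/= y1 y2]; apply: eO; apply: (lt_trans _ (_ : e / 2 < e)) => //; lra.
exists W; split => //.
  by split; rewrite /= subrr normr0 divr_gt0.
exists W; split; [exact: open_measurable_plane|by []|].
move=> eps eps0; pose a := x.1 - e / 2; pose b := x.2 - e / 2.
have WQ : W `<=` sq a b e.
  move=> y [/= +]; rewrite !ltr_distl => /andP[? ?] /andP[? ?].
  by split; rewrite /= in_itv/=; apply/andP; split; rewrite /a /b; lra.
have QO : sq a b e `<=` Omega.
  move=> y [/=]; rewrite !in_itv/= /a /b => /andP[? ?] /andP[? ?].
  by apply: eO; rewrite ltr_distl; apply/andP; split; lra.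
have [n ne] : exists n : nat, 2 * (e / 2 ^+ n) ^+ 2 <= eps.
  (* A side z <= d <= 1 has 2 z^2 <= 2 d <= eps. *)
  pose d := Num.min 1 (eps / 2).
  have d0 : 0 < d by rewrite lt_min ltr01 divr_gt0.
  have d1 : d <= 1 by rewrite ge_min lexx.
  have de : d <= eps / 2 by rewrite ge_min lexx orbT.
  have [n _ Hn] := nbhs_infty_gtr (e / d).
  have en : e / d < n%:R by exact: (Hn n (leqnn n)).
  exists n; have p2 : 0 < 2 ^+ n :> R by rewrite exprn_gt0.
  have : e / 2 ^+ n <= d.
    rewrite ler_pdivrMr// mulrC -ler_pdivrMr//; apply: le_trans (ltW en) _.
    by rewrite -natrX ler_nat ltnW// ltn_expl.
  have : 0 <= e / 2 ^+ n by rewrite divr_ge0// ltW.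
  move: (e / 2 ^+ n) => z z0 zd; nra.
have [l [sl Hl]] := square_refine n a b e0.
exists l; split.
  by move=> q /sl[? ? ?]; split => //; exact: subset_trans QO.
move=> f Cf; have mf := measurable_sqfun Cf; have mg := measurable_grad2 Cf.
have mW : measurable (W : set (plane R)) by exact: open_measurable_plane.
have mOW : measurable (Omega `&` W : set (plane R)) by exact: measurableI.
have mQ := measurable_sq a b e.
have bW : boundary Omega `&` W = set0.
  rewrite -subset0 => y [[_ ny] Wy]; apply: ny.
  by have := Omega_open; rewrite openE; apply; exact: WO.
rewrite /mass bW integral_set0 adde0.
apply: (@le_trans _ _ (\int[area]_(z in sq a b e) (f z ^+ 2)%:E)%E).
  apply: (ge0_subset_integral area mOW mQ).
  - exact: measurable_funS mf.
  - by move=> z _; rewrite lee_fin sqr_ge0.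
  - by move=> z [_]; exact: WQ.
apply: le_trans (Hl f Cf) _; apply: leeD => //.
apply: (@le_trans _ _ (eps%:E * \int[area]_(z in sq a b e) (grad2 f z)%:E)%E).
  apply: lee_wpmul2r; last by rewrite lee_fin.
  by apply: integral_ge0 => z _; rewrite lee_fin grad2_ge0.
apply: lee_wpmul2l; first by rewrite lee_fin ltW.
apply: (ge0_subset_integral area mQ mO) => //.
- exact: measurable_funS mg.
- by move=> z _; rewrite lee_fin grad2_ge0.
Qed.

Lemma finite_rank_cover0 : finite_rank_cover set0.
Proof.
exists set0; split => // eps eps0; exists [::]; split => // f Cf.
rewrite /mass !setI0 !integral_set0 adde0 big_nil add0e mule_ge0 ?energy_ge0//.
by rewrite lee_fin ltW.
Qed.

Lemma finite_rank_cover_mono A B : A `<=` B -> finite_rank_cover B -> finite_rank_cover A.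
Proof. by move=> AB [B' [mB BB' HB]]; exists B'; split => //; exact: subset_trans BB'. Qed.

Lemma finite_rank_cover_compact_inner K : compact K -> K `<=` Omega -> finite_rank_cover K.
Proof.
move=> cK KO; apply: (compact_induction cK).
- exact: finite_rank_cover0.
- exact: finite_rank_cover_mono.
- exact: finite_rank_cover_setU.
- by move=> x /KO; exact: finite_rank_cover_interior.
Qed.

Lemma finite_rank_bound_inner K : compact K -> K `<=` Omega -> forall eps : R, 0 < eps ->
  exists l : seq square, (forall q, q \in l -> square_in Omega q) /\
  forall f, C1 f -> (\int[area]_(x in K) (f x ^+ 2)%:E <=
    (\sum_(q <- l) square_term q f)%:E + eps%:E * energy f)%E.
Proof.
move=> cK KO eps eps0; have [B [mB KB HB]] := finite_rank_cover_compact_inner cK KO.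
have [l [sl Hl]] := HB eps eps0; exists l; split => // f Cf.
apply: le_trans (Hl f Cf); have mf := measurable_sqfun Cf.
have mK : measurable (K : set (plane R)).
  apply: closed_measurable_plane; apply: compact_closed => //; exact: norm_hausdorff.
have mOB : measurable (Omega `&` B : set (plane R)) by exact: measurableI.
apply: (@le_trans _ _ (\int[area]_(x in Omega `&` B) (f x ^+ 2)%:E)%E).
  apply: (ge0_subset_integral area mK mOB).
  - exact: measurable_funS mf.
  - by move=> z _; rewrite lee_fin sqr_ge0.
  - by move=> z Kz; split; [exact: KO|exact: KB].
by rewrite leeDl//; apply: integral_ge0 => z _; rewrite lee_fin sqr_ge0.
Qed.

Definition scale_square (k : R) (q : square) : square := (k * q.1, q.2).

(** The depth [dl] is fixed first, to make the energy term of the chart small. It determines the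
    compact set [K], on which the interior estimate is then applied with an accuracy [eps'] that
    survives the division by [dl]. *)
Lemma finite_rank_cover_boundary x : lipschitz_boundary Omega -> boundary Omega x ->
  exists W, [/\ open W, W x & finite_rank_cover W].
Proof.
move=> lipO bx; have [W [oW Wx _ [A [d0 [A0 d00 Hdl]]]]] := boundary_chart_estimate Omega_open lipO bx.
exists W; split => //; exists W; split => //; first exact: open_measurable_plane.
(* After division by [dl] the energy has coefficient 4 A dl + 2 A eps' / dl; the choices of [dl] and
   [eps'] make each summand at most eps / 2. The averages on [K] get the factor k = 2 A / dl. *)
move=> eps eps0; pose dl := Num.min d0 (eps / (8 * A)).
have dl0 : 0 < dl by rewrite lt_min d00 divr_gt0// mulr_gt0.
have dld : dl <= d0 by rewrite ge_min lexx.
have dle : 8 * A * dl <= eps.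
  by rewrite mulrC -ler_pdivlMr ?mulr_gt0// ge_min lexx orbT.
have [K [cK KO HK]] := Hdl dl dl0 dld.
pose eps' := eps * dl / (4 * A).
have eps'0 : 0 < eps' by rewrite divr_gt0 ?mulr_gt0.
have [l [sl Hl]] := finite_rank_bound_inner cK KO eps'0.
pose k := 2 * A / dl; have k0 : 0 < k by rewrite divr_gt0 ?mulr_gt0.
exists (map (scale_square k) l); split.
  move=> q /mapP[q' /sl[q0 q1 q2] ->]; split => //=.
  by rewrite mulr_ge0// ltW.
move=> f Cf; have := HK f Cf; have := Hl f Cf.
rewrite -/(mass f W) -/(energy f) big_map.
have -> : \sum_(q <- l) square_term (scale_square k q) f = k * \sum_(q <- l) square_term q f.
  by rewrite mulr_sumr; apply: eq_bigr => q _; rewrite /square_term /= mulrA.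
have E0 := energy_ge0 f.
have I0 : (0 <= \int[area]_(x in K) (f x ^+ 2)%:E)%E.
  by apply: integral_ge0 => z _; rewrite lee_fin sqr_ge0.
move: E0 I0; set E := energy f; set I := (\int[area]_(x in K) _)%E; set S := \sum_(q <- l) _.
set m := mass f W; clearbody E I m => E0 I0 H1 H2.
have dlm : (dl%:E * m <= dl%:E * ((k * S)%:E + eps%:E * E))%E.
  apply: le_trans H2 _.
  apply: (@le_trans _ _ (A%:E * (2%:E * (S%:E + eps'%:E * E) + (4 * dl ^+ 2)%:E * E))%E).
    apply: lee_wpmul2l; first by rewrite lee_fin ltW.
    by apply: leeD => //; apply: lee_wpmul2l => //; rewrite lee_fin.
  have [->|Eoo] := eqVneq E +oo%E.
    have -> : (dl%:E * ((k * S)%:E + eps%:E * +oo) = +oo)%E; last exact: leey.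
    by rewrite gt0_muley ?lte_fin// addey ?ltNye_eq// gt0_muley ?lte_fin.
  have [e Ee] : exists e, E = e%:E.
    by exists (fine E); rewrite fineK// ge0_fin_numE// ltey.
  rewrite Ee in E0 *; rewrite lee_fin in E0.
  rewrite -(EFinM eps' e) -(EFinD S) -(EFinM 2) -(EFinM (4 * dl ^+ 2)) -EFinD -(EFinM A).
  rewrite -(EFinM eps e) -EFinD -(EFinM dl) lee_fin.
  have -> : A * (2 * (S + eps' * e) + 4 * dl ^+ 2 * e) =
      dl * (k * S) + (dl * eps / 2 + 4 * A * dl ^+ 2) * e.
    by rewrite /k /eps'; field; rewrite !gt_eqF.
  rewrite mulrDr lerD2l mulrA ler_wpM2r//.
  have : dl * (8 * A * dl) <= dl * eps by rewrite ler_pM2l.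
  rewrite expr2; lra.
by rewrite -(lee_pmul2l (x := dl%:E)) ?lte_fin.
Qed.

Hypothesis Omega_bounded : bounded_set Omega.

Lemma Omega_box : exists M : R, forall x, closure Omega x -> `|x.1| <= M /\ `|x.2| <= M.
Proof.
have [M [_ HM]] := Omega_bounded; exists (M + 1).
have OM x : Omega x -> `|x.1| <= M + 1 /\ `|x.2| <= M + 1.
  move=> Ox; have := HM (M + 1) ltac:(by rewrite ltrDl) x Ox.
  by rewrite /= prod_normE ge_max => /andP[].
have cl : closed [set x : R * R | `|x.1| <= M + 1 /\ `|x.2| <= M + 1].
  have cn (g : R * R -> R) : continuous g -> closed [set y | `|g y| <= M + 1].
    move=> cg; apply: (@closed_comp _ _ (fun y => `|g y|) [set z | z <= M + 1]); last exact: closed_le.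
    by move=> y _; apply: (@continuous_comp _ _ _ g Num.norm); [exact: cg|exact: norm_continuous].
  apply: closedI; apply: cn => y; [exact: cvg_fst|exact: cvg_snd].
by rewrite closureE; apply: smallest_sub.
Qed.

Lemma closure_compact : compact (closure Omega).
Proof.
have [M HM] := Omega_box.
apply: (@subclosed_compact _ _ ([set` `[- M, M]] `*` [set` `[- M, M]] : set (R * R))).
- exact: closed_closure.
- by apply: compact_setX; exact: segment_compact.
- by move=> x /HM[x1 x2]; split; rewrite /= in_itv/= -ler_norml.
Qed.

Lemma area_finite : (area Omega < +oo)%E.
Proof.
have [M HM] := Omega_box.
have OQ : Omega `<=` sq (- `|M| - 1) (- `|M| - 1) (2 * (`|M| + 1)).
  move=> x /subset_closure/HM[]; rewrite !ler_norml => /andP[? ?] /andP[? ?].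
  have := ler_norm M; have := ler_norm (- M); rewrite normrN => ? ?.
  by split; rewrite /= in_itv/=; apply/andP; split; lra.
have h0 : 0 < 2 * (`|M| + 1) by rewrite mulr_gt0// ltr_wpDl.
apply: (@le_lt_trans _ _ (area (sq (- `|M| - 1) (- `|M| - 1) (2 * (`|M| + 1))))).
  by apply: le_measure => //; rewrite inE//; exact: measurable_sq.
by rewrite area_sq// ltry.
Qed.

Hypothesis Omega_lipschitz : lipschitz_boundary Omega.

Lemma closure_cases x : closure Omega x -> Omega x \/ boundary Omega x.
Proof.
move=> clx; have [Ox|nOx] := pselect (Omega x); [by left|right; split => //].
by move=> /interior_subset.
Qed.

Lemma boundary_closure : boundary Omega `<=` closure Omega.
Proof. by move=> x []. Qed.

Lemma arclength_boundary_finite : (arclength (boundary Omega) < +oo)%E.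
Proof.
pose P (A : set (R * R)) := (arclength (boundary Omega `&` A) < +oo)%E.
have -> : boundary Omega = boundary Omega `&` closure Omega.
  by apply/esym/setIidPl; exact: boundary_closure.
apply: (@compact_induction _ _ P closure_compact).
- by rewrite /P setI0 arclength0 ltry.
- by move=> A B AB; apply: le_lt_trans; apply: le_arclength; exact: setIS.
- move=> A B PA PB; rewrite /P setIUr; apply: le_lt_trans (outer_measureU2 arclength _ _) _.
  exact: lte_add_pinfty.
- move=> x /closure_cases[Ox|bx].
    exists Omega; split => //; rewrite /P (_ : _ `&` _ = set0) ?arclength0 ?ltry//.
    rewrite -subset0 => y [[_ ny] Oy]; apply: ny.
    by have := Omega_open; rewrite openE; apply.
  have [W [oW Wx PW _]] := boundary_chart_estimate Omega_open Omega_lipschitz bx.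
  by exists W.
Qed.

Lemma rellich (eps : R) : 0 < eps ->
  exists l : seq square, (forall q, q \in l -> square_in Omega q) /\
  forall f, C1 f -> (\int[area]_(x in Omega) (f x ^+ 2)%:E +
      \int[arclength]_(x in boundary Omega) (f x ^+ 2)%:E <=
    (\sum_(q <- l) square_term q f)%:E + eps%:E * energy f)%E.
Proof.
move=> eps0; have : finite_rank_cover (closure Omega).
  apply: (compact_induction closure_compact).
  - exact: finite_rank_cover0.
  - exact: finite_rank_cover_mono.
  - exact: finite_rank_cover_setU.
  - move=> x /closure_cases[Ox|bx]; first exact: finite_rank_cover_interior.
    exact: finite_rank_cover_boundary.
move=> [B [mB cB /(_ eps eps0)[l [sl Hl]]]]; exists l; split => // f Cf.
have := Hl f Cf; rewrite /mass.
have -> : Omega `&` B = Omega.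
  by apply/setIidPl; exact: subset_trans (@subset_closure _ Omega) cB.
have -> // : boundary Omega `&` B = boundary Omega.
by apply/setIidPl; exact: subset_trans boundary_closure cB.
Qed.

End Domain.

End Rellich.

(** * The space H^1 *)

Section IntegrationByParts.
Context {R : realType}.
Notation leb := (@lebesgue_measure R).
Implicit Types f g P phi : R * R -> R.

Lemma box_sq (M : R) (x : R * R) : 0 < M -> `|x.1| < M -> `|x.2| < M ->
  sq (- M) (- M) (2 * M) x.
Proof.
move=> M0; rewrite !ltr_norml => /andP[? ?] /andP[? ?].
by split; rewrite /= in_itv/=; apply/andP; split; lra.
Qed.

Lemma vanishing_integrable g (M : R) : 0 < M -> continuous g ->
  (forall x, g x != 0 -> `|x.1| < M /\ `|x.2| < M) ->
  (@area R).-integrable setT (EFin \o (g : plane R -> R)).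
Proof.
move=> M0 cg gM; have h0 : 0 < 2 * M by rewrite mulr_gt0.
have mQ := measurable_sq (- M) (- M) (2 * M).
have Qfin : (area (sq (- M) (- M) (2 * M)) < +oo)%E by rewrite area_sq// ltry.
have := sqint_integrable1 mQ Qfin (continuous_sqint_sq (- M) (- M) h0 cg).
rewrite integrable_mkcond//; congr (_.-integrable _ _).
apply/funext => x; rewrite patchE; case: ifPn => //= /negP nQ.
have [//|/gM[x1 x2]] := eqVneq (g x) 0; first by move=> ->.
by exfalso; apply: nQ; rewrite inE; exact: box_sq.
Qed.

Lemma line_integral_vanish (F F' : R -> R) (M : R) : 0 < M ->
  (forall t : R, is_derive t (1 : R) F (F' t)) -> continuous F' ->
  (forall t, M <= `|t| -> F t = 0) -> (forall t, M <= `|t| -> F' t = 0) ->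
  (\int[leb]_t (F' t)%:E = 0)%E.
Proof.
move=> M0 dF cF' FM F'M; have MM : - M <= M by lra.
have mI := measurable_itvR `[- M, M].
have fi : leb.-integrable `[- M, M]%classic (EFin \o F').
  apply: sqint_integrable1 => //; last exact: continuous_sqint_itv.
  have := lebesgue_measure_itv `[- M, M] => /= ->.
  by case: ifP => _; rewrite ?ltry// -EFinB ltry.
pose I : set R := [set` `[- M, M]].
transitivity (\int[leb]_(t in I) (F' t)%:E)%E.
  rewrite [RHS]integral_mkcond; apply: eq_integral => t _; rewrite patchE.
  case: ifPn => // /negP nt; rewrite F'M// leNgt; apply/negP => /ltW tM; apply: nt.
  by rewrite inE /I /= in_itv/= -ler_norml.
have := ftc_itv dF cF' MM; rewrite /Rintegral !FM; last 2 first.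
- by rewrite normrN gtr0_norm.
- by rewrite gtr0_norm.
rewrite subrr => E; rewrite -[LHS]fineK ?E//.
exact: integrable_fin_num.
Qed.

Lemma integral_dx_vanish g P (M : R) : 0 < M -> continuous g ->
  (forall y t : R, is_derive t (1 : R) (fun s => P (s, y)) (g (t, y))) ->
  (forall x, g x != 0 -> `|x.1| < M /\ `|x.2| < M) ->
  (forall x, P x != 0 -> `|x.1| < M /\ `|x.2| < M) ->
  (\int[area]_z (g z)%:E = 0)%E.
Proof.
move=> M0 cg dP gM PM; have gi := vanishing_integrable M0 cg gM.
rewrite -(integral21_prod_meas1 (m1 := leb) (m2 := leb) gi) /fubini_G.
rewrite -[RHS](integral0 leb setT); apply: eq_integral => y _.
apply: (line_integral_vanish M0 (dP y)).
- exact: continuous_hline.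
- move=> t tM; apply/eqP/negP => /negP /PM[/= t1 _]; by have := lt_le_trans t1 tM; rewrite ltxx.
- move=> t tM; apply/eqP/negP => /negP /gM[/= t1 _]; by have := lt_le_trans t1 tM; rewrite ltxx.
Qed.

Lemma integral_dy_vanish g P (M : R) : 0 < M -> continuous g ->
  (forall x t : R, is_derive t (1 : R) (fun s => P (x, s)) (g (x, t))) ->
  (forall x, g x != 0 -> `|x.1| < M /\ `|x.2| < M) ->
  (forall x, P x != 0 -> `|x.1| < M /\ `|x.2| < M) ->
  (\int[area]_z (g z)%:E = 0)%E.
Proof.
move=> M0 cg dP gM PM; have gi := vanishing_integrable M0 cg gM.
rewrite -(integral12_prod_meas1 (m1 := leb) (m2 := leb) gi) /fubini_F.
rewrite -[RHS](integral0 leb setT); apply: eq_integral => x _.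
apply: (line_integral_vanish M0 (dP x)).
- exact: continuous_vline.
- move=> t tM; apply/eqP/negP => /negP /PM[/= _ t1]; by have := lt_le_trans t1 tM; rewrite ltxx.
- move=> t tM; apply/eqP/negP => /negP /gM[/= _ t1]; by have := lt_le_trans t1 tM; rewrite ltxx.
Qed.

Variable Omega : set (R * R).
Hypothesis Omega_open : open Omega.

(** Off the closed support, [phi] vanishes in a neighbourhood, hence so do its derivatives. *)
Lemma test_support phi : test_function Omega phi ->
  exists2 M : R, 0 < M & forall x, phi x != 0 \/ d1 phi x != 0 \/ d2 phi x != 0 ->
    Omega x /\ (`|x.1| < M /\ `|x.2| < M).
Proof.
move=> [Cphi cpt supp]; set K := closure _ in cpt supp.
have [M [_ HM]] := compact_bounded cpt.
exists (Num.max 0 (M + 1) + 1); first by rewrite ltr_wpDl// le_max lexx.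
have Kx x : K x -> Omega x /\ (`|x.1| < Num.max 0 (M + 1) + 1 /\ `|x.2| < Num.max 0 (M + 1) + 1).
  move=> xK; split; first exact: supp.
  have := HM (Num.max 0 (M + 1)) ltac:(by rewrite lt_max ltrDl ltr01 orbT) x xK.
  rewrite /= prod_normE ge_max => /andP[x1 x2].
  by split; [apply: le_lt_trans x1 _|apply: le_lt_trans x2 _]; rewrite ltrDl.
have deriv0 x : ~ K x -> d1 phi x = 0 /\ d2 phi x = 0.
  move=> nK; have nz : \forall y \near x, phi y = 0.
    have : nbhs x (~` K) by apply: open_nbhs_nbhs; split => //; apply: closed_openC; exact: closed_closure.
    apply: filterS => y nKy; apply/eqP/negP => /negP phiy; apply: nKy.
    exact: subset_closure.
  have nz0 : phi x = 0 by exact: nbhs_singleton nz.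
  have D0 v : 'D_v phi x = 0.
    transitivity ('D_v (cst 0 : R * R -> R) x); last exact: derive_cst.
    by apply: near_eq_derive.
  by split; exact: D0.
move=> x H; apply: Kx; apply: contrapT => nK; have [z1 z2] := deriv0 x nK.
case: H => [phix|[|]]; rewrite ?z1 ?z2 ?eqxx//.
by apply: nK; exact: subset_closure.
Qed.

Lemma C1_mul_continuous f phi (df dphi : R * R -> R) : C1 f -> C1 phi ->
  continuous df -> continuous dphi -> continuous (fun x => f x * dphi x + df x * phi x).
Proof.
move=> Cf Cphi cdf cdphi x; apply: cvgD; apply: cvgM.
- exact: C1_continuous.
- exact: cdphi.
- exact: cdf.
- exact: C1_continuous.
Qed.

(** The integrand is the partial derivative of [f * phi], which vanishes outside a box. Fubini
    reduces the integral to lines, where it is a difference of end values. *)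
Lemma integration_by_parts1 f phi : C1 f -> test_function Omega phi ->
  (\int[area]_(x in Omega) (f x * d1 phi x + d1 f x * phi x)%:E = 0)%E.
Proof.
move=> Cf tphi; have [Cphi _ _] := tphi; have [M M0 HM] := test_support tphi.
pose g x := f x * d1 phi x + d1 f x * phi x.
have gM x : g x != 0 -> Omega x /\ (`|x.1| < M /\ `|x.2| < M).
  move=> gx; apply: HM; have [p0|] := eqVneq (phi x) 0; last by left.
  right; left; apply/negP => /eqP p1; move: gx; rewrite /g p0 p1 !mulr0 addr0.
  by rewrite eqxx.
have -> : (\int[area]_(x in Omega) (g x)%:E = \int[area]_x (g x)%:E)%E.
  rewrite integral_mkcond; apply: eq_integral => x _; rewrite patchE; case: ifPn => // /negP nO.
  have [->//|/gM[Ox _]] := eqVneq (g x) 0.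
  by exfalso; apply: nO; rewrite inE.
apply: (@integral_dx_vanish g (fun x => f x * phi x) M) => //.
- by apply: C1_mul_continuous => //; [case: Cf|case: Cphi].
- move=> y t; have := is_deriveM (C1_hline y Cf t) (C1_hline y Cphi t).
  by rewrite /g /GRing.scale/= [phi _ * _]mulrC.
- by move=> x /gM[].
- move=> x; rewrite mulf_eq0 negb_or => /andP[_ px].
  by have [] := HM x (or_introl px).
Qed.

Lemma integration_by_parts2 f phi : C1 f -> test_function Omega phi ->
  (\int[area]_(x in Omega) (f x * d2 phi x + d2 f x * phi x)%:E = 0)%E.
Proof.
move=> Cf tphi; have [Cphi _ _] := tphi; have [M M0 HM] := test_support tphi.
pose g x := f x * d2 phi x + d2 f x * phi x.
have gM x : g x != 0 -> Omega x /\ (`|x.1| < M /\ `|x.2| < M).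
  move=> gx; apply: HM; have [p0|] := eqVneq (phi x) 0; last by left.
  right; right; apply/negP => /eqP p1; move: gx; rewrite /g p0 p1 !mulr0 addr0.
  by rewrite eqxx.
have -> : (\int[area]_(x in Omega) (g x)%:E = \int[area]_x (g x)%:E)%E.
  rewrite integral_mkcond; apply: eq_integral => x _; rewrite patchE; case: ifPn => // /negP nO.
  have [->//|/gM[Ox _]] := eqVneq (g x) 0.
  by exfalso; apply: nO; rewrite inE.
apply: (@integral_dy_vanish g (fun x => f x * phi x) M) => //.
- by apply: C1_mul_continuous => //; [case: Cf|case: Cphi].
- move=> y t; have := is_deriveM (C1_vline y Cf t) (C1_vline y Cphi t).
  by rewrite /g /GRing.scale/= [phi _ * _]mulrC.
- by move=> x /gM[].
- move=> x; rewrite mulf_eq0 negb_or => /andP[_ px].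
  by have [] := HM x (or_introl px).
Qed.

End IntegrationByParts.

(** * Closures for a seminorm and compactness from finite-rank bounds *)

Section Closure.
Context {R : realType} {W : lmodType R}.
Variable q : W -> W -> R.
Hypothesis qI : semi_inner q.
Variable D : @submodule R W.

(** Closure for the seminorm of [q], without putting a topology on [W]. *)
Definition adherent (x : W) : Prop := forall e : R, 0 < e ->
  exists2 y, submodule_set D y & q (x - y) (x - y) <= e.

Lemma adherent_sub x : submodule_set D x -> adherent x.
Proof. by move=> Dx e e0; exists x => //; rewrite subrr (si0l qI) ltW. Qed.

Lemma adherent0 : adherent 0.
Proof. exact: adherent_sub (submodule0 D). Qed.

Lemma adherent_linear (c : R) (x y : W) : adherent x -> adherent y -> adherent (c *: x + y).
Proof.
move=> Hx Hy e e0; pose k := 4 * (1 + c ^+ 2).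
have k0 : 0 < k by rewrite mulr_gt0// ltr_wpDr ?sqr_ge0.
have [x' Dx' Hx'] := Hx (e / k) ltac:(by rewrite divr_gt0).
have [y' Dy' Hy'] := Hy (e / k) ltac:(by rewrite divr_gt0).
exists (c *: x' + y'); first exact: submodule_linear.
rewrite (_ : _ - _ = c *: (x - x') + (y - y')); last by rewrite scalerBr opprD addrACA.
apply: le_trans (si_sqD_le _ _ qI) _; rewrite (si_sqZ qI).
have ek : 4 * (1 + c ^+ 2) * (e / k) = e by rewrite -/k mulrCA mulfV ?gt_eqF// mulr1.
have := ler_wpM2l (sqr_ge0 c) Hx'; have := sqr_ge0 c; have ek0 : 0 <= e / k by rewrite divr_ge0 ?ltW.
move: ek0 ek Hy' Hx'; set t := e / k; move=> t0 tE ? ?.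
have := mulr_ge0 (sqr_ge0 c) t0; rewrite !mulrDr mulr1 in tE; lra.
Qed.

Definition closure_submodule := Submodule adherent0 adherent_linear.

Lemma adherent_seq x : adherent x -> exists y : nat -> W,
  (forall n, submodule_set D (y n)) /\ q (y n - x) (y n - x) @[n --> \oo] --> (0 : R).
Proof.
move=> Hx; have /choice[y Hy] (n : nat) : exists y, submodule_set D y /\
    q (y - x) (y - x) <= n.+1%:R^-1.
  have [|y Dy Hy] := Hx n.+1%:R^-1; first by rewrite invr_gt0.
  by exists y; rewrite (si_sqBC qI).
exists y; split=> [n|]; first exact: (Hy n).1.
apply: (@squeeze_cvgr _ _ _ _ (fun=> 0) (fun n => n.+1%:R^-1)).
- by near=> n; rewrite (si_ge0 qI) (Hy n).2.
- exact: cvg_cst.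
- exact: (@cvg_harmonic R).
Unshelve. all: by end_near. Qed.

(** Both forms are bounded by a multiple of [q], hence continuous along a sequence of [D] that
    approximates [x]. *)
Lemma adherent_le (b1 b2 : W -> W -> R) (K : R) : semi_inner b1 -> semi_inner b2 ->
  (forall x, b1 x x <= K * q x x) -> (forall x, b2 x x <= K * q x x) ->
  (forall x, submodule_set D x -> b1 x x <= b2 x x) ->
  forall x, adherent x -> b1 x x <= b2 x x.
Proof.
move=> b1I b2I b1K b2K b12 x /adherent_seq[y [Dy yx]].
pose p u v := `|K| * q u v.
have pI : semi_inner p.
  split=> [u v|c u v w|u]; rewrite /p; first by rewrite (siC qI).
    by rewrite (siDl qI) (siZl qI); ring.
  by rewrite mulr_ge0// (si_ge0 qI).
have px : p (y n - x) (y n - x) @[n --> \oo] --> (0 : R).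
  by rewrite -[X in _ --> X](mulr0 `|K|); apply: cvgM => //; exact: cvg_cst.
have Kp u : K * q u u <= p u u by rewrite ler_wpM2r ?(si_ge0 qI)// ler_norm.
have H (b : W -> W -> R) : semi_inner b -> (forall x, b x x <= K * q x x) ->
    b (y n) (y n) @[n --> \oo] --> b x x.
  move=> bI bK; apply: (@si_cvg _ _ _ p (fun=> b) _ y y x x _ pI) => //.
    by move=> _ w; exact: le_trans (bK w) (Kp w).
  exact: cvg_cst.
apply: (ler_cvg_to (H b1 b1I b1K) (H b2 b2I b2K)).
by apply: nearW => n; apply: b12.
Qed.

Lemma closure_complete : si_complete q ->
  si_complete (fun x y : submodule_type closure_submodule => q (submodule_val x) (submodule_val y)).
Proof.
move=> qC x xC; have [|y Hy] := qC (fun n => submodule_val (x n)).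
  by move=> e /xC[N HN]; exists N => n m Nn Nm; have := HN n m Nn Nm; rewrite submodule_valB.
have ady : adherent y.
  move=> e e0; have [|N HN] := Hy (e / 4); first by rewrite divr_gt0.
  have /(_ (e / 4))[|z Dz Hz] := submodule_valP (x N); first by rewrite divr_gt0.
  exists z => //; rewrite -(subrK (submodule_val (x N)) y) -addrA.
  apply: le_trans (si_sqD_le _ _ qI) _; rewrite (si_sqBC qI).
  have := HN N (leqnn N) => /= ?; lra.
exists (@submodule_in _ _ closure_submodule y ady) => e /Hy[N HN]; exists N => n Nn.
by have := HN n Nn; rewrite submodule_valB.
Qed.

End Closure.

Section FiniteRank.
Context {R : realType} {V : lmodType R} {S : eqType}.
Variables (a b0 : V -> V -> R) (w : S -> R) (L : S -> V -> R) (P : S -> Prop).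
Hypotheses (aI : semi_inner a) (b0I : semi_inner b0).
Let p x y := a x y + b0 x y.
Hypothesis LB : forall s x y, P s -> L s (x - y) = L s x - L s y.
Hypothesis L_le : forall s, P s -> exists K, forall x, L s x ^+ 2 <= K * p x x.
Hypothesis finite_rank : forall eps : R, 0 < eps -> exists l : seq S,
  (forall s, s \in l -> P s) /\
  forall x, b0 x x <= \sum_(s <- l) w s * L s x ^+ 2 + eps * a x x.

(** Along the sequence each [L s] is bounded, so it converges along the ultrafilter; finitely many
    of them are thus close at once, and the energy term of a difference is uniformly small. *)
Lemma finite_rank_compact (F : set_system nat) (x : nat -> V) (C : R) :
  UltraFilter F -> (forall n, p (x n) (x n) <= C) -> si_cauchy F b0 x.
Proof.
move=> FU xC e e0.
have C0 : 0 <= C by apply: le_trans (xC 0%N); rewrite addr_ge0 ?(si_ge0 aI) ?(si_ge0 b0I).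
have pI : semi_inner p by exact: semi_innerD.
(* Differences have energy at most 4 C, so the energy term stays below e / 2. *)
pose eps := e / (8 * (C + 1)).
have C1 : 0 < 8 * (C + 1) by rewrite mulr_gt0// ltr_wpDl.
have eps0 : 0 < eps by rewrite divr_gt0.
have [l [lP Hl]] := finite_rank eps0.
suff [A FA HA] : exists2 A, F A & forall n m, A n -> A m ->
    \sum_(s <- l) w s * L s (x n - x m) ^+ 2 <= e / 2.
  exists A => // n m An Am; apply: le_trans (Hl _) _.
  have := HA n m An Am; suff : eps * a (x n - x m) (x n - x m) <= e / 2 by move=> ? ?; lra.
  apply: (@le_trans _ _ (eps * (4 * C))); last first.
    rewrite /eps mulrAC ler_pdivrMr//; have := mulr_ge0 (ltW e0) C0; lra.
  rewrite ler_pM2l//.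
  have ax k : a (x k) (x k) <= C.
    by apply: le_trans (xC k); rewrite /p lerDl (si_ge0 b0I).
  have := si_ge0 aI (x n + x m); rewrite (si_sqD aI) (si_sqB aI).
  have := ax n; have := ax m; lra.
have {Hl} : forall s, s \in l -> P s by [].
have : 0 < e / 2 by rewrite divr_gt0.
move: (e / 2) => {e e0 eps C1 eps0 lP}e e0.
elim: l e e0 => [|s l ih] e e0 lP.
  by exists setT => [|n m _ _]; [exact: filterT|rewrite big_nil ltW].
have [||A FA HA] := ih (e / 2); first by rewrite divr_gt0.
  by move=> s' s'l; apply: lP; rewrite inE s'l orbT.
have Ps : P s by apply: lP; rewrite inE eqxx.
have [K HK] := L_le Ps.
have [|t Lt] := @ultra_cvg _ F (fun n => L s (x n)) (`|K| * C + 1).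
  apply: nearW => n; have t1 : L s (x n) ^+ 2 <= `|K| * C.
    apply: le_trans (HK _) _; apply: le_trans (ler_wpM2r (si_ge0 pI _) (ler_norm K)) _.
    by rewrite ler_wpM2l.
  have := sqr_ge0 (`|L s (x n)| - 1); rewrite sqrrB (real_normK (num_real _)).
  have := mulr_ge0 (normr_ge0 K) C0; lra.
(* Two values within sqrt d of the limit differ by at most 4 d in square, so the term of [s] takes
   at most half of [e]; the rest of the list gets the other half. *)
pose d := e / (8 * (`|w s| + 1)).
have w1 : 0 < 8 * (`|w s| + 1) by rewrite mulr_gt0// ltr_wpDl.
have d0 : 0 < Num.sqrt d by rewrite sqrtr_gt0 divr_gt0.
have Ld : F [set n | `|t - L s (x n)| < Num.sqrt d].
  by move/cvgrPdist_lt: Lt => /(_ _ d0).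
exists (A `&` [set n | `|t - L s (x n)| < Num.sqrt d]); first exact: filterI.
move=> n m [An Hn] [Am Hm]; rewrite big_cons (splitr e); apply: lerD; last exact: HA.
have sq k : `|t - L s (x k)| < Num.sqrt d -> (t - L s (x k)) ^+ 2 <= d.
  move=> /ltW H; rewrite -(real_normK (num_real (_ - _))) -[leRHS]sqr_sqrtr; last by rewrite divr_ge0 ?ltW.
  by rewrite ler_sqr ?nnegrE ?sqrtr_ge0.
have := sq _ Hn; have := sq _ Hm; rewrite LB//.
set y := L s (x n); set z := L s (x m) => hz hy.
have yz : (y - z) ^+ 2 <= 4 * d.
  have := sqr_ge0 ((t - y) + (t - z)); rewrite sqrrD.
  move: hz hy; rewrite !sqrrB => ? ?; lra.
apply: (@le_trans _ _ (`|w s| * (4 * d))).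
  apply: le_trans (ler_wpM2r (sqr_ge0 _) (ler_norm _)) _.
  by rewrite ler_wpM2l.
have dE : d * (8 * (`|w s| + 1)) = e by rewrite /d divfK ?gt_eqF.
have d1 : 0 < d by rewrite divr_gt0.
move: dE; rewrite !mulrDr mulr1; lra.
Qed.

End FiniteRank.

Section C1Linear.
Context {R : realType}.
Implicit Types f g : R * R -> R.

Lemma derive_linear (e : R * R) (c : R) f g (x : R * R) :
  differentiable f x -> differentiable g x ->
  'D_e (fun x => c * f x + g x) x = c * 'D_e f x + 'D_e g x.
Proof.
move=> df dg.
have Df : is_derive x e f ('D_e f x) by apply/derivableP/diff_derivable.
have Dg : is_derive x e g ('D_e g x) by apply/derivableP/diff_derivable.
have H := @is_deriveD R _ _ _ _ x e _ _ (@is_deriveZ R _ _ f c x e _ Df) Dg.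
exact: (@derive_val _ _ _ _ _ _ _ H).
Qed.

Lemma d1_linear (c : R) f g : C1 f -> C1 g ->
  d1 (fun x => c * f x + g x) = (fun x => c * d1 f x + d1 g x).
Proof. by move=> [df _ _] [dg _ _]; apply/funext => x; exact: derive_linear. Qed.

Lemma d2_linear (c : R) f g : C1 f -> C1 g ->
  d2 (fun x => c * f x + g x) = (fun x => c * d2 f x + d2 g x).
Proof. by move=> [df _ _] [dg _ _]; apply/funext => x; exact: derive_linear. Qed.

Lemma C1_linear (c : R) f g : C1 f -> C1 g -> C1 (fun x => c * f x + g x).
Proof.
move=> Cf Cg; have [df cf1 cf2] := Cf; have [dg cg1 cg2] := Cg.
have cl (h k : R * R -> R) : continuous h -> continuous k ->
    continuous (fun x => c * h x + k x).
  move=> ch ck x; apply: cvgD; last exact: ck.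
  by apply: cvgM; [exact: cvg_cst|exact: ch].
split.
- move=> x; have H := @differentiableZ _ _ _ f c x (df x).
  exact: (differentiableD H (dg x)).
- by rewrite d1_linear//; exact: cl.
- by rewrite d2_linear//; exact: cl.
Qed.

Lemma d1_cst (c : R) : d1 (fun=> c) = fun=> 0.
Proof. by apply/funext => x; rewrite /d1 derive_cst. Qed.

Lemma d2_cst (c : R) : d2 (fun=> c) = fun=> 0.
Proof. by apply/funext => x; rewrite /d2 derive_cst. Qed.

Lemma C1_cst (c : R) : C1 (fun _ : R * R => c).
Proof.
split; first by move=> x; exact: differentiable_cst.
  by rewrite d1_cst => x; exact: cvg_cst.
by rewrite d2_cst => x; exact: cvg_cst.
Qed.

End C1Linear.

Lemma fst_linear {R : realType} (U V : lmodType R) (c : R) (x y : U * V) :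
  (c *: x + y).1 = c *: x.1 + y.1.
Proof. by []. Qed.

Lemma snd_linear {R : realType} (U V : lmodType R) (c : R) (x y : U * V) :
  (c *: x + y).2 = c *: x.2 + y.2.
Proof. by []. Qed.

Lemma fct_linear {R : realType} (T : Type) (c : R) (f g : T -> R) :
  c *: f + g = fun z => c * f z + g z.
Proof. by []. Qed.

(** * Tuples of a function, its trace and its derivatives *)

Section State.
Variable R : realType.

Definition scalar_field : lmodType R := plane R -> R.
Definition field_pair : lmodType R := (scalar_field * scalar_field)%type.
(* the function, its boundary values, and its two partial derivatives *)
Definition state : lmodType R := (field_pair * field_pair)%type.

Implicit Types x y : state.
Definition st_fun x : plane R -> R := x.1.1.
Definition st_trace x : plane R -> R := x.1.2.
Definition st_d1 x : plane R -> R := x.2.1.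
Definition st_d2 x : plane R -> R := x.2.2.

Lemma st_funE (c : R) x y : st_fun (c *: x + y) = fun z => c * st_fun x z + st_fun y z.
Proof.
by rewrite /st_fun (@fst_linear R field_pair field_pair) (@fst_linear R scalar_field scalar_field) fct_linear.
Qed.
Lemma st_traceE (c : R) x y : st_trace (c *: x + y) = fun z => c * st_trace x z + st_trace y z.
Proof.
by rewrite /st_trace (@fst_linear R field_pair field_pair) (@snd_linear R scalar_field scalar_field) fct_linear.
Qed.
Lemma st_d1E (c : R) x y : st_d1 (c *: x + y) = fun z => c * st_d1 x z + st_d1 y z.
Proof.
by rewrite /st_d1 (@snd_linear R field_pair field_pair) (@fst_linear R scalar_field scalar_field) fct_linear.
Qed.
Lemma st_d2E (c : R) x y : st_d2 (c *: x + y) = fun z => c * st_d2 x z + st_d2 y z.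
Proof.
by rewrite /st_d2 (@snd_linear R field_pair field_pair) (@snd_linear R scalar_field scalar_field) fct_linear.
Qed.

Let subE x y : x - y = (- 1) *: y + x.
Proof. by rewrite scaleN1r addrC. Qed.
Let funE (f g : plane R -> R) : (fun z => (- 1) * g z + f z) = fun z => f z - g z.
Proof. by apply/funext => z; rewrite mulN1r addrC. Qed.

Lemma st_funB x y : st_fun (x - y) = fun z => st_fun x z - st_fun y z.
Proof. by rewrite subE st_funE funE. Qed.
Lemma st_traceB x y : st_trace (x - y) = fun z => st_trace x z - st_trace y z.
Proof. by rewrite subE st_traceE funE. Qed.
Lemma st_d1B x y : st_d1 (x - y) = fun z => st_d1 x z - st_d1 y z.
Proof. by rewrite subE st_d1E funE. Qed.
Lemma st_d2B x y : st_d2 (x - y) = fun z => st_d2 x z - st_d2 y z.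
Proof. by rewrite subE st_d2E funE. Qed.

Definition mk_state (u g d e : plane R -> R) : state := ((u, g), (d, e)).

End State.

Section Space.
Context {R : realType}.
Variable Omega : set (R * R).
Hypotheses (Omega_open : open Omega) (Omega_bounded : bounded_set Omega)
  (Omega_lipschitz : lipschitz_boundary Omega).
Notation Gamma := (boundary Omega).
Implicit Types f g h : R * R -> R.

Lemma measurable_domain : measurable (Omega : set (plane R)).
Proof. exact: open_measurable_plane. Qed.
Let mO := measurable_domain.

Lemma measurable_boundary : measurable (Gamma : set (plane R)).
Proof.
apply: measurableD; first by apply: closed_measurable_plane; exact: closed_closure.
by apply: open_measurable_plane; exact: open_interior.
Qed.
Let mG := measurable_boundary.

Let Ofin : (area Omega < +oo)%E. Proof. exact: area_finite. Qed.
Let Gfin : (arclength Gamma < +oo)%E. Proof. exact: arclength_boundary_finite. Qed.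

Lemma continuous_sqint_domain f : continuous f -> sqint area Omega (f : plane R -> R).
Proof.
have [M HM] := Omega_box Omega_bounded.
by move=> cf; apply: (continuous_sqint_area cf mO (M := M)) => // x /subset_closure; exact: HM.
Qed.

Lemma continuous_sqint_boundary f : continuous f -> sqint arclength Gamma (f : plane R -> R).
Proof.
have [M HM] := Omega_box Omega_bounded.
move=> cf; have [K HK] := continuous_box_bounded M cf.
apply: (@sqint_bounded _ _ _ _ _ mG Gfin K).
  by apply: (measurable_funS measurableT) => //; exact: continuous_measurable_plane.
by move=> x [/HM[? ?] _]; exact: HK.
Qed.

Definition state_sqint (x : state R) : Prop :=
  [/\ sqint area Omega (st_fun x), sqint arclength Gamma (st_trace x),
      sqint area Omega (st_d1 x) & sqint area Omega (st_d2 x)].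

Lemma state_sqint0 : state_sqint 0.
Proof. by split; exact: sqint0. Qed.

Lemma state_sqint_linear c x y : state_sqint x -> state_sqint y -> state_sqint (c *: x + y).
Proof.
move=> [x1 x2 x3 x4] [y1 y2 y3 y4].
split; rewrite (st_funE, st_traceE, st_d1E, st_d2E); exact: sqint_linear.
Qed.

Definition ambient := Submodule state_sqint0 state_sqint_linear.

Notation X := (submodule_type ambient).

Definition domain_form (x y : X) : R :=
  l2_ip area Omega (st_fun (submodule_val x)) (st_fun (submodule_val y)).
Definition boundary_form (x y : X) : R :=
  l2_ip arclength Gamma (st_trace (submodule_val x)) (st_trace (submodule_val y)).
Definition gradient_form (x y : X) : R :=
  l2_ip area Omega (st_d1 (submodule_val x)) (st_d1 (submodule_val y)) +
  l2_ip area Omega (st_d2 (submodule_val x)) (st_d2 (submodule_val y)).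
Definition mass_form (x y : X) : R := domain_form x y + boundary_form x y.
(** All four components are measured, so convergence of C^1 functions for this form combines the
    three limits that [trace] asks for. *)
Definition full_form (x y : X) : R := gradient_form x y + mass_form x y.

Lemma domain_formI : semi_inner domain_form.
Proof.
split=> [x y|c x y z|x]; rewrite /domain_form; first exact: l2_ipC.
  have [? ? ? ?] := submodule_valP x; have [? ? ? ?] := submodule_valP y.
  have [? ? ? ?] := submodule_valP z.
  by rewrite submodule_valE (st_funE, st_traceE, st_d1E, st_d2E); exact: l2_ip_linear.
exact: l2_ip_ge0.
Qed.

Lemma boundary_formI : semi_inner boundary_form.
Proof.
split=> [x y|c x y z|x]; rewrite /boundary_form; first exact: l2_ipC.
  have [? ? ? ?] := submodule_valP x; have [? ? ? ?] := submodule_valP y.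
  have [? ? ? ?] := submodule_valP z.
  by rewrite submodule_valE (st_funE, st_traceE, st_d1E, st_d2E); exact: l2_ip_linear.
exact: l2_ip_ge0.
Qed.

Lemma gradient_formI : semi_inner gradient_form.
Proof.
apply: semi_innerD.
  split=> [x y|c x y z|x]; first exact: l2_ipC.
    have [? ? ? ?] := submodule_valP x; have [? ? ? ?] := submodule_valP y.
    have [? ? ? ?] := submodule_valP z.
    by rewrite submodule_valE (st_funE, st_traceE, st_d1E, st_d2E); exact: l2_ip_linear.
  exact: l2_ip_ge0.
split=> [x y|c x y z|x]; first exact: l2_ipC.
  have [? ? ? ?] := submodule_valP x; have [? ? ? ?] := submodule_valP y.
  have [? ? ? ?] := submodule_valP z.
  by rewrite submodule_valE (st_funE, st_traceE, st_d1E, st_d2E); exact: l2_ip_linear.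
exact: l2_ip_ge0.
Qed.

Lemma mass_formI : semi_inner mass_form.
Proof. exact: semi_innerD domain_formI boundary_formI. Qed.

Lemma full_formI : semi_inner full_form.
Proof. exact: semi_innerD gradient_formI mass_formI. Qed.

Lemma full_form_complete : si_complete full_form.
Proof.
move=> x xC; pose v n := submodule_val (x n).
have vS n : state_sqint (v n) by exact: (submodule_valP (x n)).
pose ip1 (f g : plane R -> R) := l2_ip area Omega f g.
have E n m : full_form (x n - x m) (x n - x m) =
    (ip1 (fun z => st_d1 (v n) z - st_d1 (v m) z) (fun z => st_d1 (v n) z - st_d1 (v m) z) +
     ip1 (fun z => st_d2 (v n) z - st_d2 (v m) z) (fun z => st_d2 (v n) z - st_d2 (v m) z)) +
    (ip1 (fun z => st_fun (v n) z - st_fun (v m) z) (fun z => st_fun (v n) z - st_fun (v m) z) +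
     l2_ip arclength Gamma (fun z : plane R => st_trace (v n) z - st_trace (v m) z) (fun z => st_trace (v n) z - st_trace (v m) z)).
  by rewrite /full_form /gradient_form /mass_form /domain_form /boundary_form submodule_valB st_funB st_traceB st_d1B st_d2B.
have g0 := @l2_ip_ge0 _ (plane R) R area Omega.
have g0' := @l2_ip_ge0 _ (plane R) R arclength Gamma.
have [||u uS Hu] := @l2_complete _ _ _ area _ mO (fun n => st_fun (v n)).
- by move=> n; have [] := vS n.
- move=> e /xC[N HN]; exists N => n m Nn Nm; apply: le_trans (HN n m Nn Nm); rewrite E.
  by rewrite addrCA lerDl !addr_ge0 ?g0 ?g0'.
have [||t tS Ht] := @l2_complete _ _ _ arclength _ mG (fun n => st_trace (v n)).
- by move=> n; have [] := vS n.
- move=> e /xC[N HN]; exists N => n m Nn Nm; apply: le_trans (HN n m Nn Nm); rewrite E.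
  by rewrite addrA lerDr !addr_ge0 ?g0 ?g0'.
have [||G1 G1S HG1] := @l2_complete _ _ _ area _ mO (fun n => st_d1 (v n)).
- by move=> n; have [] := vS n.
- move=> e /xC[N HN]; exists N => n m Nn Nm; apply: le_trans (HN n m Nn Nm); rewrite E.
  by rewrite -addrA lerDl !addr_ge0 ?g0 ?g0'.
have [||G2 G2S HG2] := @l2_complete _ _ _ area _ mO (fun n => st_d2 (v n)).
- by move=> n; have [] := vS n.
- move=> e /xC[N HN]; exists N => n m Nn Nm; apply: le_trans (HN n m Nn Nm); rewrite E.
  by rewrite -addrA addrCA lerDl !addr_ge0 ?g0 ?g0'.
have lS : state_sqint (mk_state u t G1 G2) by split.
exists (@submodule_in _ _ ambient _ lS) => e e0.
have e4 : 0 < e / 4 by rewrite divr_gt0.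
have [N1 H1] := Hu _ e4; have [N2 H2] := Ht _ e4; have [N3 H3] := HG1 _ e4; have [N4 H4] := HG2 _ e4.
exists (maxn (maxn N1 N2) (maxn N3 N4)) => n; rewrite !geq_max => /andP[/andP[/H1 h1 /H2 h2] /andP[/H3 h3 /H4 h4]].
apply: le_trans (_ : e / 4 + e / 4 + (e / 4 + e / 4) <= e); last by lra.
rewrite /full_form /gradient_form /mass_form /domain_form /boundary_form submodule_valB st_funB st_traceB st_d1B st_d2B.
by apply: lerD; apply: lerD.
Qed.

Lemma C1_sqint f : C1 f -> state_sqint (mk_state f f (d1 f) (d2 f)).
Proof.
move=> Cf; have cf := C1_continuous Cf; have [_ c1 c2] := Cf.
have [S0 S1 S2] : [/\ sqint area Omega (f : plane R -> R), sqint area Omega (d1 f : plane R -> R) &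
    sqint area Omega (d2 f : plane R -> R)].
  by split; exact: continuous_sqint_domain.
exact (And4 S0 (continuous_sqint_boundary cf) S1 S2).
Qed.

Definition c1_lift f (Cf : C1 f) : X := @submodule_in _ _ ambient _ (C1_sqint Cf).

Definition is_lift (x : X) : Prop := exists2 f, C1 f & submodule_val x = (mk_state f f (d1 f) (d2 f)).

Lemma is_lift0 : is_lift 0.
Proof.
by exists (fun=> 0); [exact: C1_cst|rewrite d1_cst d2_cst].
Qed.

Lemma is_lift_linear c x y : is_lift x -> is_lift y -> is_lift (c *: x + y).
Proof.
move=> [f Cf xf] [g Cg yg]; exists (fun z => c * f z + g z); first exact: C1_linear.
by rewrite submodule_valE xf yg d1_linear// d2_linear.
Qed.

Definition lifts := Submodule is_lift0 is_lift_linear.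

End Space.

Lemma square_sum_semi_inner {R : realType} {W : lmodType R} {S : eqType} (w : S -> R)
    (L : S -> W -> R) (l : seq S) (a : W -> W -> R) :
  (forall s, s \in l -> 0 <= w s) ->
  (forall s c x y, s \in l -> L s (c *: x + y) = c * L s x + L s y) ->
  semi_inner a -> semi_inner (fun x y => \sum_(s <- l) w s * (L s x * L s y) + a x y).
Proof.
move=> w0 Ll aI; elim: l w0 Ll => [|s l ih] w0 Ll.
  by under eq_fun do under eq_fun do rewrite big_nil add0r.
have -> : (fun x y => \sum_(s' <- s :: l) w s' * (L s' x * L s' y) + a x y) =
    (fun x y => w s * (L s x * L s y) + (\sum_(s' <- l) w s' * (L s' x * L s' y) + a x y)).
  by apply/funext => x; apply/funext => y; rewrite big_cons addrA.
have sl : s \in s :: l by rewrite inE eqxx.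
apply: (@semi_innerD _ _ (fun x y => w s * (L s x * L s y))); last first.
  apply: ih => [s' s'l|s' c x y s'l]; first by apply: w0; rewrite inE s'l orbT.
  by apply: Ll; rewrite inE s'l orbT.
split=> [x y|c x y z|x]; first by rewrite [L s x * _]mulrC.
  by rewrite Ll//; ring.
by rewrite mulr_ge0 ?w0// -expr2 sqr_ge0.
Qed.

Section Closure.
Context {R : realType} {W : lmodType R} {S : eqType}.
Variables (q : W -> W -> R) (D : @submodule R W) (a : W -> W -> R) (w : S -> R) (L : S -> W -> R).
Hypotheses (qI : semi_inner q) (aI : semi_inner a) (a_le : forall x, a x x <= q x x).

(** The right-hand side is the quadratic form of a semi-inner product bounded by a multiple of [q],
    so [adherent_le] applies. This carries estimates for C^1 functions over to H^1. *)
Lemma adherent_finite_rank (l : seq S) (b : W -> W -> R) (eps : R) : 0 <= eps ->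
  semi_inner b -> (forall x, b x x <= q x x) ->
  (forall s, s \in l -> [/\ 0 <= w s, forall c x y, L s (c *: x + y) = c * L s x + L s y &
     exists K, forall x, L s x ^+ 2 <= K * q x x]) ->
  (forall x, submodule_set D x -> b x x <= \sum_(s <- l) w s * L s x ^+ 2 + eps * a x x) ->
  forall x, adherent q D x -> b x x <= \sum_(s <- l) w s * L s x ^+ 2 + eps * a x x.
Proof.
move=> eps0 bI b_le Hl Hb x.
have eI : semi_inner (fun x y => eps * a x y).
  split=> [u v|c u v z|u]; first by rewrite (siC aI).
    by rewrite (siDl aI) (siZl aI); ring.
  by rewrite mulr_ge0// (si_ge0 aI).
pose b2 u v := \sum_(s <- l) w s * (L s u * L s v) + eps * a u v.
have b2I : semi_inner b2.
  apply: square_sum_semi_inner => // [s /Hl[]//|s c u v /Hl[_ H _]]; exact: H.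
have b2E u : b2 u u = \sum_(s <- l) w s * L s u ^+ 2 + eps * a u u by [].
have [K HK] : exists K, forall u, b2 u u <= K * q u u.
  suff [K HK] : exists K, forall u, \sum_(s <- l) w s * L s u ^+ 2 <= K * q u u.
    by exists (K + eps) => u; rewrite b2E mulrDl lerD// ler_wpM2l.
  move: Hl {Hb b2 b2I b2E}; elim: l => [|s l ih] Hl.
    by exists 0 => u; rewrite big_nil mul0r.
  have [s' s'l|K HK] := ih; first by apply: Hl; rewrite inE s'l orbT.
  have [|w0 _ [K' HK']] := Hl s; first by rewrite inE eqxx.
  by exists (w s * K' + K) => u; rewrite big_cons mulrDl lerD// -mulrA ler_wpM2l.
move=> xad; rewrite -b2E; apply: (@adherent_le _ _ q qI D b b2 (Num.max 1 K)) => //.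
- by move=> u; apply: le_trans (b_le u) _; rewrite ler_peMl ?(si_ge0 qI)// le_max lexx.
- by move=> u; apply: le_trans (HK u) _; rewrite ler_wpM2r ?(si_ge0 qI)// le_max lexx orbT.
Qed.

End Closure.

Section Energy.
Context {R : realType}.
Variable Omega : set (R * R).
Hypotheses (Omega_open : open Omega) (Omega_bounded : bounded_set Omega)
  (Omega_lipschitz : lipschitz_boundary Omega).
Notation Gamma := (boundary Omega).
Notation X := (submodule_type (ambient Omega_open)).
Let mO := measurable_domain Omega_open.

Lemma gradient_form_le (x : X) : gradient_form x x <= full_form x x.
Proof. by rewrite /full_form lerDl (si_ge0 (mass_formI _)). Qed.
Lemma mass_form_le (x : X) : mass_form x x <= full_form x x.
Proof. by rewrite /full_form lerDr (si_ge0 (gradient_formI _)). Qed.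
Lemma domain_form_le (x : X) : domain_form x x <= full_form x x.
Proof. by apply: le_trans (mass_form_le x); rewrite /mass_form lerDl (si_ge0 (boundary_formI _)). Qed.

Lemma sqint_sub (A B : set (plane R)) (f : plane R -> R) : measurable A -> measurable B ->
  A `<=` B -> sqint area B f -> sqint area A f /\ l2_ip area A f f <= l2_ip area B f f.
Proof.
move=> mA mB AB fS; have mf : measurable_fun A f by apply: measurable_funS fS.1.
have le : (\int[area]_(x in A) (f x ^+ 2)%:E <= \int[area]_(x in B) (f x ^+ 2)%:E)%E.
  apply: (ge0_subset_integral area) => //; last by move=> x _; rewrite lee_fin sqr_ge0.
  by apply/measurable_EFinP; apply: measurable_funX; exact: fS.1.
have fA : sqint area A f by split=> //; exact: le_lt_trans le fS.2.
by split => //; rewrite -lee_fin -!l2_sqE.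
Qed.

Definition square_integral (q : @square R) (x : X) : R := \int[area]_(z in square_set q) st_fun (submodule_val x) z.

Section OneSquare.
Variable q : @square R.
Hypothesis qO : square_in Omega q.

Let q_area : area (square_set q) = (q.2.2 * q.2.2)%:E.
Proof. by case: qO => _ h0 _; exact: area_sq. Qed.

Let q_fin : (area (square_set q) < +oo)%E. Proof. by rewrite q_area ltry. Qed.

Let q_sqint (x : X) : sqint area (square_set q) (st_fun (submodule_val x)) /\
  l2_ip area (square_set q) (st_fun (submodule_val x)) (st_fun (submodule_val x)) <= domain_form x x.
Proof.
have [? _ _ _] := submodule_valP x; have [_ _ qO'] := qO.
by apply: sqint_sub => //; exact: measurable_square.
Qed.

Lemma square_integral_linear (c : R) (x y : X) :
  square_integral q (c *: x + y) = c * square_integral q x + square_integral q y.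
Proof.
have mq := @measurable_square _ q.
have ix := sqint_integrable1 mq q_fin (q_sqint x).1; have iy := sqint_integrable1 mq q_fin (q_sqint y).1.
rewrite /square_integral submodule_valE st_funE -RintegralZl// -RintegralD//.
by have := integrableZl mq c ix.
Qed.

(** Only the mass inside the domain enters, which is what makes the averages vanish in
    [l2_mass_domain]. *)
Lemma square_integral_le_domain (x : X) :
  square_integral q x ^+ 2 <= q.2.2 ^+ 2 * domain_form x x.
Proof.
have mq := @measurable_square _ q; have [xS xle] := q_sqint x.
have oneS : sqint area (square_set q) (fun=> 1).
  by apply: (@sqint_bounded _ _ _ area _ mq q_fin 1) => // z _; rewrite normr1.
have := l2_CS mq xS oneS; rewrite {1}/l2_ip.
rewrite (_ : (\int[area]_(z in _) _) = square_integral q x); last first.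
  by apply: eq_Rintegral => z _; rewrite mulr1.
rewrite (_ : l2_ip _ _ (fun=> 1) _ = q.2.2 ^+ 2); last first.
  have := l2_sqE mq oneS; rewrite (_ : (\int[area]_(z in _) _)%E = (q.2.2 ^+ 2)%:E); first by case.
  transitivity (\int[area]_(z in square_set q) 1%:E)%E.
    by apply: eq_integral => z _; rewrite expr1n.
  by rewrite integral_cst// mul1e expr2; exact: q_area.
by move=> /le_trans; apply; rewrite mulrC ler_wpM2l ?sqr_ge0.
Qed.

Lemma square_integral_le (x : X) :
  square_integral q x ^+ 2 <= q.2.2 ^+ 2 * full_form x x.
Proof.
apply: le_trans (square_integral_le_domain x) _.
by rewrite ler_wpM2l ?sqr_ge0 ?domain_form_le.
Qed.

End OneSquare.

Lemma lift_energy (x : X) f : C1 f -> submodule_val x = mk_state f f (d1 f) (d2 f) ->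
  energy Omega f = (gradient_form x x)%:E.
Proof.
move=> Cf xE; have [_ _ S1 S2] := submodule_valP x.
have m1 : measurable_fun Omega (d1 f : plane R -> R) by have := S1.1; rewrite xE.
have m2 : measurable_fun Omega (d2 f : plane R -> R) by have := S2.1; rewrite xE.
rewrite /gradient_form EFinD -(l2_sqE mO S1) -(l2_sqE mO S2) xE /energy.
rewrite -(ge0_integralD area mO) //.
- by move=> z _; rewrite lee_fin sqr_ge0.
- by apply/measurable_EFinP; exact: (measurable_funX 2 m1).
- by move=> z _; rewrite lee_fin sqr_ge0.
- by apply/measurable_EFinP; exact: (measurable_funX 2 m2).
Qed.

Lemma mass_finite_rank (eps : R) : 0 < eps -> exists l : seq (@square R),
  (forall q, q \in l -> square_in Omega q) /\
  forall x : X, adherent (@full_form R Omega Omega_open) (lifts Omega_open) x ->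
    mass_form x x <= \sum_(q <- l) q.1 * square_integral q x ^+ 2 + eps * gradient_form x x.
Proof.
move=> eps0; have [l [lO Hl]] := rellich Omega_open Omega_bounded Omega_lipschitz eps0.
exists l; split=> // x.
apply: (adherent_finite_rank (full_formI _) (gradient_formI _) gradient_form_le (ltW eps0)
  (mass_formI _) mass_form_le) => [q /lO qO|{}x [f Cf xE]].
  split; [by case: qO|by move=> c u v; exact: square_integral_linear|].
  by exists (q.2.2 ^+ 2) => u; exact: square_integral_le.
have [S1 S2 _ _] := submodule_valP x.
have mE : (mass_form x x)%:E = (\int[area]_(z in Omega) (f z ^+ 2)%:E +
    \int[arclength]_(z in Gamma) (f z ^+ 2)%:E)%E.
  rewrite /mass_form EFinD /domain_form /boundary_form -(l2_sqE mO S1).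
  by rewrite -(l2_sqE (measurable_boundary Omega) S2) xE.
have := Hl f Cf; rewrite (lift_energy Cf xE) -EFinM -EFinD -mE lee_fin.
move=> /le_trans; apply.
rewrite lerD2r le_eqVlt; apply/orP; left; apply/eqP.
by apply: eq_bigr => q _; rewrite /square_integral xE.
Qed.

(** For functions without energy: on each square they carry no more mass than their average does. *)
Lemma square_poincare_adherent (q : @square R) : square_in Omega q ->
  forall x : X, adherent (@full_form R Omega Omega_open) (lifts Omega_open) x ->
  l2_ip area (square_set q) (st_fun (submodule_val x)) (st_fun (submodule_val x)) <=
    square_integral q x ^+ 2 / q.2.2 ^+ 2 + 2 * q.2.2 ^+ 2 * gradient_form x x.
Proof.
move=> qO x xad; have [_ h0 qsub] := qO; have mq := @measurable_square _ q.
pose b (x y : X) := l2_ip area (square_set q) (st_fun (submodule_val x)) (st_fun (submodule_val y)).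
have sub (u : X) : sqint area (square_set q) (st_fun (submodule_val u)) /\
    l2_ip area (square_set q) (st_fun (submodule_val u)) (st_fun (submodule_val u)) <= domain_form u u.
  by have [uS _ _ _] := submodule_valP u; exact: sqint_sub mq mO qsub uS.
have bI : semi_inner b.
  split=> [u v|c u v z|u]; rewrite /b; first exact: l2_ipC.
    by rewrite submodule_valE st_funE; apply: l2_ip_linear => //; exact: (sub _).1.
  exact: l2_ip_ge0.
have k0 : 0 <= 2 * q.2.2 ^+ 2 by rewrite mulr_ge0 ?sqr_ge0.
have := @adherent_finite_rank _ _ _ (@full_form R Omega Omega_open) (lifts Omega_open)
  (@gradient_form R Omega Omega_open) (fun q : @square R => (q.2.2 ^+ 2)^-1) (@square_integral) (full_formI _) (gradient_formI _)
  gradient_form_le [:: q] b _ k0 bI _ _ _ x xad.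
rewrite big_seq1 [_^-1 * _]mulrC; apply.
- by move=> u; exact: le_trans (sub u).2 (domain_form_le u).
- move=> q'; rewrite inE => /eqP ->; split.
  + by rewrite invr_ge0 sqr_ge0.
  + by move=> c u v; exact: square_integral_linear.
  + by exists (q.2.2 ^+ 2) => u; exact: square_integral_le.
- move=> u [f Cf uE]; rewrite big_seq1 [_^-1 * _]mulrC -lee_fin -(l2_sqE mq (sub u).1) uE.
  apply: le_trans (square_poincare _ _ Cf h0) _.
  rewrite EFinD leeD//; first by rewrite /square_integral uE.
  rewrite [leRHS]EFinM lee_wpmul2l ?lee_fin// -(lift_energy Cf uE).
  apply: (ge0_subset_integral area) => //; last by move=> z _; rewrite lee_fin grad2_ge0.
  exact: measurable_funS (measurable_grad2 Cf).
Qed.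

End Energy.

(** * Connectedness seen through squares *)

Section LocallyConstant.
Context {R : realType}.
Variable Omega : set (R * R).
Hypotheses (Omega_open : open Omega) (Omega_connected : connected Omega).

Definition centered (x : R * R) (r : R) : @square R := (1, (x.1 - r, x.2 - r, 2 * r)).

Lemma centeredP x r y : square_set (centered x r) y <->
  (x.1 - r < y.1 <= x.1 + r) /\ (x.2 - r < y.2 <= x.2 + r).
Proof.
have E (t : R) : t - r + 2 * r = t + r by ring.
by rewrite /square_set /sq /centered /= !E; split=> [[/=]|[]]; rewrite !in_itv.
Qed.

Lemma centered_center x r : 0 < r -> square_set (centered x r) x.
Proof. by move=> r0; apply/centeredP; split; apply/andP; split; lra. Qed.

Lemma centered_sub x r r' : r <= r' -> square_set (centered x r) `<=` square_set (centered x r').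
Proof.
by move=> rr y /centeredP[/andP[? ?] /andP[? ?]]; apply/centeredP; split; apply/andP; split; lra.
Qed.

Lemma centered_shift x y r : `|y.1 - x.1| < r / 2 -> `|y.2 - x.2| < r / 2 ->
  square_set (centered y (r / 2)) `<=` square_set (centered x r).
Proof.
rewrite !ltr_norml => /andP[? ?] /andP[? ?] z /centeredP[/andP[? ?] /andP[? ?]].
by apply/centeredP; split; apply/andP; split; lra.
Qed.

(** [m] will be the mean of a function over a square. Squares replace points because values at
    points have no meaning modulo null sets; nested squares inside [Omega] link neighbouring
    points. *)
Lemma connected_square_constant (m : @square R -> R) :
  (forall q q', square_in Omega q -> square_in Omega q' ->
     square_set q' `<=` square_set q -> m q' = m q) ->
  exists c, forall q, square_in Omega q -> m q = c.
Proof.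
(* the B c are open and partition Omega *)
move=> m_mono; pose B (c : R) : set (R * R) :=
  [set x | exists r, [/\ 0 < r, square_set (centered x r) `<=` Omega & m (centered x r) = c]].
have inO x r : 0 < r -> square_set (centered x r) `<=` Omega -> square_in Omega (centered x r).
  by move=> r0 rO; split; rewrite //= mulr_gt0.
have oB c : open (B c).
  rewrite openE => x [r [r0 rO rc]].
  pose U : set (R * R) := [set y | `|y.1 - x.1| < r / 2] `&` [set y | `|y.2 - x.2| < r / 2].
  have oU : nbhs x U.
    have r2 : 0 < r / 2 by rewrite divr_gt0.
    have H1 : \forall y \near x, `|y.1 - x.1| < r / 2.
      have /cvgrPdist_lt/(_ _ r2) : (fst : R * R -> R) y @[y --> x] --> x.1 by exact: cvg_fst.
      by apply: filterS => y; rewrite distrC.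
    have H2 : \forall y \near x, `|y.2 - x.2| < r / 2.
      have /cvgrPdist_lt/(_ _ r2) : (snd : R * R -> R) y @[y --> x] --> x.2 by exact: cvg_snd.
      by apply: filterS => y; rewrite distrC.
    exact: filterI H1 H2.
  apply: filterS oU => y [/= y1 y2]; have sub := centered_shift y1 y2.
  have r2 : 0 < r / 2 by rewrite divr_gt0.
  have yO : square_set (centered y (r / 2)) `<=` Omega by exact: subset_trans sub rO.
  by exists (r / 2); split=> //; rewrite -rc; apply: m_mono => //; exact: inO.
have BO c : B c `<=` Omega by move=> x [r [r0 rO _]]; apply: rO; exact: centered_center.
have BU c c' x : B c x -> B c' x -> c = c'.
  move=> [r [r0 rO <-]] [r' [r'0 r'O <-]]; pose s := Num.min r r'.
  have s0 : 0 < s by rewrite lt_min r0.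
  have sr : square_set (centered x s) `<=` square_set (centered x r).
    by apply: centered_sub; rewrite ge_min lexx.
  have sr' : square_set (centered x s) `<=` square_set (centered x r').
    by apply: centered_sub; rewrite ge_min lexx orbT.
  have sO : square_set (centered x s) `<=` Omega by exact: subset_trans sr rO.
  by rewrite -(m_mono _ _ (inO _ _ r0 rO) (inO _ _ s0 sO) sr)
     -(m_mono _ _ (inO _ _ r'0 r'O) (inO _ _ s0 sO) sr').
have BqP q : square_in Omega q ->
    exists x r, [/\ 0 < r, square_set (centered x r) `<=` Omega & m (centered x r) = m q].
  case: q => w [[a b] h] qO; have [_ /= h0 qsub] := qO.
  have E : square_set (centered (a + h / 2, b + h / 2) (h / 2)) = square_set (w, (a, b, h)).
    by rewrite /square_set /sq /centered /= !addrK mulrCA mulfV ?pnatr_eq0// mulr1.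
  have h2 : 0 < h / 2 by rewrite divr_gt0.
  exists (a + h / 2, b + h / 2), (h / 2); split=> //; first by rewrite E.
  by apply: m_mono => //; [apply: inO => //; rewrite E|rewrite E].
have [[q0 q0O]|noq] := pselect (exists q, square_in Omega q); last first.
  by exists 0 => q qO; case: noq; exists q.
have [x0 [r0 [r00 r0O r0m]]] := BqP q0 q0O.
exists (m q0) => q qO; have [x [r [rp rO rm]]] := BqP q qO.
have : B (m q0) = Omega.
  apply: Omega_connected.
  - by exists x0, r0.
  - by exists (B (m q0)) => //; apply/esym/setIidPr; exact: BO.
  (* Within [Omega] the complement of [B (m q0)] is the union of the other classes, hence open. *)
  - exists (~` \bigcup_(c in [set c | c != m q0]) B c).
      by rewrite closedC; apply: bigcup_open => c _; exact: oB.
    apply/seteqP; split=> y.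
      move=> By; split; first exact: BO By.
      by move=> [c /= /negP + Bc]; apply; rewrite (BU _ _ _ Bc By).
    move=> [Oy nB]; have [e e0 He] := open_box Omega_open Oy.
    have yO : square_set (centered y (e / 2)) `<=` Omega.
      move=> z /centeredP[/andP[? ?] /andP[? ?]]; apply: He; rewrite ltr_norml;
        apply/andP; split; lra.
    have e2 : 0 < e / 2 by rewrite divr_gt0.
    have By : B (m (centered y (e / 2))) y by exists (e / 2).
    have [<-//|ne] := eqVneq (m (centered y (e / 2))) (m q0).
    by case: nB; exists (m (centered y (e / 2))).
move=> /seteqP[_ /(_ x (rO _ (centered_center _ rp)))] Bx.
rewrite -rm; apply: (BU _ _ x); last exact: Bx.
by exists r.
Qed.

End LocallyConstant.

Lemma semi_inner_val {R : realType} {W : lmodType R} (S : @submodule R W) (q : W -> W -> R) :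
  semi_inner q ->
  semi_inner (fun x y : submodule_type S => q (submodule_val x) (submodule_val y)).
Proof.
move=> qI; split=> [x y|c x y z|x]; first exact: siC.
  by rewrite submodule_valE (siDl qI) (siZl qI).
exact: si_ge0.
Qed.

(** * The forms of the Steklov problem on H^1 *)

Section Forms.
Context {R : realType}.
Variable Omega : set (R * R).
Hypotheses (Omega_open : open Omega) (Omega_bounded : bounded_set Omega)
  (Omega_lipschitz : lipschitz_boundary Omega) (Omega_connected : connected Omega).
Notation Gamma := (boundary Omega).
Let mO := measurable_domain Omega_open.
Let mG : measurable (Gamma : set (plane R)) := measurable_boundary Omega.
Let Gfin : (arclength Gamma < +oo)%E. Proof. exact: arclength_boundary_finite. Qed.

(* By the definition of trace, the functions having a weak gradient and a trace
   are exactly the limits of C^1 functions in this closure; see sobolev_state,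
   state_sobolev and state_trace. *)
Definition H1_submodule := closure_submodule (full_formI Omega_open) (lifts Omega_open).
Notation V := (submodule_type H1_submodule).

Definition state_of (v : V) : state R := submodule_val (submodule_val v).

Lemma state_of_sqint v : state_sqint Omega (state_of v).
Proof. exact: (submodule_valP (submodule_val v)). Qed.

Lemma state_of_linear c v w : state_of (c *: v + w) = c *: state_of v + state_of w.
Proof. by rewrite /state_of !submodule_valE. Qed.

Definition dirichlet_form (v w : V) : R := gradient_form (submodule_val v) (submodule_val w).
Definition l2_mass (v w : V) : R := mass_form (submodule_val v) (submodule_val w).
Definition weighted_form (r : plane R -> R) (v w : V) : R :=
  \int[arclength]_(x in Gamma) (r x * (st_trace (state_of v) x * st_trace (state_of w) x)).

Lemma dirichlet_formI : semi_inner dirichlet_form.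
Proof. exact: semi_inner_val (gradient_formI _). Qed.

Lemma l2_massI : semi_inner l2_mass.
Proof. exact: semi_inner_val (mass_formI _). Qed.

Lemma H1_complete : si_complete (fun x y => dirichlet_form x y + l2_mass x y).
Proof.
exact (@closure_complete _ _ _ (full_formI Omega_open) (lifts Omega_open) (@full_form_complete R Omega Omega_open)).
Qed.

Lemma l2_mass_compact (F : set_system nat) (x : nat -> V) (C : R) : UltraFilter F ->
  (forall n, dirichlet_form (x n) (x n) + l2_mass (x n) (x n) <= C) -> si_cauchy F l2_mass x.
Proof.
apply: (finite_rank_compact (w := fst) (L := fun q v => square_integral q (submodule_val v))
  (P := square_in Omega)).
- exact: dirichlet_formI.
- exact: l2_massI.
- move=> q v w qO; rewrite submodule_valB -(scaleN1r (submodule_val w)) addrC.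
  by rewrite square_integral_linear// mulN1r addrC.
- by move=> q qO; exists (q.2.2 ^+ 2) => v; exact: square_integral_le.
- move=> eps eps0; have [l [lO Hl]] := mass_finite_rank Omega_open Omega_bounded Omega_lipschitz eps0.
  by exists l; split=> // v; apply: Hl; exact: (submodule_valP v).
Qed.

Lemma trace_integrable v w : arclength.-integrable Gamma
  (EFin \o (fun x => st_trace (state_of v) x * st_trace (state_of w) x)).
Proof.
by have [_ vS _ _] := state_of_sqint v; have [_ wS _ _] := state_of_sqint w; exact: sqintM.
Qed.

Lemma weighted_integrable r v w : density Gamma r -> arclength.-integrable Gamma
  (EFin \o (fun x => r x * (st_trace (state_of v) x * st_trace (state_of w) x))).
Proof. by move=> rD; apply: integrable_density => //; exact: trace_integrable. Qed.

Lemma weighted_formI r : density Gamma r -> semi_inner (weighted_form r).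
Proof.
move=> rD; split=> [v w|c v w z|v].
- by apply: eq_Rintegral => x _; rewrite [st_trace (state_of v) x * _]mulrC.
- rewrite /weighted_form -RintegralZl//; last exact: weighted_integrable.
  rewrite -RintegralD//; last exact: weighted_integrable.
    by apply: eq_Rintegral => x _; rewrite state_of_linear st_traceE; ring.
  by have := integrableZl mG c (weighted_integrable v z rD).
- apply: Rintegral_ge0 => x Gx; rewrite -expr2 mulr_ge0 ?sqr_ge0//.
  by have /andP[] := rD.2 x Gx.
Qed.

Lemma weighted_form_le r v : density Gamma r -> weighted_form r v v <= l2_mass v v.
Proof.
move=> rD; apply: (@le_trans _ _ (boundary_form (submodule_val v) (submodule_val v))).
  apply: le_Rintegral => //; [exact: weighted_integrable|exact: trace_integrable|].
  move=> x Gx; rewrite -expr2 ler_piMl ?sqr_ge0//.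
  by have /andP[] := rD.2 x Gx.
by rewrite /l2_mass /mass_form lerDr (si_ge0 (domain_formI _)).
Qed.

Definition one_lift := c1_lift Omega_open Omega_bounded Omega_lipschitz (C1_cst (1 : R)).

Lemma one_adherent : adherent (@full_form R Omega Omega_open) (lifts Omega_open) one_lift.
Proof. by apply: adherent_sub; [exact: full_formI|exists (fun=> 1); first exact: C1_cst]. Qed.

Definition one_state : V := @submodule_in _ _ H1_submodule one_lift one_adherent.

Lemma dirichlet_one v : dirichlet_form one_state v = 0.
Proof.
rewrite /dirichlet_form /gradient_form /= /l2_ip.
have E (f : plane R -> R) (g : plane R -> R) : f = (fun=> 0) -> \int[area]_(x in Omega) (f x * g x) = 0.
  by move=> ->; rewrite /Rintegral; under eq_integral do rewrite mul0r; rewrite integral0.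
by rewrite !E ?addr0//= ?d1_cst ?d2_cst.
Qed.

(** Without energy, the Poincaré inequality makes [v] equal to its mean on every square, so means on
    nested squares agree and all are one constant [c]. Then all averages of [v - c *: one_state]
    vanish, and the Rellich inequality annihilates its mass on the domain and on the boundary. *)
Lemma dirichlet_kernel v : dirichlet_form v v = 0 ->
  exists c, l2_mass (v - c *: one_state) (v - c *: one_state) = 0.
Proof.
move=> v0.
pose m (q : @square R) := square_integral q (submodule_val v) / q.2.2 ^+ 2.
have oneq q : square_in Omega q -> square_integral q (submodule_val one_state) = q.2.2 ^+ 2.
  move=> [_ h0 _]; rewrite /square_integral /Rintegral /=.
  transitivity (fine (\int[area]_(z in square_set q) 1%:E)%E); first by congr fine; exact: eq_integral.
  rewrite integral_cst; last exact: measurable_square.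
  transitivity (fine (q.2.2 * q.2.2)%:E); last by rewrite expr2.
  by congr fine; rewrite mul1e; exact: area_sq.
have lin q c : square_in Omega q ->
    square_integral q (submodule_val (v - c *: one_state)) = square_integral q (submodule_val v) - c * q.2.2 ^+ 2.
  move=> qO; rewrite addrC -scaleNr submodule_valE square_integral_linear// oneq//; ring.
have d0 c : dirichlet_form (v - c *: one_state) (v - c *: one_state) = 0.
  rewrite (si_sqB dirichlet_formI) v0 (siZr dirichlet_formI) (siC dirichlet_formI v) dirichlet_one.
  by rewrite (siZl dirichlet_formI) dirichlet_one; ring.
have poin q c : square_in Omega q -> square_integral q (submodule_val (v - c *: one_state)) = 0 ->
    l2_ip area (square_set q) (st_fun (state_of (v - c *: one_state))) (st_fun (state_of (v - c *: one_state))) = 0.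
  move=> qO I0; apply/eqP; rewrite eq_le l2_ip_ge0 andbT.
  apply: le_trans (square_poincare_adherent qO (submodule_valP (v - c *: one_state))) _.
  by rewrite I0 -/(dirichlet_form _ _) d0; lra.
have mono q q' : square_in Omega q -> square_in Omega q' ->
    square_set q' `<=` square_set q -> m q' = m q.
  move=> qO q'O sub; have [_ h0 qsub] := qO; have [_ h'0 _] := q'O.
  have hn : q.2.2 ^+ 2 != 0 by rewrite expf_neq0// gt_eqF.
  have hn' : q'.2.2 ^+ 2 != 0 by rewrite expf_neq0// gt_eqF.
  have I0 : square_integral q (submodule_val (v - m q *: one_state)) = 0.
    by rewrite lin// /m divfK// subrr.
  have [uS _ _ _] := state_of_sqint (v - m q *: one_state).
  have [uSq _] := sqint_sub (measurable_square q) mO qsub uS.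
  have [uSq' le] := sqint_sub (measurable_square q') (measurable_square q) sub uSq.
  rewrite (poin _ _ qO I0) in le.
  have oneS : sqint area (square_set q') (fun=> 1).
    apply: (@sqint_bounded _ _ _ area _ (measurable_square q') _ 1) => //; last by move=> z _; rewrite normr1.
    by apply: le_lt_trans (ltry (q'.2.2 * q'.2.2)); rewrite le_eqVlt; apply/orP; left; apply/eqP; exact: area_sq.
  have CS := l2_CS (measurable_square q') uSq' oneS.
  have : square_integral q' (submodule_val (v - m q *: one_state)) ^+ 2 <= 0.
    rewrite (_ : square_integral _ _ = l2_ip area (square_set q') (st_fun (state_of (v - m q *: one_state))) (fun=> 1)).
      apply: le_trans CS _; have := l2_ip_ge0 area (square_set q') (fun _ : plane R => (1 : R)).
      have := l2_ip_ge0 area (square_set q') (st_fun (state_of (v - m q *: one_state))).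
      by move=> p1 p2; have -> : l2_ip area (square_set q') (st_fun (state_of (v - m q *: one_state)))
        (st_fun (state_of (v - m q *: one_state))) = 0; [apply/eqP; rewrite eq_le le p1|rewrite mul0r].
    by apply: eq_Rintegral => z _; rewrite mulr1.
  rewrite lin// => le0.
  have /eqP : (square_integral q' (submodule_val v) - m q * q'.2.2 ^+ 2) ^+ 2 = 0.
    by apply/eqP; rewrite eq_le le0 sqr_ge0.
  by rewrite sqrf_eq0 subr_eq0 => /eqP E; rewrite {1}/m E mulfK.
have [c Hc] := connected_square_constant Omega_open Omega_connected mono.
exists c; apply/eqP; rewrite eq_le (si_ge0 l2_massI) andbT.
(* The energy is 0, so any coefficient will do for it, here 1. *)
have [l [lO Hl]] := mass_finite_rank Omega_open Omega_bounded Omega_lipschitz (@ltr01 R).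
apply: le_trans (Hl _ (submodule_valP (v - c *: one_state))) _.
rewrite -/(dirichlet_form _ _) d0 mulr0 addr0 big_seq big1// => q /lO qO.
have [_ h0 _] := qO; rewrite lin// -(Hc q qO) /m divfK ?subrr ?expr0n ?mulr0//.
by rewrite expf_neq0// gt_eqF.
Qed.

Definition densities (beta : R) : set (plane R -> R) :=
  [set r | density Gamma r /\ \int[arclength]_(x in Gamma) r x = beta].

Lemma weighted_one r beta : densities beta r -> weighted_form r one_state one_state = beta.
Proof. by move=> [_ <-]; apply: eq_Rintegral => x _; rewrite /= !mulr1. Qed.

Lemma densities_nonempty alpha : 0 <= alpha <= 1 ->
  densities (alpha * fine (arclength Gamma)) !=set0.
Proof.
move=> a01; exists (fun=> alpha); split; first by split=> // x _.
rewrite /Rintegral integral_cst// fineM//.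
by rewrite ge0_fin_numE// measure_ge0.
Qed.

Lemma densities_compact beta (F : set_system nat) (r : nat -> plane R -> R) : UltraFilter F ->
  (forall n, densities beta (r n)) ->
  exists2 s, densities beta s & forall v w, weighted_form (r n) v w @[n --> F] --> weighted_form s v w.
Proof.
move=> FU rD; have [s sD Hs] := @density_weak_compact _ _ _ arclength _ mG Gfin F r FU (fun n => (rD n).1).
exists s; last by move=> v w; apply: Hs; exact: trace_integrable.
(* The prescribed integral passes to the limit because 1 is an integrable test function on a
   boundary of finite length. *)
split=> //; have oneI : arclength.-integrable Gamma (EFin \o (fun _ : plane R => (1 : R))).
  apply: sqint_integrable1 => //; apply: (@sqint_bounded _ _ _ arclength _ mG Gfin 1) => // z _.
  by rewrite normr1.
have E t : \int[arclength]_(x in Gamma) (t x * 1) = \int[arclength]_(x in Gamma) t x.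
  by apply: eq_Rintegral => x _; rewrite mulr1.
have := Hs _ oneI; rewrite E; under eq_fun do rewrite E (rD _).2.
by move=> H; apply/esym; apply: (cvg_unique _ (cvg_cst beta) H).
Qed.

End Forms.

(** A continuous functional that vanishes on [D] vanishes on its closure: [adherent_le] compares the
    rank-one form [ell x * ell y] with 0. *)
Lemma adherent_kernel {R : realType} {W : lmodType R} (q : W -> W -> R) (qI : semi_inner q)
    (D : @submodule R W) (ell : W -> R) (K : R) :
  (forall c x y, ell (c *: x + y) = c * ell x + ell y) ->
  (forall x, ell x ^+ 2 <= K * q x x) ->
  (forall x, submodule_set D x -> ell x = 0) -> forall x, adherent q D x -> ell x = 0.
Proof.
move=> ellL ellK ell0 x xad; pose b (x y : W) := ell x * ell y.
have bI : semi_inner b.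
  split=> [u v|c u v w|u]; rewrite /b; first by rewrite mulrC.
    by rewrite ellL; ring.
  by rewrite -expr2 sqr_ge0.
have zI : semi_inner (fun _ _ : W => 0 : R).
  by split=> // c u v w; rewrite mulr0 addr0.
have H : b x x <= 0.
  apply: (@adherent_le _ _ q qI D b (fun _ _ => 0) `|K|) => //.
  - by move=> u; apply: le_trans (ellK u) _; rewrite ler_wpM2r ?(si_ge0 qI)// ler_norm.
  - by move=> u; rewrite mulr_ge0 ?(si_ge0 qI).
  - by move=> u /ell0 E; rewrite /b E mul0r.
apply/eqP; rewrite -sqrf_eq0; apply/eqP/le_anti; rewrite sqr_ge0 andbT.
by rewrite expr2.
Qed.

(** * Agreement of the closure with weak gradients and traces *)

Section H1.
Context {R : realType}.
Variable Omega : set (R * R).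
Hypotheses (Omega_open : open Omega) (Omega_bounded : bounded_set Omega)
  (Omega_lipschitz : lipschitz_boundary Omega).
Notation Gamma := (boundary Omega).
Notation X := (submodule_type (ambient Omega_open)).
Notation V := (submodule_type (H1_submodule Omega_open)).
Let mO := measurable_domain Omega_open.
Let mG : measurable (Gamma : set (plane R)) := measurable_boundary Omega.

Definition gradient_of (s : state R) : R * R -> R * R := fun x => (st_d1 s x, st_d2 s x).

Lemma domain_formE (x : X) :
  (\int[area]_(z in Omega) (st_fun (submodule_val x) z ^+ 2)%:E)%E = (domain_form x x)%:E.
Proof. by have [S _ _ _] := submodule_valP x; exact: l2_sqE. Qed.

Lemma boundary_formE (x : X) :
  (\int[arclength]_(z in Gamma) (st_trace (submodule_val x) z ^+ 2)%:E)%E = (boundary_form x x)%:E.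
Proof. by have [_ S _ _] := submodule_valP x; exact: l2_sqE. Qed.

Lemma gradient_formE (x y : X) :
  (\int[area]_(z in Omega) (st_d1 (submodule_val x) z * st_d1 (submodule_val y) z +
     st_d2 (submodule_val x) z * st_d2 (submodule_val y) z)%:E)%E = (gradient_form x y)%:E.
Proof.
have [_ _ x1 x2] := submodule_valP x; have [_ _ y1 y2] := submodule_valP y.
have i1 := sqintM mO x1 y1; have i2 := sqintM mO x2 y2.
rewrite /gradient_form EFinD -(l2_ipE mO x1 y1) -(l2_ipE mO x2 y2).
by rewrite -(integralD mO i1 i2); apply: eq_integral => z _; rewrite /= EFinD.
Qed.

Lemma form_parts_le (x : X) : [/\ domain_form x x <= full_form x x,
  boundary_form x x <= full_form x x & gradient_form x x <= full_form x x].
Proof.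
have := si_ge0 (domain_formI _) x; have := si_ge0 (boundary_formI _) x.
have := si_ge0 (gradient_formI _) x; rewrite /full_form /mass_form => ? ? ?; split; lra.
Qed.

Lemma state_trace (v : V) : trace Omega (st_fun (state_of v)) (gradient_of (state_of v)) (st_trace (state_of v)).
Proof.
have [_ vS _ _] := state_of_sqint v; split; first exact: vS.
have [y [Dy yv]] := adherent_seq (full_formI Omega_open) (submodule_valP v).
have /choice[f Hf] n : exists f, C1 f /\ submodule_val (y n) = mk_state f f (d1 f) (d2 f).
  by have [f Cf E] := Dy n; exists f.
have sq0 (g : nat -> R) : (forall n, 0 <= g n <= full_form (y n - submodule_val v) (y n - submodule_val v)) ->
    (g n)%:E @[n --> \oo] --> (0 : R)%:E.
  move=> g01; apply: cvg_EFin; first exact: nearW.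
  apply: (squeeze_cvgr _ (cvg_cst 0) yv); exact: nearW.
exists f; split.
- by move=> n; exact: (Hf n).1.
- rewrite (_ : (fun n => _) = fun n => (domain_form (y n - submodule_val v) (y n - submodule_val v))%:E).
    by apply: sq0 => n; have [-> _ _] := form_parts_le (y n - submodule_val v); rewrite (si_ge0 (domain_formI _)).
  by apply/funext => n; rewrite -domain_formE submodule_valB st_funB (Hf n).2.
- rewrite (_ : (fun n => _) = fun n => (gradient_form (y n - submodule_val v) (y n - submodule_val v))%:E).
    by apply: sq0 => n; have [_ _ ->] := form_parts_le (y n - submodule_val v); rewrite (si_ge0 (gradient_formI _)).
  by apply/funext => n; rewrite -gradient_formE submodule_valB st_d1B st_d2B (Hf n).2.
- rewrite (_ : (fun n => _) = fun n => (boundary_form (y n - submodule_val v) (y n - submodule_val v))%:E).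
    by apply: sq0 => n; have [_ -> _] := form_parts_le (y n - submodule_val v); rewrite (si_ge0 (boundary_formI _)).
  by apply/funext => n; rewrite -boundary_formE submodule_valB st_traceB (Hf n).2.
Qed.

(** The difference of the two sides is a functional bounded for [full_form] which vanishes on C^1
    functions, hence on their closure. [F] and [G] select the function and one of its
    derivatives. *)
Lemma adherent_by_parts (F G : state R -> plane R -> R) (phi psi : plane R -> R) :
  (forall c x y, F (c *: x + y) = fun z => c * F x z + F y z) ->
  (forall c x y, G (c *: x + y) = fun z => c * G x z + G y z) ->
  (forall x : X, sqint area Omega (F (submodule_val x)) /\
     l2_ip area Omega (F (submodule_val x)) (F (submodule_val x)) <= full_form x x) ->
  (forall x : X, sqint area Omega (G (submodule_val x)) /\
     l2_ip area Omega (G (submodule_val x)) (G (submodule_val x)) <= full_form x x) ->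
  sqint area Omega phi -> sqint area Omega psi ->
  (forall f, C1 f -> (\int[area]_(x in Omega)
     (F (mk_state f f (d1 f) (d2 f)) x * phi x + G (mk_state f f (d1 f) (d2 f)) x * psi x)%:E = 0)%E) ->
  forall v : V, (\int[area]_(x in Omega) (F (state_of v) x * phi x)%:E =
    - \int[area]_(x in Omega) (G (state_of v) x * psi x)%:E)%E.
Proof.
move=> FL GL FS GS phiS psiS H v.
pose ell (x : X) := l2_ip area Omega (F (submodule_val x)) phi + l2_ip area Omega (G (submodule_val x)) psi.
have ell0 : ell (submodule_val v) = 0.
  apply: (adherent_kernel (K := 2 * l2_ip area Omega phi phi + 2 * l2_ip area Omega psi psi)
    (full_formI Omega_open) (D := lifts Omega_open)); last exact: submodule_valP v.
  - move=> c x y; rewrite /ell submodule_valE FL GL.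
    rewrite (l2_ip_linear mO c (FS x).1 (FS y).1 phiS) (l2_ip_linear mO c (GS x).1 (GS y).1 psiS).
    ring.
  - move=> x; have := l2_CS mO (FS x).1 phiS; have := l2_CS mO (GS x).1 psiS.
    have := sqr_ge0 (l2_ip area Omega (F (submodule_val x)) phi - l2_ip area Omega (G (submodule_val x)) psi).
    have := ler_wpM2r (l2_ip_ge0 area Omega phi) (FS x).2.
    have := ler_wpM2r (l2_ip_ge0 area Omega psi) (GS x).2.
    rewrite /ell sqrrB sqrrD; lra.
  - move=> x [f Cf xE]; have := H f Cf; rewrite -xE.
    have i1 := sqintM mO (FS x).1 phiS; have i2 := sqintM mO (GS x).1 psiS.
    under eq_integral do rewrite EFinD.
    rewrite (integralD mO i1 i2).
    rewrite (l2_ipE mO (FS x).1 phiS) (l2_ipE mO (GS x).1 psiS) -EFinD.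
    by move=> [].
rewrite (l2_ipE mO (FS _).1 phiS) (l2_ipE mO (GS _).1 psiS) -EFinN; congr EFin.
by apply/eqP; rewrite -addr_eq0; apply/eqP.
Qed.

Lemma state_parts_sqint (x : X) : [/\ sqint area Omega (st_fun (submodule_val x)) /\
     l2_ip area Omega (st_fun (submodule_val x)) (st_fun (submodule_val x)) <= full_form x x,
  sqint area Omega (st_d1 (submodule_val x)) /\
     l2_ip area Omega (st_d1 (submodule_val x)) (st_d1 (submodule_val x)) <= full_form x x &
  sqint area Omega (st_d2 (submodule_val x)) /\
     l2_ip area Omega (st_d2 (submodule_val x)) (st_d2 (submodule_val x)) <= full_form x x].
Proof.
have [S1 _ S2 S3] := submodule_valP x; have [d0 _ g0] := form_parts_le x.
by split; split => //; apply: le_trans g0; rewrite /gradient_form ?lerDl ?lerDr l2_ip_ge0.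
Qed.

Lemma state_sobolev (v : V) : sobolev Omega (st_fun (state_of v)) (gradient_of (state_of v)).
Proof.
have [S1 _ S2 S3] := state_of_sqint v; split=> // phi tphi; have [Cphi _ _] := tphi.
have [_ c1 c2] := Cphi; have c0 := C1_continuous Cphi.
have sq := continuous_sqint_domain Omega_open Omega_bounded.
split.
- apply: (@adherent_by_parts (@st_fun R) (@st_d1 R) (d1 phi) phi).
  + exact: st_funE.
  + exact: st_d1E.
  + by move=> x; have [] := state_parts_sqint x.
  + by move=> x; have [] := state_parts_sqint x.
  + exact: sq.
  + exact: sq.
  + by move=> f Cf; exact: integration_by_parts1.
- apply: (@adherent_by_parts (@st_fun R) (@st_d2 R) (d2 phi) phi).
  + exact: st_funE.
  + exact: st_d2E.
  + by move=> x; have [] := state_parts_sqint x.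
  + by move=> x; have [] := state_parts_sqint x.
  + exact: sq.
  + exact: sq.
  + by move=> f Cf; exact: integration_by_parts2.
Qed.

(** The approximating sequence provided by [trace] is a sequence of lifts converging for
    [full_form], which places the tuple in the closure. *)
Lemma sobolev_state u G g : sobolev Omega u G -> trace Omega u G g ->
  exists v : V, state_of v = mk_state u g (fun x => (G x).1) (fun x => (G x).2).
Proof.
move=> [uS G1S G2S _] [gS [f [Cf fu fG fg]]].
have S : state_sqint Omega (mk_state u g (fun x => (G x).1) (fun x => (G x).2)) by split.
pose x : X := @submodule_in _ _ (ambient Omega_open) _ S.
pose y n : X := c1_lift Omega_open Omega_bounded Omega_lipschitz (Cf n).
have yD n : submodule_set (lifts Omega_open) (y n) by exists (f n).
have real0 (h : nat -> R) : (h n)%:E @[n --> \oo] --> 0%E -> h n @[n --> \oo] --> (0 : R).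
  by move=> /fine_cvg.
have d0 : domain_form (y n - x) (y n - x) @[n --> \oo] --> (0 : R).
  apply: real0; rewrite (_ : (fun n => _) = fun n => (\int[area]_(z in Omega) ((f n z - u z) ^+ 2)%:E)%E)//.
  by apply/funext => n; rewrite -domain_formE submodule_valB st_funB.
have g0 : gradient_form (y n - x) (y n - x) @[n --> \oo] --> (0 : R).
  apply: real0; rewrite (_ : (fun n => _) = fun n => (\int[area]_(z in Omega)
      ((d1 (f n) z - (G z).1) ^+ 2 + (d2 (f n) z - (G z).2) ^+ 2)%:E)%E)//.
  by apply/funext => n; rewrite -gradient_formE submodule_valB st_d1B st_d2B.
have b0 : boundary_form (y n - x) (y n - x) @[n --> \oo] --> (0 : R).
  apply: real0; rewrite (_ : (fun n => _) = fun n => (\int[arclength]_(z in Gamma) ((f n z - g z) ^+ 2)%:E)%E)//.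
  by apply/funext => n; rewrite -boundary_formE submodule_valB st_traceB.
have q0 : full_form (y n - x) (y n - x) @[n --> \oo] --> (0 : R).
  rewrite (_ : 0 = 0 + (0 + 0) :> R); last by rewrite !addr0.
  exact: cvgD g0 (cvgD d0 b0).
have xad : adherent (@full_form R Omega Omega_open) (lifts Omega_open) x.
  move=> e e0; move/cvgrPdist_lt: q0 => /(_ e e0)[N _ /(_ N (leqnn N))] /=.
  rewrite sub0r normrN ger0_norm ?(si_ge0 (full_formI _))// => lt.
  exists (y N); first exact: yD.
  by rewrite (si_sqBC (full_formI Omega_open) x (y N)); exact: ltW lt.
by exists (@submodule_in _ _ (H1_submodule Omega_open) x xad).
Qed.

End H1.

(** * Steklov eigenvalues *)

Lemma ae_imply d (T : measurableType d) {R : realType} (mu : {measure set T -> \bar R}) (P Q : T -> Prop) :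
  (forall x, P x -> Q x) -> {ae mu, forall x, P x} -> {ae mu, forall x, Q x}.
Proof. by move=> PQ; apply: filterS. Qed.

Section Correspondence.
Context {R : realType}.
Variable Omega : set (R * R).
Hypotheses (Omega_open : open Omega) (Omega_bounded : bounded_set Omega)
  (Omega_lipschitz : lipschitz_boundary Omega) (Omega_connected : connected Omega).
Notation Gamma := (boundary Omega).
Notation V := (submodule_type (H1_submodule Omega_open)).
Let mO := measurable_domain Omega_open.
Let mG : measurable (Gamma : set (plane R)) := measurable_boundary Omega.
Let Gfin : (arclength Gamma < +oo)%E. Proof. exact: arclength_boundary_finite. Qed.

Lemma arclength_fin_num : arclength Gamma \is a fin_num.
Proof. by rewrite ge0_fin_numE// measure_ge0. Qed.

(** An admissible density changes only on a null set, so its boundary integrals are kept while the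
    bounds become valid everywhere. *)
Definition clamp (rho : R * R -> R) : plane R -> R := fun x => Num.max 0 (Num.min 1 (rho x)).

Lemma clamp_id (t : R) : 0 <= t <= 1 -> Num.max 0 (Num.min 1 t) = t.
Proof. by move=> /andP[t0 t1]; rewrite min_r// max_r. Qed.

Lemma measurable_clamp rho : measurable_fun Gamma (rho : plane R -> R) -> measurable_fun Gamma (clamp rho).
Proof. by move=> mr; apply: measurable_maxr => //; exact: measurable_minr. Qed.

Lemma clamp_density rho : measurable_fun Gamma (rho : plane R -> R) -> density Gamma (clamp rho).
Proof.
move=> mr; split; first exact: measurable_clamp.
by move=> x _; rewrite /clamp le_max lexx /= ge_max ler01 /= ge_min lexx.
Qed.

Section Weight.
Variables (alpha : R) (rho : R * R -> R).
Hypothesis rho_adm : admissible Omega alpha rho.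
Let mrho : measurable_fun Gamma (rho : plane R -> R). Proof. by case: rho_adm. Qed.

Lemma clamp_integral (f : plane R -> R) : measurable_fun Gamma f ->
  (\int[arclength]_(x in Gamma) (rho x * f x)%:E = \int[arclength]_(x in Gamma) (clamp rho x * f x)%:E)%E.
Proof.
move=> mf; apply: ae_eq_integral => //.
- by apply/measurable_EFinP; apply: measurable_funM.
- by apply/measurable_EFinP; apply: measurable_funM => //; exact: measurable_clamp.
- have [_ ae _] := rho_adm; apply: (ae_imply (mu := arclength) _ ae) => x H Gx.
  by rewrite /clamp clamp_id// H.
Qed.

Lemma clamp_densities : densities Omega (alpha * fine (arclength Gamma)) (clamp rho).
Proof.
split; first exact: clamp_density.
have [_ _ rI] := rho_adm.
have E1 (g : plane R -> R) : (\int[arclength]_(x in Gamma) (g x * 1)%:E = \int[arclength]_(x in Gamma) (g x)%:E)%E.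
  by apply: eq_integral => x _; rewrite mulr1.
have := clamp_integral (f := fun=> 1) ltac:(exact: measurable_cst).
by rewrite !E1 rI /Rintegral => <-; rewrite fineM// arclength_fin_num.
Qed.

Lemma weighted_formE (v w : V) :
  (\int[arclength]_(x in Gamma) (rho x * st_trace (state_of v) x * st_trace (state_of w) x)%:E =
   (weighted_form (clamp rho) v w)%:E)%E.
Proof.
have [_ v1 _ _] := state_of_sqint v; have [_ w1 _ _] := state_of_sqint w.
under eq_integral do rewrite -mulrA.
rewrite clamp_integral; last by apply: measurable_funM; [exact: v1.1|exact: w1.1].
rewrite fineK//; apply: integrable_fin_num => //.
by apply: weighted_integrable => //; exact: clamp_density.
Qed.

(** Functions with a gradient and a trace enter [V] by [sobolev_state] and come back by
    [state_sobolev] and [state_trace]; this matches the solutions and also the test functions of the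
    two equations. *)
Lemma steklov_solutionE (lam : R) u : steklov_solution Omega rho lam u <->
  exists2 v : V, st_fun (state_of v) = u &
    forall w, dirichlet_form v w = lam * weighted_form (clamp rho) v w.
Proof.
split=> [[G [g [su tu H]]]|[v vu H]].
  have [v vE] := sobolev_state Omega_open Omega_bounded Omega_lipschitz su tu.
  exists v; first by rewrite vE.
  move=> w; apply: EFin_inj; rewrite EFinM -weighted_formE -[LHS]gradient_formE.
  have sw := state_sobolev Omega_bounded w.
  have tw := state_trace w.
  by have := H _ _ _ sw tw; rewrite -!/(state_of _) vE.
exists (gradient_of (state_of v)), (st_trace (state_of v)); rewrite -vu; split.
- exact: state_sobolev.
- exact: state_trace.
- move=> f Hf h sf tf; have [w wE] := sobolev_state Omega_open Omega_bounded Omega_lipschitz sf tf.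
  have := congr1 EFin (H w); rewrite EFinM -weighted_formE.
  by rewrite -[X in X = _ -> _]gradient_formE -!/(state_of _) wE.
Qed.

End Weight.

Lemma state_of_lincomb k (c : nat -> R) (v : nat -> V) x :
  st_fun (state_of (lincomb k c v)) x = \sum_(i < k) c i * st_fun (state_of (v i)) x.
Proof.
have st0 : st_fun (state_of (0 : V)) x = 0.
  have := congr1 (fun s => st_fun s x) (state_of_linear (-1) (0 : V) 0); rewrite scaler0 addr0.
  by rewrite st_funE mulN1r addNr.
rewrite /lincomb; elim: k => [|k ih]; first by rewrite !big_ord0.
rewrite !big_ord_recr /= addrC state_of_linear st_funE ih addrC.
by [].
Qed.

Lemma domain_form_ae (v : V) : {ae area, forall x, Omega x -> st_fun (state_of v) x = 0} ->
  domain_form (submodule_val v) (submodule_val v) = 0.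
Proof.
move=> v0; apply: EFin_inj; rewrite -domain_formE -/(state_of v).
have [vS _ _ _] := state_of_sqint v.
rewrite (ae_eq_integral (fun=> 0%E)) ?integral0//.
  by apply/measurable_EFinP; apply: measurable_funX; exact: vS.1.
by apply: (ae_imply (mu := area) _ v0) => x H Ox; rewrite H// expr0n.
Qed.

Lemma domain_form_eq0 (v : V) : domain_form (submodule_val v) (submodule_val v) = 0 ->
  {ae area, forall x, Omega x -> st_fun (state_of v) x = 0}.
Proof.
move=> E; have I0 := congr1 EFin E; rewrite -domain_formE -/(state_of v) in I0.
have [vS _ _ _] := state_of_sqint v.
have mv : measurable_fun Omega (fun x : plane R => (st_fun (state_of v) x ^+ 2)%:E).
  by apply/measurable_EFinP; apply: measurable_funX; exact: vS.1.
have [+ _] := ae_eq_integral_abs area mO mv.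
have -> : (\int[area]_(x in Omega) `|(st_fun (state_of v) x ^+ 2)%:E| = 0)%E.
  by rewrite -[RHS]I0; apply: eq_integral => x _; rewrite gee0_abs// lee_fin sqr_ge0.
move=> /(_ erefl); apply: (ae_imply (mu := area)) => x H Ox.
by have [/eqP] := H Ox; rewrite sqrf_eq0 => /eqP.
Qed.

(** A function that vanishes almost everywhere has zero trace: its averages are 0, so the Rellich
    inequality bounds its mass by any multiple of its energy. Linear independence in [Omega] is
    thereby visible to boundary forms. *)
Lemma l2_mass_domain (v : V) : domain_form (submodule_val v) (submodule_val v) = 0 -> l2_mass v v = 0.
Proof.
move=> v0; apply/eqP; rewrite eq_le (si_ge0 (l2_massI _)) andbT; apply/ler_addgt0Pr => e e0.
rewrite add0r; pose d := dirichlet_form v v.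
have d0 : 0 <= d by rewrite (si_ge0 (dirichlet_formI _)).
have e1 : 0 < e / (d + 1) by rewrite divr_gt0// ltr_wpDl.
have [l [lO Hl]] := mass_finite_rank Omega_open Omega_bounded Omega_lipschitz e1.
apply: le_trans (Hl _ (submodule_valP v)) _.
rewrite big_seq big1 ?add0r => [|q /lO qO].
  rewrite -/(dirichlet_form v v) -/d mulrAC ler_pdivrMr ?ltr_wpDl//.
  by apply: ler_wpM2l; [exact: ltW|rewrite lerDl].
have := square_integral_le_domain qO (submodule_val v); rewrite v0 mulr0 => le0.
suff -> : square_integral q (submodule_val v) ^+ 2 = 0 by rewrite mulr0.
by apply/eqP; rewrite eq_le le0 sqr_ge0.
Qed.

Hypothesis Gamma_gt0 : (0 < arclength Gamma)%E.
Variable alpha : R.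
Hypotheses (alpha_gt0 : 0 < alpha) (alpha_le1 : alpha <= 1).
Let beta := alpha * fine (arclength Gamma).
Let beta_gt0 : 0 < beta.
Proof. by rewrite mulr_gt0// fine_gt0// Gamma_gt0. Qed.

Let aI := @dirichlet_formI R Omega Omega_open.
Let b0I := @l2_massI R Omega Omega_open.
Let bI r : densities Omega beta r -> semi_inner (@weighted_form R Omega Omega_open r).
Proof. by move=> [rD _]; exact: weighted_formI. Qed.
Let b_le r (w : V) : densities Omega beta r -> weighted_form r w w <= l2_mass w w.
Proof. by move=> [rD _]; exact: weighted_form_le. Qed.
Let a_kernel (w : V) : dirichlet_form w w = 0 -> exists c,
  l2_mass (w - c *: one_state Omega_open Omega_bounded Omega_lipschitz)
          (w - c *: one_state Omega_open Omega_bounded Omega_lipschitz) = 0.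
Proof. exact: dirichlet_kernel. Qed.
Let b_one r : densities Omega beta r -> weighted_form r
  (one_state Omega_open Omega_bounded Omega_lipschitz) (one_state Omega_open Omega_bounded Omega_lipschitz) = beta.
Proof. exact: weighted_one. Qed.
Let A_ne : densities Omega beta !=set0.
Proof. by apply: densities_nonempty => //; rewrite ltW. Qed.

Let pC : si_complete (fun x y : V => dirichlet_form x y + l2_mass x y).
Proof. exact (@H1_complete R Omega Omega_open). Qed.
Let b0_compact (F : set_system nat) (x : nat -> V) (C : R) : UltraFilter F ->
  (forall n, dirichlet_form (x n) (x n) + l2_mass (x n) (x n) <= C) -> si_cauchy F (@l2_mass R Omega Omega_open) x.
Proof. exact: l2_mass_compact. Qed.
Let A_compact (F : set_system nat) (r : nat -> plane R -> R) : UltraFilter F ->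
  (forall n, densities Omega beta (r n)) ->
  exists2 s, densities Omega beta s &
    forall v w : V, weighted_form (r n) v w @[n --> F] --> weighted_form s v w.
Proof. exact: densities_compact. Qed.

Lemma H1_coercive : exists C, forall r (w : V), densities Omega beta r ->
  l2_mass w w <= C * (dirichlet_form w w + weighted_form r w w).
Proof.
have [C HC] := (uniformly_coercive aI b0I pC b0_compact
  bI b_le a_kernel b_one beta_gt0).
by exists C.
Qed.

Definition H1_eigenvalue (k : nat) (r : plane R -> R) : \bar R :=
  eigenvalue_of (@dirichlet_form R Omega Omega_open) (@weighted_form R Omega Omega_open) k r.

Lemma H1_eigenvalue_inf k : exists2 r, densities Omega beta r &
  H1_eigenvalue k r = ereal_inf [set H1_eigenvalue k r' | r' in densities Omega beta].
Proof.
exact: (eigenvalue_of_inf aI b0I pC b0_compact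
  bI b_le a_kernel b_one beta_gt0 A_ne A_compact).
Qed.

Lemma H1_eigenvalue_sup k : exists2 r, densities Omega beta r &
  H1_eigenvalue k r = ereal_sup [set H1_eigenvalue k r' | r' in densities Omega beta].
Proof.
exact: (eigenvalue_of_sup aI b0I pC b0_compact
  bI b_le a_kernel b_one beta_gt0 A_ne A_compact).
Qed.

End Correspondence.

(** * Steklov eigenvalues as min-max levels *)

Section Eigenvalue.
Context {R : realType}.
Variable Omega : set (R * R).
Hypotheses (Omega_open : open Omega) (Omega_bounded : bounded_set Omega)
  (Omega_lipschitz : lipschitz_boundary Omega) (Omega_connected : connected Omega).
Notation Gamma := (boundary Omega).
Notation V := (submodule_type (H1_submodule Omega_open)).
Hypothesis Gamma_gt0 : (0 < arclength Gamma)%E.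
Variable alpha : R.
Hypotheses (alpha_gt0 : 0 < alpha) (alpha_le1 : alpha <= 1).
Notation beta := (alpha * fine (arclength Gamma)).
Notation a := (@dirichlet_form R Omega Omega_open).
Notation b := (@weighted_form R Omega Omega_open).
Let aI : semi_inner a. Proof. exact: dirichlet_formI. Qed.

(* With s_i = sqrt (t - lam_i), the difference of the two sides is the b-norm of
   sum_i c_i s_i v_i, since b (v_i) (v_j) = 0 whenever lam_i != lam_j. *)
Lemma eigen_comb_energy r k (v : nat -> V) (lam : nat -> R) (t : R) (c : nat -> R) :
  semi_inner (b r) -> (forall i, (i < k)%N -> lam i <= t) ->
  (forall i w, (i < k)%N -> a (v i) w = lam i * b r (v i) w) ->
  a (lincomb k c v) (lincomb k c v) <= t * b r (lincomb k c v) (lincomb k c v).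
Proof.
move=> bI lamt va; pose s i := Num.sqrt (t - lam i).
have ss i : (i < k)%N -> s i * s i = t - lam i.
  by move=> ik; rewrite -expr2 sqr_sqrtr// subr_ge0 lamt.
have sb i j : (i < k)%N -> (j < k)%N -> s i * s j * b r (v i) (v j) = (t - lam i) * b r (v i) (v j).
  move=> ik jk; have [lij|lij] := eqVneq (lam i) (lam j).
    by rewrite /s -lij -/(s i) ss.
  have : (lam i - lam j) * b r (v i) (v j) = 0.
    by rewrite mulrBl -va// (siC bI) -va// (siC aI) subrr.
  by move/eqP; rewrite mulf_eq0 subr_eq0 (negPf lij) /= => /eqP ->; rewrite !mulr0.
have E : t * b r (lincomb k c v) (lincomb k c v) - a (lincomb k c v) (lincomb k c v) =
    b r (lincomb k (fun i => c i * s i) v) (lincomb k (fun i => c i * s i) v).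
  rewrite !si_lincombl// mulr_sumr -sumrB; apply: eq_bigr => i _.
  rewrite va//.
  transitivity (c i * ((t - lam i) * b r (v i) (lincomb k c v))); first by ring.
  rewrite -mulrA; congr (c i * _).
  rewrite (siC bI) si_lincombl// (siC bI (v i)) si_lincombl// !mulr_sumr; apply: eq_bigr => j _.
  have := sb i j (ltn_ord i) (ltn_ord j); rewrite (siC bI (v i)) => sbE.
  transitivity (c j * ((t - lam i) * b r (v j) (v i))); first by ring.
  by rewrite -sbE; ring.
by rewrite -subr_ge0 E (si_ge0 bI).
Qed.

Section Weight.
Variable rho : R * R -> R.
Hypothesis rho_adm : admissible Omega alpha rho.
Let r := clamp rho.
Let rD : densities Omega beta r. Proof. exact: clamp_densities. Qed.
Let bI : semi_inner (b r). Proof. by apply: weighted_formI => //; case: rD. Qed.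

(** The given solutions need not be orthonormal. The min-max principle is applied to their span, on
    which [eigen_comb_energy] bounds the Rayleigh quotient by [t]. *)
Lemma eigenfamily_of_independent k (t : R) (u : 'I_k.+1 -> R * R -> R) : independent Omega u ->
  (forall i, exists2 lam, lam <= t & steklov_solution Omega rho lam (u i)) ->
  exists w lam, eigenfamily a (b r) k.+1 t w lam.
Proof.
move=> uI uS; have [C coer] := H1_coercive Omega_open Omega_bounded Omega_lipschitz Omega_connected
  Gamma_gt0 alpha_gt0.
have /choice[vl Hvl] (i : 'I_k.+1) : exists vl : V * R, [/\ st_fun (state_of vl.1) = u i, vl.2 <= t &
    forall w, a vl.1 w = vl.2 * b r vl.1 w].
  have [lam lt /(steklov_solutionE Omega_open Omega_bounded Omega_lipschitz rho_adm)[v vu va]] := uS i.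
  by exists (v, lam).
(* [inord] extends the finite families to sequences; it is the identity on the indices below
   [k.+1]. *)
pose v (i : nat) := (vl (inord i)).1; pose lam (i : nat) := (vl (inord i)).2.
have en c : a (lincomb k.+1 c v) (lincomb k.+1 c v) <= t * b r (lincomb k.+1 c v) (lincomb k.+1 c v).
  apply: (eigen_comb_energy (lam := lam)) => // i; first by move=> _; have [] := Hvl (inord i).
  by move=> w _; have [_ _] := Hvl (inord i); apply.
apply: (@minmax_eigenfamily _ _ a (@l2_mass R Omega Omega_open) _ _ _ _ (b r) C t v) => //.
- exact: l2_massI.
- exact (@H1_complete R Omega Omega_open).
- exact: l2_mass_compact.
- by move=> w; apply: weighted_form_le => //; case: rD.
- by move=> w; apply: coer.
(* A combination of zero weight has zero energy by [en], hence zero mass by coercivity; it vanishes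
   almost everywhere in [Omega], against independence. *)
- move=> c [i ik ci]; rewrite lt_neqAle (si_ge0 bI) andbT eq_sym; apply/eqP => b0.
  case/eqP: ci; have a0 : a (lincomb k.+1 c v) (lincomb k.+1 c v) = 0.
    by apply/eqP; rewrite eq_le (si_ge0 aI) andbT; have := en c; rewrite b0 mulr0.
  have m0 : l2_mass (lincomb k.+1 c v) (lincomb k.+1 c v) <= 0.
    by apply: le_trans (coer _ _ rD) _; rewrite a0 b0 addr0 mulr0.
  have d0 : domain_form (submodule_val (lincomb k.+1 c v)) (submodule_val (lincomb k.+1 c v)) = 0.
    apply/eqP; rewrite eq_le (si_ge0 (domain_formI _)) andbT; apply: le_trans m0.
    by rewrite /l2_mass /mass_form lerDl (si_ge0 (boundary_formI _)).
  have := uI (fun i => c i) _ (Ordinal ik); apply.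
  apply: (ae_imply (mu := area) _ (domain_form_eq0 d0)) => x H Ox.
  rewrite -[RHS](H Ox) state_of_lincomb; apply: eq_bigr => j _.
  by have [<- _ _] := Hvl j; rewrite /v inord_val.
Qed.

(** A combination vanishing in [Omega] has zero trace by [l2_mass_domain], so its weighted mass, the
    sum of the squared coefficients, is 0. *)
Lemma independent_of_eigenfamily k (t : R) (w : nat -> V) (lam : nat -> R) :
  eigenfamily a (b r) k.+1 t w lam ->
  exists2 u : 'I_k.+1 -> R * R -> R, independent Omega u &
    forall i, exists2 lam, lam <= t & steklov_solution Omega rho lam (u i).
Proof.
move=> H; exists (fun i => st_fun (state_of (w i))); last first.
  move=> i; have [lt aw] := H.2 i (ltn_ord i); exists (lam i) => //.
  apply/(steklov_solutionE Omega_open Omega_bounded Omega_lipschitz rho_adm).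
  by exists (w i).
move=> c c0 i; pose c' (j : nat) := c (inord j).
have d0 : domain_form (submodule_val (lincomb k.+1 c' w)) (submodule_val (lincomb k.+1 c' w)) = 0.
  apply: domain_form_ae; apply: (ae_imply (mu := area) _ c0) => x Hx Ox.
  rewrite state_of_lincomb -[RHS](Hx Ox); apply: eq_bigr => j _.
  by rewrite /c' inord_val.
have m0 := l2_mass_domain Omega_bounded Omega_lipschitz d0.
have : b r (lincomb k.+1 c' w) (lincomb k.+1 c' w) <= 0.
  by rewrite -m0; apply: weighted_form_le => //; case: rD.
rewrite (eigenfamily_normsq c' bI H) => s0.
have /eqP : \sum_(j < k.+1) c' j ^+ 2 = 0.
  by apply/eqP; rewrite eq_le s0 sumr_ge0// => j _; exact: sqr_ge0.
rewrite psumr_eq0 => [|j _]; last exact: sqr_ge0.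
move=> /allP/(_ i (mem_index_enum i)) /=; rewrite sqrf_eq0 /c' inord_val.
by move=> /eqP.
Qed.

Lemma steklov_eigenvalueE k : steklov_eigenvalue Omega rho k = H1_eigenvalue Omega_open k r.
Proof.
rewrite /steklov_eigenvalue /H1_eigenvalue /eigenvalue_of; congr ereal_inf; congr image.
apply/seteqP; split=> t /=.
  by move=> [u uI uS]; exact: eigenfamily_of_independent uI uS.
by move=> [w [lam H]]; exact: independent_of_eigenfamily H.
Qed.

End Weight.

Lemma densities_admissible r : densities Omega beta r -> admissible Omega alpha r.
Proof.
move=> [[mr r01] rI]; have Gfin := arclength_boundary_finite Omega_open Omega_bounded Omega_lipschitz.
have mG : measurable (Gamma : set (plane R)) := measurable_boundary Omega.
split=> //; first by apply: aeW => x Gx; exact: r01.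
have ri : arclength.-integrable Gamma (EFin \o r).
  by apply: sqint_integrable1 => //; apply: density_sqint.
transitivity (\int[arclength]_(x in Gamma) r x)%:E.
  by rewrite fineK//; exact: integrable_fin_num.
by rewrite rI EFinM fineK// ge0_fin_numE// measure_ge0.
Qed.

Lemma clamp_densityE k r : densities Omega beta r ->
  steklov_eigenvalue Omega r k = H1_eigenvalue Omega_open k r.
Proof.
move=> rD; rewrite steklov_eigenvalueE; last exact: densities_admissible.
rewrite /H1_eigenvalue /eigenvalue_of.
suff -> : weighted_form (clamp r) = b r by [].
apply/funext => v; apply/funext => w; apply: eq_Rintegral => x; rewrite inE => Gx.
by rewrite /clamp clamp_id//; case: rD => -[_ r01] _; exact: r01.
Qed.

Lemma admissible_values k :
  [set steklov_eigenvalue Omega rho k | rho in admissible Omega alpha] =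
  [set H1_eigenvalue Omega_open k r | r in densities Omega beta].
Proof.
apply/seteqP; split=> _ [r rA <-].
  by exists (clamp r); [exact: clamp_densities|rewrite steklov_eigenvalueE].
by exists r; [exact: densities_admissible|exact: clamp_densityE].
Qed.

Lemma steklov_extremal k :
  (exists2 rho, admissible Omega alpha rho & steklov_eigenvalue Omega rho k =
     ereal_inf [set steklov_eigenvalue Omega rho' k | rho' in admissible Omega alpha]) /\
  (exists2 rho, admissible Omega alpha rho & steklov_eigenvalue Omega rho k =
     ereal_sup [set steklov_eigenvalue Omega rho' k | rho' in admissible Omega alpha]).
Proof.
rewrite admissible_values; split.
  have [r rD rE] := H1_eigenvalue_inf Omega_open Omega_bounded Omega_lipschitz Omega_connected
    Gamma_gt0 alpha_gt0 alpha_le1 k.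
  by exists r; [exact: densities_admissible|rewrite clamp_densityE].
have [r rD rE] := H1_eigenvalue_sup Omega_open Omega_bounded Omega_lipschitz Omega_connected
  Gamma_gt0 alpha_gt0 alpha_le1 k.
by exists r; [exact: densities_admissible|rewrite clamp_densityE].
Qed.

End Eigenvalue.

Lemma steklov_eigenvalue_null {R : realType} (Omega : set (R * R)) (rho rho' : R * R -> R) k :
  measurable_fun (boundary Omega) (rho : plane R -> R) ->
  measurable_fun (boundary Omega) (rho' : plane R -> R) ->
  arclength (boundary Omega) = 0%E ->
  steklov_eigenvalue Omega rho k = steklov_eigenvalue Omega rho' k.
Proof.
move=> mr mr' G0; have mG : measurable (boundary Omega : set (plane R)) := measurable_boundary Omega.
have int0 (r g h : plane R -> R) : measurable_fun (boundary Omega) r ->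
    measurable_fun (boundary Omega) g -> measurable_fun (boundary Omega) h ->
    (\int[arclength]_(x in boundary Omega) (r x * g x * h x)%:E = 0)%E.
  move=> mr1 mg mh; apply: null_set_integral => //; apply/measurable_EFinP.
  by apply: measurable_funM => //; exact: measurable_funM.
have sub (r1 r2 : R * R -> R) lam u : measurable_fun (boundary Omega) (r1 : plane R -> R) ->
    measurable_fun (boundary Omega) (r2 : plane R -> R) ->
    steklov_solution Omega r1 lam u -> steklov_solution Omega r2 lam u.
  move=> m1 m2 [G [g [sG tg H]]]; exists G, g; split=> // v Hv h sv tv.
  have [[mg _] _] := tg; have [[mh _] _] := tv.
  by rewrite (H v Hv h sv tv) (int0 _ _ _ m1 mg mh) (int0 _ _ _ m2 mg mh).
rewrite /steklov_eigenvalue; congr ereal_inf; congr image; apply/seteqP; split=> t /= [u uI uS];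
  exists u => // i; have [lam lt s] := uS i; exists lam => //; exact: sub s.
Qed.

Theorem theorem1p1 (R : realType) (Omega : set (R * R))
    (Omega_open : open Omega) (Omega_bounded : bounded_set Omega)
    (Omega_connected : connected Omega)
    (Gamma_lipschitz : lipschitz_boundary Omega)
    (Gamma_connected : connected (boundary Omega))
    (k : nat) (k_ge1 : (1 <= k)%N)
    (alpha : R) (alpha_gt0 : 0 < alpha) (alpha_le1 : alpha <= 1) :
  (exists2 rho, admissible Omega alpha rho &
     steklov_eigenvalue Omega rho k =
     ereal_inf [set steklov_eigenvalue Omega rho' k
               | rho' in admissible Omega alpha]) /\
  (exists2 rho, admissible Omega alpha rho &
     steklov_eigenvalue Omega rho k =
     ereal_sup [set steklov_eigenvalue Omega rho' k
               | rho' in admissible Omega alpha]).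
Proof.
(* if the boundary is null (for instance if Omega = set0), rho plays no role *)
have [G0|G0] := eqVneq (arclength (boundary Omega)) 0%E; last first.
  by apply: steklov_extremal => //; rewrite lt0e G0 measure_ge0.
have adm : admissible Omega alpha (fun=> alpha).
  split; [exact: measurable_cst|by apply: aeW => x _; rewrite ltW|].
  by rewrite integral_cst//; exact: measurable_boundary.
have -> : [set steklov_eigenvalue Omega rho' k | rho' in admissible Omega alpha] =
    [set steklov_eigenvalue Omega (fun=> alpha) k].
  apply/seteqP; split=> [_ [r [mr _ _] <-]|_ ->].
    by apply: steklov_eigenvalue_null => //; exact: measurable_cst.
  by exists (fun=> alpha).
by rewrite ereal_inf1 ereal_sup1; split; exists (fun=> alpha).
Qed.
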